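(* Let $E$ be a real Hausdorff locally convex topological vector space, $n\in\mathbb{N}$, $k\in\mathbb{N}_0$, let $U\subseteq\mathbb{R}^n$ be a locally convex subset with dense interior, and let $A\subseteq U$ be a relatively closed, locally compact, locally convex subset with dense interior. Then the restriction map \[C^k(U,E)\to C^k(A,E),\quad f\mapsto f|_A\] has a continuous linear right inverse.
   Context: $\mathbb{N}=\{1,2,\dots\}$, $\mathbb{N}_0=\mathbb{N}\cup\{0\}$; $\alpha$ denotes multi-indices in $(\mathbb{N}_0)^n$. Subsets carry the induced topology. Sets. A subset $U\subseteq\mathbb{R}^n$ is called locally convex if each $x\in U$ has a convex neighbourhood in $U$ (for the induced topology). It has dense interior if its interior $U^\circ$ in $\mathbb{R}^n$ is dense in $U$. $C^k$-functions. Let $U\subseteq\mathbb{R}^n$ be locally convex with dense interior, $k\in\mathbb{N}_0\cup\{\infty\}$. A function $f\colon U\to E$ is $C^0$ if it is continuous. For $k\ge1$, $f$ is $C^k$ if $f$ is continuous and for all $l\in\mathbb{N}$ with $l\le k$ the iterated directional derivatives $d^{(l)}f(x,y_1,\dots,y_l)=(D_{y_l}\cdots D_{y_1}f)(x)$, where $(D_yf)(x)=\lim_{t\to0}\frac{f(x+ty)-f(x)}{t}$, exist for all $x\in U^\circ$, $y_i\in\mathbb{R}^n$, the function $d^{(l)}f\colon U^\circ\times(\mathbb{R}^n)^l\to E$ is continuous and it has a (necessarily unique) continuous extension $d^{(l)}f\colon U\times(\mathbb{R}^n)^l\to E$. For $|\alpha|\le k$, $\partial^\alpha f\colon U\to E$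 is the continuous extension to $U$ of the iterated partial derivative of $f|_{U^\circ}$ ($\partial^0f=f$). $C^k(U,E)$ is the vector space of $C^k$-functions $U\to E$, with the compact-open $C^k$-topology: the locally convex topology generated by the seminorms $\|f\|_{C^l,q,K}=\max_{|\alpha|\le l}\sup_{x\in K}q(\partial^\alpha f(x))$, for $l\in\mathbb{N}_0$ with $l\le k$, continuous seminorms $q$ on $E$, compact $K\subseteq U$. *)

(* Defs.v *)
From HB Require Import structures.
From mathcomp Require Import all_boot all_order all_algebra.
From mathcomp Require Import all_classical all_reals all_analysis.

Set Implicit Arguments.
Unset Strict Implicit.
Unset Printing Implicit Defensive.

Import Order.TTheory GRing.Theory Num.Theory.
Import numFieldNormedType.Exports.

Local Open Scope classical_set_scope.
Local Open Scope ring_scope.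

Section Sets.
Context {R : realType} {n : nat}.
Implicit Type U : set 'rV[R]_n.

(* [within U (nbhs x) C] with [C `<=` U]: C is a neighbourhood of x in U. *)
Definition locally_convex_set U : Prop :=
  forall x, U x -> exists C : set 'rV[R]_n,
    [/\ convex_set C, C `<=` U & within U (nbhs x) C].

Definition has_dense_interior U : Prop := U `<=` closure U°.

Definition relatively_closed U (A : set 'rV[R]_n) : Prop :=
  closed (set_val @^-1` A : set U).

(* [locally_compact A] in the ambient space would be vacuous, as the compact
   neighbourhoods it provides need not be contained in A. *)
Definition locally_compact_set (A : set 'rV[R]_n) : Prop :=
  locally_compact [set: A].

End Sets.

Section IteratedDerivatives.
Context {R : realType} {n : nat} {E : tvsType R}.
Implicit Types (g : 'rV[R]_n -> E) (W : set 'rV[R]_n) (ys : seq 'rV[R]_n).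

(* The library's [derive] is only available for normed codomains. *)
Definition is_dir_deriv g (x y : 'rV[R]_n) (d : E) : Prop :=
  (fun t : R => t^-1 *: (g (x + t *: y) - g x)) @ 0^' --> d.

Definition dir_deriv g (y : 'rV[R]_n) : 'rV[R]_n -> E :=
  fun x => xget 0 [set d | is_dir_deriv g x y d].

(* [iter_deriv g [:: y_1; ...; y_l]] is D_{y_l} ... D_{y_1} g. *)
Definition iter_deriv g ys : 'rV[R]_n -> E := foldl dir_deriv g ys.

(* All the directional derivatives involved in [iter_deriv g ys] exist at
   every point of W. *)
Fixpoint iter_derivable W g ys : Prop :=
  if ys is y :: ys' then
    (forall x, W x -> exists d, is_dir_deriv g x y d) /\
    iter_derivable W (dir_deriv g y) ys'
  else True.

End IteratedDerivatives.

Section Ck.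
Context {R : realType} {n : nat} {E : tvsType R}.
Implicit Type U : set 'rV[R]_n.

(* d^(l) f (x, y_1, ..., y_l) for x in U°, where y_1, ..., y_l are the rows of
   Y.  Here f is extended by 0 outside of U, which does not affect the iterated
   derivatives on the open set U°. *)
Definition dk U (f : U -> E) l (x : 'rV[R]_n) (Y : 'M[R]_(l, n)) : E :=
  iter_deriv ('valL_ 0 f) [seq row i Y | i <- enum 'I_l] x.

Definition is_Ck k U (f : U -> E) : Prop :=
  continuous f /\
  forall l, (0 < l <= k)%N ->
  [/\ forall Y : 'M[R]_(l, n),
        iter_derivable U° ('valL_ 0 f) [seq row i Y | i <- enum 'I_l],
      {within U° `*` setT, continuous (fun z => dk f z.1 z.2 : E)
         : 'rV[R]_n * 'M[R]_(l, n) -> E} &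
      exists F : U * 'M[R]_(l, n) -> E, continuous F /\
        forall (x : U) Y, U° (set_val x) -> F (x, Y) = dk f (set_val x) Y].

(* The directions e_i, each repeated a_i times. *)
Definition multi_directions (a : 'I_n -> nat) : seq 'rV[R]_n :=
  flatten [seq nseq (a i) (delta_mx 0 i) | i <- enum 'I_n].

(* The continuous extension to U of the iterated partial derivative on U°; it
   is unique when U° is dense in U and E is Hausdorff. *)
Definition partial U (f : U -> E) (a : 'I_n -> nat) : U -> E :=
  xget (fun=> 0) [set h : U -> E | continuous h /\
    forall x : U, U° (set_val x) ->
      h x = iter_deriv ('valL_ 0 f) (multi_directions a) (set_val x)].

Definition continuous_seminorm (q : E -> R) : Prop :=
  [/\ forall x y, q (x + y) <= q x + q y,
      forall (a : R) x, q (a *: x) = `|a| * q x &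
      continuous q].

(* The multi-indices a with |a| <= l have all entries at most l. *)
Definition Ck_norm U l (q : E -> R) (K : set U) (f : U -> E) : R :=
  \big[Num.max/0]_(a : {ffun 'I_n -> 'I_l.+1} | (\sum_i a i <= l)%N)
    sup [set q (partial f (fun i => a i) x) | x in K].

End Ck.

Section Closure.
Context {R : realType} {n : nat} {E : tvsType R} (hE : hausdorff_space E).
Implicit Types (W : set 'rV[R]_n) (U : set 'rV[R]_n).

Lemma cvg_lincomb (T : Type) (F : set_system T) (FF : Filter F) (a : R)
    (u v : T -> E) (lu lv : E) :
  u @ F --> lu -> v @ F --> lv ->
  (fun t => a *: u t + v t) @ F --> a *: lu + lv.
Proof.
move=> hu hv.
apply: (@continuous2_cvg _ _ _ _ _ FF _ v (fun x y : E => x + y)) => //.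
  exact: (@add_continuous E (_, _)).
apply: (@continuous2_cvg _ _ _ _ _ FF _ u (fun (x : R^o) (y : E) => x *: y)).
- exact: (@scale_continuous R E (a, lu)).
- exact: cvg_cst.
- exact: hu.
Qed.

Lemma continuous_lincomb (T : topologicalType) (a : R) (u v : T -> E) :
  continuous u -> continuous v -> continuous (fun t => a *: u t + v t).
Proof. by move=> cu cv t; apply: cvg_lincomb; [exact: cu|exact: cv]. Qed.

Lemma dir_derivE (g : 'rV[R]_n -> E) x y d :
  is_dir_deriv g x y d -> dir_deriv g y x = d.
Proof.
move=> gd; rewrite /dir_deriv; case: xgetP => [d' _ /= gd'|/(_ d)//].
exact: (cvg_unique hE gd' gd).
Qed.

Lemma is_dir_deriv_lincomb W (a : R) (u g h : 'rV[R]_n -> E) x y d e :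
  open W -> (forall z, W z -> u z = a *: g z + h z) -> W x ->
  is_dir_deriv g x y d -> is_dir_deriv h x y e ->
  is_dir_deriv u x y (a *: d + e).
Proof.
move=> oW uE Wx gd he; rewrite /is_dir_deriv.
have H := @cvg_lincomb _ _ (dnbhs_filter (0 : R)) a _ _ _ _ gd he.
apply: (cvg_trans _ H).
apply: near_eq_cvg.
have Wn : \forall t \near (0 : R), W (x + t *: y).
  have c : (fun t : R => x + t *: y) @ (0 : R) --> x.
    rewrite -[X in _ --> X]addr0 -[in X in _ --> X](scale0r y).
    apply: cvgD; first exact: cvg_cst.
    by apply: cvgZr_tmp; exact: cvg_id.
  by apply: c; exact: open_nbhs_nbhs.
have Wn' : \forall t \near (0 : R)^', W (x + t *: y) by exact: nbhs_dnbhs.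
apply: filterS Wn' => t Wt.
rewrite uE// uE// scalerA mulrC -scalerA -scalerDr; congr (_ *: _).
by rewrite scalerBr opprD addrACA.
Qed.

Lemma iter_deriv_lincomb W W' (a : R) ys : open W' -> W' `<=` W ->
  forall u g h : 'rV[R]_n -> E,
  (forall z, W' z -> u z = a *: g z + h z) ->
  iter_derivable W g ys -> iter_derivable W h ys ->
  iter_derivable W' u ys /\
  forall z, W' z ->
    iter_deriv u ys z = a *: iter_deriv g ys z + iter_deriv h ys z.
Proof.
move=> oW' sW; elim: ys => [|y ys IH] u g h uE //= [dg Ig] [dh Ih].
have D z : W' z -> exists d e, [/\ is_dir_deriv g z y d,
    is_dir_deriv h z y e & is_dir_deriv u z y (a *: d + e)].
  move=> W'z; have [d gd] := dg z (sW _ W'z); have [e he] := dh z (sW _ W'z).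
  by exists d, e; split => //; exact: (is_dir_deriv_lincomb oW' uE W'z gd he).
have duE z : W' z ->
    dir_deriv u y z = a *: dir_deriv g y z + dir_deriv h y z.
  move=> /D[d [e [gd he ud]]].
  by rewrite (dir_derivE gd) (dir_derivE he) (dir_derivE ud).
have [Iu uE'] := IH _ _ _ duE Ig Ih.
split; last exact: uE'.
by split => // z /D[d [e [_ _ ud]]]; exists (a *: d + e).
Qed.

Lemma iter_deriv_cst0 ys :
  iter_derivable setT (fun=> 0 : E) ys /\
  forall z : 'rV[R]_n, iter_deriv (fun=> 0 : E) ys z = 0.
Proof.
elim: ys => [|y ys IH] //=.
have D z : is_dir_deriv (fun=> 0 : E) z y 0.
  rewrite /is_dir_deriv.
  under eq_fun do rewrite subrr scaler0.
  exact: cvg_cst.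
have -> : dir_deriv (fun=> 0 : E) y = fun=> 0.
  by apply/funext => z; exact: dir_derivE (D z).
by case: IH => ? ?; split => //; split => // z _; exists 0.
Qed.

Lemma iter_derivable_subset W W' ys (g : 'rV[R]_n -> E) : W' `<=` W ->
  iter_derivable W g ys -> iter_derivable W' g ys.
Proof.
move=> sW; elim: ys g => [|y ys IH] g //= [dg Ig]; split; last exact: IH.
by move=> x /sW; exact: dg.
Qed.

Lemma valL0E U (f : U -> E) (x : U) : 'valL_ 0 f (set_val x) = f x.
Proof. exact: (congr1 (fun h => h x) (valLK 0 f)). Qed.

Lemma is_Ck_cst0 k U : is_Ck k (fun _ : U => 0 : E).
Proof.
have v0 : 'valL_ 0 (fun _ : U => 0 : E) = fun=> 0.
  apply/funext => x; case: (pselect (U x)) => Ux.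
    by have := valL0E (fun _ : U => 0 : E) (SigSub (mem_set Ux)).
  rewrite /= oinv_set_val insubN//; apply/negP => xU; apply: Ux.
  exact: set_mem xU.
split; first exact: cst_continuous.
move=> l _.
have d0 (x : 'rV[R]_n) (Y : 'M[R]_(l, n)) : dk (fun _ : U => 0 : E) x Y = 0.
  by rewrite /dk v0; case: (iter_deriv_cst0 [seq row i Y | i <- enum 'I_l]).
split.
- move=> Y; rewrite v0.
  have [I0 _] := iter_deriv_cst0 [seq row i Y | i <- enum 'I_l].
  exact: iter_derivable_subset I0.
- under eq_fun do rewrite d0.
  exact: cst_continuous.
- exists (fun=> 0); split; first exact: cst_continuous.
  by move=> x Y _; rewrite d0.
Qed.

Lemma is_Ck_lincomb k U (a : R) (f g : U -> E) :
  is_Ck k f -> is_Ck k g -> is_Ck k (a *: f + g).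
Proof.
move=> [cf Cf] [cg Cg]; split; first exact: continuous_lincomb.
move=> l lk; have [If Df [F [cF FE]]] := Cf l lk.
have [Ig Dg [G [cG GE]]] := Cg l lk.
have vE z : U° z ->
    'valL_ 0 (a *: f + g) z = a *: 'valL_ 0 f z + 'valL_ 0 g z.
  move=> /interior_subset Uz; pose x : U := SigSub (mem_set Uz).
  by rewrite -[z]/(set_val x) !valL0E.
have L Y := iter_deriv_lincomb (@open_interior _ U) (@subset_refl _ _)
  vE (If Y) (Ig Y).
have dE z (Y : 'M[R]_(l, n)) : U° z ->
    dk (a *: f + g) z Y = a *: dk f z Y + dk g z Y.
  by case: (L Y) => _; exact.
split.
- by move=> Y; case: (L Y).
- apply: (@subspace_eq_continuous _ _ _
      (fun z => a *: dk f z.1 z.2 + dk g z.1 z.2)).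
    by move=> [z Y] /set_mem[/= Uz _]; exact: esym (dE z Y Uz).
  exact: (continuous_lincomb (T := subspace _)).
- exists (fun z => a *: F z + G z); split; first exact: continuous_lincomb.
  by move=> x Y Ux; rewrite FE// GE// dE.
Qed.

Lemma subfun_continuous (T : topologicalType) (A B : set T) (AB : A `<=` B) :
  continuous (subfun AB).
Proof.
move=> x V [_ [[W oW <-] /= Wx WV]].
exists (set_val @^-1` W); split => //=; first by exists W.
by move=> y Wy; apply: WV.
Qed.

Lemma is_Ck_restr k U A (AU : A `<=` U) (f : U -> E) :
  is_Ck k f -> is_Ck k (f \o subfun AU).
Proof.
move=> [cf Cf]; split.
  move=> x; apply: continuous_comp; first exact: subfun_continuous.
  exact: cf.
have AU' : A° `<=` U° by exact: interiorS.
move=> l lk; have [If Df [F [cF FE]]] := Cf l lk.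
have vE z : A° z ->
    'valL_ 0 (f \o subfun AU) z = 1 *: 'valL_ 0 f z + 0.
  move=> /interior_subset Az; pose x : A := SigSub (mem_set Az).
  by rewrite scale1r addr0 -{1}[z]/(set_val x) -[z]/(set_val (subfun AU x)) !valL0E.
have I0 ys : iter_derivable U° (fun=> 0 : E) ys.
  by apply: iter_derivable_subset (iter_deriv_cst0 ys).1.
have L Y := iter_deriv_lincomb (@open_interior _ A) AU' vE (If Y) (I0 _).
have dE z (Y : 'M[R]_(l, n)) : A° z ->
    dk (f \o subfun AU) z Y = dk f z Y.
  by case: (L Y) => _ /[apply]; rewrite scale1r (iter_deriv_cst0 _).2 addr0.
split.
- by move=> Y; case: (L Y).
- apply: (@subspace_eq_continuous _ _ _ (fun z => dk f z.1 z.2)).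
    by move=> [z Y] /set_mem[/= Az _]; exact: esym (dE z Y Az).
  by apply: continuous_subspaceW Df => -[z Y] [/= /AU' Uz _].
- exists (fun z => F (subfun AU z.1, z.2)); split.
    move=> z; apply: (@continuous_comp _ _ _
      (fun z : A * 'M[R]_(l, n) => (subfun AU z.1, z.2)) F); last exact: cF.
    apply: (@cvg_pair _ _ _ (nbhs z) (nbhs (subfun AU z.1)) (nbhs z.2) _ _ _
      (fun z => subfun AU z.1) snd); last exact: cvg_snd.
    apply: (@cvg_comp _ _ _ fst (subfun AU) _ (nbhs z.1)); first exact: cvg_fst.
    exact: subfun_continuous.
  by move=> x Y Ax; rewrite FE ?dE//; exact: AU'.
Qed.

End Closure.

Definition Ck_pred {R : realType} {n : nat} {E : tvsType R} k
  (U : set 'rV[R]_n) : {pred U -> E} := fun f => `[< is_Ck k f >].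
Arguments Ck_pred {R n E} k U.

(* C^k(U, E).  The parameter hE is only there for the vector space structure:
   without it the limits defining the derivatives need not be unique. *)
Record Ck {R : realType} {n : nat} {E : tvsType R} (hE : hausdorff_space E)
    (k : nat) (U : set 'rV[R]_n) : Type := MkCk {
  Ck_fun :> U -> E ;
  Ck_funP : Ck_fun \in Ck_pred k U }.

Section CkSpace.
Context {R : realType} {n : nat} {E : tvsType R} (hE : hausdorff_space E).
Variables (k : nat) (U : set 'rV[R]_n).
Local Notation Ck := (Ck hE k U).
Local Notation Ck_pred := (@Ck_pred R n E k U).

HB.instance Definition _ := [isSub of Ck for @Ck_fun R n E hE k U].
HB.instance Definition _ := [Choice of Ck by <:].

Lemma Ck_submod_closed : submod_closed Ck_pred.
Proof.
split; first by apply/asboolP; exact: is_Ck_cst0.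
by move=> a f g /asboolP Cf /asboolP Cg; apply/asboolP; exact: is_Ck_lincomb.
Qed.

HB.instance Definition _ :=
  GRing.isSubmodClosed.Build R (U -> E) Ck_pred Ck_submod_closed.
HB.instance Definition _ := [SubChoice_isSubLmodule of Ck by <:].

(* The open balls of the seminorms [Ck_norm l q K]. *)
Definition Ck_subbase : set (set Ck) :=
  [set B | exists l (q : E -> R) (K : set U) (f : Ck) (e : R),
    [/\ (l <= k)%N, continuous_seminorm q, compact K, 0 < e &
        B = [set g | Ck_norm l q K (Ck_fun (g - f)) < e]]].

HB.instance Definition _ := isSubBaseTopological.Build Ck Ck_subbase id.

End CkSpace.

Section Restriction.
Context {R : realType} {n : nat} {E : tvsType R} (hE : hausdorff_space E).
Variables (k : nat) (U A : set 'rV[R]_n) (AU : A `<=` U).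

Lemma Ck_restrP (f : Ck hE k U) : f \o subfun AU \in Ck_pred k A.
Proof. by apply/asboolP/(is_Ck_restr hE)/asboolP; exact: Ck_funP. Qed.

Definition Ck_restr (f : Ck hE k U) : Ck hE k A := MkCk hE (Ck_restrP f).

End Restriction.

(* Main.v *)
Require Import Defs.
From HB Require Import structures.
From mathcomp Require Import all_boot all_order all_algebra.
From mathcomp Require Import all_classical all_reals all_analysis.
From mathcomp Require Import ring lra zify.

Set Implicit Arguments.
Unset Strict Implicit.
Unset Printing Implicit Defensive.

Import Order.TTheory GRing.Theory Num.Theory.
Import numFieldNormedType.Exports.

Local Open Scope classical_set_scope.
Local Open Scope ring_scope.

(** The right inverse is Whitney's extension operator.  The derivatives of a
    function are organised as a jet: a family [J w], indexed by the words [w] in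
    the coordinate directions, in which [J (i :: w)] is the i-th partial
    derivative of [J w] ([isjet]).  As [E] may be incomplete, integrals are
    avoided: Taylor's inequality ([taylor_remainder]) comes from the mean value
    inequality for seminorms ([mean_value]), and all sums are finite.

    The partial derivatives of a C^k function on [A] form a jet on [A].  In the
    interior this says that continuous partial derivatives give a total
    derivative ([partials_diff_at]); a boundary point is reached through convex
    neighbourhoods by pushing segments into the interior ([isjet_closure]).
    Conversely the first component of a jet is C^k ([jet_is_Ck]).

    It remains to extend jets from [A] to [U].  Each point of [U] lies in [A] or
    at a distance [d x > 0] from it, because [A] is relatively closed.  Off [A],
    the Taylor polynomials of the jet at suitable points of [A] are glued with a
    partition of unity by functions that live at distance and scale comparable
    to [d] ([whitney_partition]).  Local convexity of [A] makes Taylor's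
    inequality available between nearby points of [A] ([near_whitney]), so that
    the Taylor polynomials glued near a point [a] of [A] are close to each other;
    the growth of the derivatives of the partition is compensated, and near [a]
    the extension stays within [o(|x - a|^(k - size w))] of the Taylor polynomial
    at [a] ([jet_ext_estimate]).  Hence it is a jet on [U] ([isjet_jet_ext]).

    The extension is linear in the jet.  It is continuous because near each point
    of [U] its components are bounded by a constant times the supremum of those of
    the jet on a compact subset of [A], where local compactness provides compact
    neighbourhoods in [A] ([jet_extension]); compactness of a subset of [U] makes these
    bounds uniform on it ([extension_operator]). *)

(** * Convex combinations and linear identities *)

Section Convexity.
Context {R : realType} {M : lmodType R}.

Lemma convex_setP (C : set M) (x y : M) (t : R) : convex_set C ->
  C x -> C y -> 0 <= t -> t <= 1 -> C (t *: x + (1 - t) *: y).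
Proof.
move=> cC Cx Cy t0 t1.
have := cC x y (Itv01 t0 t1) (mem_set Cx) (mem_set Cy).
by rewrite inE.
Qed.

End Convexity.

(** Linear identities in a left module: both sides are expanded over their
    atoms, which leaves one equation between scalars for each atom. *)
Section LinearExpressions.
Context {R : realType} {E : lmodType R}.

Inductive lin_expr : Type :=
  | LinAtom of nat
  | LinZero
  | LinAdd of lin_expr & lin_expr
  | LinOpp of lin_expr
  | LinScale of R & lin_expr.

Fixpoint lin_eval (env : seq E) (t : lin_expr) : E :=
  match t with
  | LinAtom n => nth 0 env n
  | LinZero => 0
  | LinAdd u v => lin_eval env u + lin_eval env v
  | LinOpp u => - lin_eval env u
  | LinScale a u => a *: lin_eval env u
  end.

Fixpoint lin_coef (t : lin_expr) (i : nat) : R :=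
  match t with
  | LinAtom n => if eqn n i then 1 else 0
  | LinZero => 0
  | LinAdd u v => lin_coef u i + lin_coef v i
  | LinOpp u => - lin_coef u i
  | LinScale a u => a * lin_coef u i
  end.

Fixpoint lin_same (t u : lin_expr) (n : nat) : Prop :=
  if n is n'.+1 then lin_coef t n' = lin_coef u n' /\ lin_same t u n' else True.

Lemma lin_evalE env t :
  lin_eval env t = \sum_(i < size env) lin_coef t i *: nth 0 env i.
Proof.
elim: t => /= [n||u -> v ->|u ->|a u ->].
- have [ns|sn] := ltnP n (size env); last first.
    rewrite nth_default// big1// => i _.
    case: eqnP => [ni|_]; last by rewrite scale0r.
    by have := ltn_ord i; rewrite -ni ltnNge sn.
  rewrite (bigD1 (Ordinal ns))//= (introT eqnP)// scale1r big1 ?addr0//.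
  move=> i /eqP ni; case: eqnP => [e|_]; rewrite ?scale0r//.
  by case: ni; apply: val_inj.
- by rewrite big1// => i _; rewrite scale0r.
- by rewrite -big_split; apply: eq_bigr => i _; rewrite /= scalerDl.
- by rewrite -sumrN; apply: eq_bigr => i _; rewrite scaleNr.
- by rewrite scaler_sumr; apply: eq_bigr => i _; rewrite scalerA.
Qed.

Lemma lin_exprP env t u : lin_same t u (size env) ->
  lin_eval env t = lin_eval env u.
Proof.
move=> H; rewrite !lin_evalE; apply: eq_bigr => -[i /= ilt] _; congr (_ *: _).
elim: (size env) H ilt => // m IH /= [tu H]; rewrite ltnS leq_eqVlt.
by move=> /predU1P[->|] //; exact: IH.
Qed.

End LinearExpressions.

Ltac lin_mem x l :=
  lazymatch l with
  | nil => constr:(false)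
  | x :: _ => constr:(true)
  | _ :: ?l' => lin_mem x l'
  end.

Ltac lin_atoms t l :=
  lazymatch t with
  | (?a + ?b)%R => let l1 := lin_atoms a l in lin_atoms b l1
  | (- ?a)%R => lin_atoms a l
  | (_ *: ?a)%R => lin_atoms a l
  | 0%R => l
  | _ => lazymatch lin_mem t l with
         | true => l
         | false => constr:(t :: l)
         end
  end.

Ltac lin_index t l :=
  lazymatch l with
  | t :: _ => constr:(0%N)
  | _ :: ?l' => let i := lin_index t l' in constr:(S i)
  end.

Ltac lin_reify R t l :=
  lazymatch t with
  | (?a + ?b)%R => let a' := lin_reify R a l in let b' := lin_reify R b l in
      constr:(@LinAdd R a' b')
  | (- ?a)%R => let a' := lin_reify R a l in constr:(@LinOpp R a')
  | (?r *: ?a)%R => let a' := lin_reify R a l in constr:(@LinScale R r a')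
  | 0%R => constr:(@LinZero R)
  | _ => let i := lin_index t l in constr:(@LinAtom R i)
  end.

Ltac lmod R E :=
  lazymatch goal with
  | |- ?t = ?u =>
    let l0 := lin_atoms t constr:(@nil E) in
    let l := lin_atoms u l0 in
    let t' := lin_reify R t l in
    let u' := lin_reify R u l in
    apply: (@lin_exprP R E l t' u');
    cbn [lin_same lin_coef size eqn]; repeat split; try ring
  end.

(** * Seminorms of a locally convex space *)

Section Seminorms.
Context {R : realType} {E : tvsType R}.
Implicit Types (q : E -> R) (x y : E).

Lemma seminormD q x y : continuous_seminorm q -> q (x + y) <= q x + q y.
Proof. by case. Qed.

Lemma seminormZ q (a : R) x : continuous_seminorm q -> q (a *: x) = `|a| * q x.
Proof. by case. Qed.

Lemma seminorm0 q : continuous_seminorm q -> q 0 = 0.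
Proof. by move=> /(seminormZ 0 0); rewrite scale0r normr0 mul0r. Qed.

Lemma seminormN q x : continuous_seminorm q -> q (- x) = q x.
Proof. by move=> /(seminormZ (-1) x); rewrite scaleN1r normrN1 mul1r. Qed.

Lemma seminorm_ge0 q x : continuous_seminorm q -> 0 <= q x.
Proof.
move=> hq; have := seminormD x (- x) hq.
by rewrite subrr seminorm0// seminormN// -mulr2n pmulrn_lge0.
Qed.

Lemma seminormB q x y : continuous_seminorm q -> q (x - y) <= q x + q y.
Proof. by move=> hq; rewrite -[q y]seminormN//; exact: seminormD. Qed.

Lemma seminorm_distC q x y : continuous_seminorm q -> q (x - y) = q (y - x).
Proof. by move=> hq; rewrite -seminormN// opprB. Qed.

Lemma seminorm_dist q y x z : continuous_seminorm q ->
  q (x - z) <= q (x - y) + q (y - z).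
Proof. by move=> hq; rewrite (le_trans _ (seminormD _ _ hq))// addrA subrK. Qed.

Lemma seminorm_le q y x : continuous_seminorm q -> q x <= q (x - y) + q y.
Proof. by move=> hq; have := seminorm_dist y x 0 hq; rewrite !subr0. Qed.

Lemma seminorm_sum q (I : Type) (r : seq I) (P : pred I) (F : I -> E) :
  continuous_seminorm q ->
  q (\sum_(i <- r | P i) F i) <= \sum_(i <- r | P i) q (F i).
Proof.
move=> hq; elim/big_rec2 : _ => [|i a b _ ab]; first by rewrite seminorm0.
by rewrite (le_trans (seminormD _ _ hq))// lerD2l.
Qed.

Lemma seminorm_small q x (e : R) : continuous_seminorm q -> 0 < e ->
  \forall y \near x, q (y - x) < e.
Proof.
move=> hq e0; case: (hq) => _ _ /(_ 0) cq.
have c : (fun y => y - x) @ x --> (0 : E).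
  rewrite -[X in _ --> X](subrr x).
  apply: (@continuous2_cvg _ _ _ _ _ _ id _ (fun x y : E => x + y)).
  - exact: (@add_continuous E (_, _)).
  - exact: cvg_id.
  - exact: cvg_cst.
have := cvg_comp _ _ c cq.
rewrite seminorm0// => /cvgrPdist_lt /(_ _ e0); apply: filterS => y.
by rewrite sub0r normrN /= ger0_norm// seminorm_ge0.
Qed.

Section Gauge.
Variable W : set E.
Hypotheses (Wcvx : convex_set W) (W0 : nbhs (0 : E) W)
  (WN : forall x, W x -> W (- x)).

Let scalings x := [set t : R | 0 < t /\ W (t^-1 *: x)].
Let gauge x : R := inf (scalings x).

Let W00 : W 0. Proof. exact: nbhs_singleton. Qed.

Let scalings_le x s t : scalings x s -> s <= t -> scalings x t.
Proof.
move=> [s0 Ws] st; have t0 := lt_le_trans s0 st; split => //.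
have -> : t^-1 *: x = (s / t) *: (s^-1 *: x) + (1 - s / t) *: 0.
  by rewrite scaler0 addr0 scalerA mulrAC divff ?mul1r// gt_eqF.
apply: convex_setP => //; first by rewrite divr_ge0// ltW.
by rewrite ler_pdivrMr// mul1r.
Qed.

Let scalings_neq0 x : scalings x !=set0.
Proof.
have : (fun t : R => t *: x) @ (0 : R) --> (0 : E).
  rewrite -[X in _ --> X](scale0r x).
  apply: (@continuous2_cvg _ _ _ _ _ _ id _ (fun (a : R^o) (y : E) => a *: y)).
  - exact: (@scale_continuous R E (0, x)).
  - exact: cvg_id.
  - exact: cvg_cst.
move=> /(_ _ W0) /nbhs_ballP[e /= e0 be].
exists (2 / e); split; first by rewrite divr_gt0.
apply: be; rewrite /= /ball/= sub0r normrN invf_div.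
by rewrite gtr0_norm ?divr_gt0// ltr_pdivrMr// ltr_pMr// ltr1n.
Qed.

Let scalings_lb x : lbound (scalings x) 0.
Proof. by move=> t [/ltW]. Qed.

Let has_inf_scalings x : has_inf (scalings x).
Proof. by split => //; exists 0. Qed.

Let gauge_ge0 x : 0 <= gauge x.
Proof. exact: lb_le_inf. Qed.

Let gauge_le x t : scalings x t -> gauge x <= t.
Proof. by move=> h; apply: ge_inf => //; exists 0. Qed.

Let gauge_lt x e : gauge x < e -> scalings x e.
Proof.
move=> xe; have e0 : 0 < e - gauge x by rewrite subr_gt0.
have [t tx te] := inf_adherent e0 (has_inf_scalings x).
by apply: scalings_le tx _; rewrite ltW// (lt_le_trans te)// -/(gauge x) addrC subrK.
Qed.

Let gaugeD x y : gauge (x + y) <= gauge x + gauge y.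
Proof.
apply/ler_addgt0Pr => e e0.
have e2 : 0 < e / 2 by rewrite divr_gt0.
have [s0 Ws] : scalings x (gauge x + e / 2) by apply: gauge_lt; rewrite ltrDl.
have [t0 Wt] : scalings y (gauge y + e / 2) by apply: gauge_lt; rewrite ltrDl.
set s := gauge x + e / 2 in s0 Ws *; set t := gauge y + e / 2 in t0 Wt *.
have -> : gauge x + gauge y + e = s + t.
  by rewrite /s /t addrACA -splitr.
apply: gauge_le; split; first exact: addr_gt0.
have st0 : s + t != 0 by rewrite gt_eqF// addr_gt0.
have -> : (s + t)^-1 *: (x + y) =
    (s / (s + t)) *: (s^-1 *: x) + (1 - s / (s + t)) *: (t^-1 *: y).
  rewrite !scalerA scalerDr; congr (_ *: _ + _ *: _).
    by rewrite mulrAC divff ?mul1r// gt_eqF.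
  by field; rewrite st0 gt_eqF.
apply: convex_setP => //; first by rewrite divr_ge0// ltW// addr_gt0.
by rewrite (ler_pdivrMr _ _ (addr_gt0 s0 t0)) mul1r lerDl ltW.
Qed.

Let gaugeZ_le a x : gauge (a *: x) <= `|a| * gauge x.
Proof.
apply/ler_addgt0Pr => e e0.
have a1 : 0 < `|a| + 1 by rewrite ltr_pwDr.
have d0 : 0 < e / (`|a| + 1) by rewrite divr_gt0.
have [s0 Ws] : scalings x (gauge x + e / (`|a| + 1)) by apply: gauge_lt; rewrite ltrDl.
set s := gauge x + _ in s0 Ws *.
have [->|an0] := eqVneq a 0.
  rewrite normr0 mul0r add0r; apply: gauge_le; split => //.
  by rewrite scale0r scaler0.
apply: (@le_trans _ _ (`|a| * s)); last first.
  rewrite /s mulrDr lerD2l mulrCA ler_piMr ?(ltW e0)//.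
  by rewrite ler_pdivrMr// mul1r lerDl.
have na0 : 0 < `|a| by rewrite normr_gt0.
apply: gauge_le; split; first by rewrite mulr_gt0.
rewrite invfM scalerA mulrAC.
have [a0|a0] := leP 0 a.
  by rewrite ger0_norm// mulVf// mul1r.
by rewrite ltr0_norm// invrN mulNr mulVf// mulN1r scaleNr; exact: WN.
Qed.

Let gaugeZ a x : gauge (a *: x) = `|a| * gauge x.
Proof.
apply/eqP; rewrite eq_le gaugeZ_le/=.
have [->|an0] := eqVneq a 0; first by rewrite normr0 mul0r.
have := gaugeZ_le a^-1 (a *: x).
rewrite scalerA mulVf// scale1r normfV ler_pdivlMl//.
by rewrite normr_gt0.
Qed.

Let gauge_continuous : continuous gauge.
Proof.
move=> x; apply/cvgrPdist_le => e e0.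
have gN y : gauge (- y) = gauge y by rewrite -scaleN1r gaugeZ normrN1 mul1r.
have gB y z : `|gauge y - gauge z| <= gauge (y - z).
  rewrite ler_norml lerNl opprB !lerBlDr; apply/andP; split.
    by rewrite -[gauge (y - z)]gN opprB -{1}[z](subrK y) gaugeD.
  by rewrite -{1}[y](subrK z) gaugeD.
have H : nbhs x (+%R x @` [set e *: w | w in W]).
  by apply: nbhsT; apply: nbhs0Z => //; rewrite gt_eqF.
apply: filterS H => _ [_ [w Ww <-] <-].
rewrite (le_trans (gB _ _))// opprD addrA subrr sub0r gN.
apply: gauge_le; split => //.
by rewrite scalerA mulVf ?scale1r// gt_eqF.
Qed.

(** The seminorm is the Minkowski gauge of [W]. *)
Lemma convex_nbhs_seminorm :
  exists q : E -> R, continuous_seminorm q /\ forall x, q x < 1 -> W x.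
Proof.
exists gauge; split; first by split.
by move=> x /gauge_lt[_]; rewrite invr1 scale1r.
Qed.

End Gauge.

(** Local convexity provides a convex symmetric neighbourhood inside [V], whose
    gauge has its open unit ball in [V]. *)
Lemma nbhs0_seminorm (V : set E) : nbhs (0 : E) V ->
  exists q : E -> R, continuous_seminorm q /\ forall x, q x < 1 -> V x.
Proof.
move=> V0; have [B Bcvx [Bo Bb]] := @locally_convex R E.
have [C [/= BC C0] CV] := Bb 0 V V0.
have Cc : convex_set C by apply: Bcvx; exact: mem_set.
have nC : nbhs (0 : E) C by apply: open_nbhs_nbhs; split => //; exact: Bo.
have nCN : nbhs (0 : E) (-%R @` C) by exact: nbhs0N.
pose W := C `&` (-%R @` C).
have WN x : W x -> W (- x).
  by move=> [Cx [y Cy yx]]; split; [rewrite -yx opprK|exists x].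
have cW : convex_set W.
  move=> x y t; rewrite !inE => -[Cx [x' Cx' xx']] [Cy [y' Cy' yy']]; split.
    by have := Cc x y t (mem_set Cx) (mem_set Cy); rewrite inE.
  exists (t%:num *: x' + (1 - t%:num) *: y').
    by apply: convex_setP.
  by rewrite -xx' -yy' /conv /= opprD -!scalerN.
have [q [hq qW]] := convex_nbhs_seminorm cW (filterI nC nCN) WN.
by exists q; split => // x /qW[/CV].
Qed.

(** Limits in [E] are thus estimated with one seminorm at a time, as in a normed
    space. *)
Lemma cvg_seminormP (T : Type) (F : set_system T) {FF : Filter F}
    (u : T -> E) (l : E) :
  u @ F --> l <->
  forall q, continuous_seminorm q -> forall e, 0 < e ->
    \forall t \near F, q (u t - l) <= e.
Proof.
split => [ul q hq e e0|H V lV].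
  have h : \forall t \near F, q (u t - l) < e.
    exact: ul (seminorm_small l hq e0).
  by apply: filterS h => t /ltW.
have : nbhs (0 : E) (+%R (- l) @` V).
  by rewrite -(addNr l); exact: nbhsB.
move=> /nbhs0_seminorm[q [hq qV]].
have /(_ 2^-1) := H q hq; rewrite invr_gt0 ltr0n => /(_ isT).
apply: filterS => t qt; have [|v Vv] := qV (u t - l).
  by rewrite (le_lt_trans qt)// invf_lt1// ltr1n.
by rewrite addrC => /addIr vu; rewrite /preimage/= -vu.
Qed.

Lemma seminorm_eq0 x : hausdorff_space E ->
  (forall q, continuous_seminorm q -> forall e, 0 < e -> q x <= e) -> x = 0.
Proof.
move=> hE hx.
have : (fun _ : nat => x) @ \oo --> (0 : E).
  apply/cvg_seminormP => q hq e e0; apply: nearW => t.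
  by rewrite subr0; exact: hx.
by move/(cvg_unique hE (cvg_cst x)).
Qed.

End Seminorms.

(** * Mean value inequality and differentiability *)

Section RowVectors.
Context {R : realType} {n : nat}.

Lemma near_normP (V : normedModType R) (x : V) (P : V -> Prop) :
  (\forall y \near x, P y) <->
  exists2 d : R, 0 < d & forall y, `|y - x| < d -> P y.
Proof.
split => [/nbhs_normP[d /= d0 dP]|[d d0 dP]].
  by exists d => // y yx; apply: dP; rewrite /ball_/= distrC.
by apply/nbhs_normP; exists d => //= y; rewrite /ball_/= distrC; exact: dP.
Qed.

Lemma near_rowP (x : 'rV[R]_n) (P : 'rV[R]_n -> Prop) :
  (\forall y \near x, P y) <->
  exists2 d : R, 0 < d & forall y : 'rV[R]_n, `|y - x| < d -> P y.
Proof. exact: near_normP. Qed.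

Lemma near_realP (x : R) (P : R -> Prop) :
  (\forall y \near x, P y) <->
  exists2 d : R, 0 < d & forall y : R, `|y - x| < d -> P y.
Proof. exact: (@near_normP R^o). Qed.

Implicit Types x y v : 'rV[R]_n.

(** [nearW] for row vectors, whose neighbourhoods unfold during the search for a
    filter structure. *)
Lemma near_all x (P : 'rV[R]_n -> Prop) :
  (forall y, P y) -> \forall y \near x, P y.
Proof. by move=> Py; apply/near_rowP; exists 1. Qed.

Lemma coord_le_norm x i : `|x 0 i| <= `|x|.
Proof.
rewrite [leRHS]/Num.norm/= mx_normrE.
by apply/bigmax_geP; right; exists (0, i).
Qed.

Lemma row_norm_le x (c : R) : 0 <= c -> (forall i, `|x 0 i| <= c) -> `|x| <= c.
Proof.
move=> c0 xc; rewrite [leLHS]/Num.norm/= mx_normrE.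
by apply/bigmax_leP; split => //= -[i j] _ /=; rewrite ord1.
Qed.

Lemma norm_delta_le i : `|delta_mx 0 i : 'rV[R]_n| <= 1.
Proof.
apply: row_norm_le => // j; rewrite mxE eqxx/=.
by case: eqP; rewrite ?normr1 ?normr0.
Qed.

End RowVectors.

Section MeanValue.
Context {R : realType}.

(** The supremum of the points of the unit interval where [phi] is at most
    [phi 0] is such a point, and it cannot be less than 1. *)
Lemma locally_noninc (phi : R -> R) :
  (forall t : R, 0 <= t <= 1 -> \forall s \near t, 0 <= s <= 1 ->
     (t <= s -> phi s <= phi t) /\ (s <= t -> phi t <= phi s)) ->
  phi 1 <= phi 0.
Proof.
move=> H; pose T := [set t | 0 <= t <= 1 /\ phi t <= phi 0].
have T0 : T 0 by split; rewrite ?lexx ?ler01.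
have uT : ubound T 1 by move=> t [/andP[]].
have sT : has_sup T by split; [exists 0|exists 1].
have c0 : 0 <= sup T by apply: ub_le_sup => //; exists 1.
have c1 : sup T <= 1 by apply: ge_sup => //; exists 0.
have c01 : 0 <= sup T <= 1 by rewrite c0 c1.
have /near_realP[d d0 dP] := H _ c01.
have Tc : phi (sup T) <= phi 0.
  have [t [t01 pt] tc] := sup_adherent d0 sT.
  have tle : t <= sup T by apply: ub_le_sup; [exists 1|].
  rewrite (le_trans _ pt)//; apply: (dP t _ t01).2 => //.
  by rewrite ltr_distl tc/= (le_lt_trans tle)// ltrDl.
have [c1'|c1'] := ltP (sup T) 1; last first.
  by have -> : 1 = sup T; [apply/eqP; rewrite eq_le c1 c1'|].
pose s := Num.min 1 (sup T + d / 2).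
have cs : sup T < s by rewrite lt_min c1'/= ltrDl divr_gt0.
have s01 : 0 <= s <= 1.
  by rewrite (le_trans c0 (ltW cs))/= ge_min lexx.
have ds : `|s - sup T| < d.
  rewrite gtr0_norm ?subr_gt0// ltrBlDl (@le_lt_trans _ _ (sup T + d / 2))//.
    by rewrite ge_min lexx orbT.
  by rewrite ltrD2l ltr_pdivrMr// ltr_pMr// ltr1n.
have ps := (dP s ds s01).1 (ltW cs).
have : s <= sup T.
  by apply: ub_le_sup; [exists 1|split => //; exact: le_trans ps Tc].
by rewrite leNgt cs.
Qed.

Context {E : tvsType R}.

(** For every [e > 0] the real function [q (h t - h 0) - (M + e) * t] is locally
    nonincreasing. *)
Lemma mean_value_curve (q : E -> R) (h h' : R -> E) (M : R) :
  continuous_seminorm q ->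
  (forall t : R, 0 <= t <= 1 -> forall e : R, 0 < e -> \forall s \near t, 0 <= s <= 1 ->
     q (h s - h t - (s - t) *: h' t) <= e * `|s - t|) ->
  (forall t, 0 <= t <= 1 -> q (h' t) <= M) ->
  q (h 1 - h 0) <= M.
Proof.
move=> hq dh Mh; apply/ler_addgt0Pr => e e0.
pose phi t := q (h t - h 0) - (M + e) * t.
suff : phi 1 <= phi 0.
  by rewrite /phi mulr0 mulr1 subr0 subrr seminorm0// subr_le0.
apply: locally_noninc => t t01; have := dh t t01 e e0.
apply: filterS => s H s01; have {}H := H s01.
have key : q (h s - h t) <= (M + e) * `|s - t|.
  rewrite (le_trans (seminorm_le ((s - t) *: h' t) _ hq))// mulrDl addrC lerD//.
  by rewrite seminormZ// mulrC ler_wpM2r// Mh.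
split => st; rewrite /phi.
  have := seminorm_dist (h t) (h s) (h 0) hq.
  by rewrite ger0_norm ?subr_ge0// in key; nra.
have := seminorm_dist (h s) (h t) (h 0) hq.
rewrite seminorm_distC// in key.
by rewrite ler0_norm ?subr_le0// in key; nra.
Qed.

End MeanValue.

Section Differentiability.
Context {R : realType} {n : nat} {E : tvsType R}.
Implicit Types (S : set 'rV[R]_n) (q : E -> R) (x y z v : 'rV[R]_n)
  (c : 'I_n -> E) (g h : 'rV[R]_n -> E).

Definition lincomb c v : E := \sum_i v 0 i *: c i.

Lemma lincombB c v w : lincomb c (v - w) = lincomb c v - lincomb c w.
Proof.
rewrite /lincomb -sumrB; apply: eq_bigr => i _.
by rewrite !mxE scalerBl.
Qed.

Lemma lincombZ c (t : R) v : lincomb c (t *: v) = t *: lincomb c v.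
Proof.
rewrite /lincomb scaler_sumr; apply: eq_bigr => i _.
by rewrite !mxE scalerA.
Qed.

Lemma lincomb_cP (a : R) c1 c2 v :
  lincomb (fun i => a *: c1 i + c2 i) v = a *: lincomb c1 v + lincomb c2 v.
Proof.
rewrite /lincomb scaler_sumr -big_split; apply: eq_bigr => i _ /=.
by rewrite scalerDr !scalerA mulrC.
Qed.

Lemma lincomb_delta c i : lincomb c (delta_mx 0 i) = c i.
Proof.
rewrite /lincomb (bigD1 i)//= !mxE !eqxx scale1r big1 ?addr0// => j ji.
by rewrite mxE eqxx (negbTE ji) scale0r.
Qed.

Lemma lincomb_le q c v (M : R) : continuous_seminorm q ->
  (forall i, q (c i) <= M) -> q (lincomb c v) <= n%:R * `|v| * M.
Proof.
move=> hq cM; rewrite (le_trans (seminorm_sum _ _ _ hq))//.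
rewrite (@le_trans _ _ (\sum_(i < n) `|v| * M))//; last first.
  by rewrite sumr_const card_ord -mulrA mulr_natl.
apply: ler_sum => i _; rewrite seminormZ//.
have h1 := coord_le_norm v i; have h2 := cM i.
have h3 := seminorm_ge0 (c i) hq; exact: ler_pM.
Qed.

Definition cont_at S g x : Prop := forall q, continuous_seminorm q ->
  forall e, 0 < e -> \forall y \near x, S y -> q (g y - g x) <= e.

(** Total differentiability relative to [S], with partial derivatives [c i],
    expressed by one seminorm at a time. *)
Definition diff_at S g c x : Prop := forall q, continuous_seminorm q ->
  forall e, 0 < e -> \forall y \near x, S y ->
    q (g y - g x - lincomb c (y - x)) <= e * `|y - x|.

Lemma cont_at_local S S' g h x :
  (\forall y \near x, S y -> S' y /\ g y = h y) -> g x = h x ->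
  cont_at S' h x -> cont_at S g x.
Proof.
move=> SS' gx ch q hq e e0; apply: filterS2 SS' (ch q hq e e0) => y SS' H.
by move=> /SS'[Sy ->]; rewrite gx; exact: H.
Qed.

Lemma diff_at_local S S' g h c x :
  (\forall y \near x, S y -> S' y /\ g y = h y) -> g x = h x ->
  diff_at S' h c x -> diff_at S g c x.
Proof.
move=> SS' gx ch q hq e e0; apply: filterS2 SS' (ch q hq e e0) => y SS' H.
by move=> /SS'[Sy ->]; rewrite gx; exact: H.
Qed.

Lemma cont_atW S S' g x : S `<=` S' -> cont_at S' g x -> cont_at S g x.
Proof.
by move=> SS'; apply: cont_at_local => //; apply: near_all => y Sy; split => //; exact: SS'.
Qed.

Lemma diff_atW S S' g c x : S `<=` S' -> diff_at S' g c x -> diff_at S g c x.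
Proof.
by move=> SS'; apply: diff_at_local => //; apply: near_all => y Sy; split => //; exact: SS'.
Qed.

Lemma diff_cont_at S g c x : diff_at S g c x -> cont_at S g x.
Proof.
move=> dg q hq e e0.
have e2 : 0 < e / 2 by rewrite divr_gt0.
pose M := \sum_i q (c i).
have cM i : q (c i) <= M.
  by rewrite /M (bigD1 i)//= lerDl sumr_ge0// => j _; rewrite seminorm_ge0.
have M0 : 0 <= M by rewrite sumr_ge0// => j _; rewrite seminorm_ge0.
pose K := n%:R * M + 1.
have K0 : 0 < K by rewrite ltr_pwDr// mulr_ge0.
have nK : \forall y \near x, `|y - x| < Num.min 1 (e / 2 / K).
  apply/near_rowP; exists (Num.min 1 (e / 2 / K)) => //.
  by rewrite lt_min ltr01/= divr_gt0.
apply: filterS2 (dg q hq _ e2) nK => y H1 + Sy; have {}H1 := H1 Sy.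
rewrite lt_min ltr_pdivlMr// => /andP[yx1 yxK].
rewrite (le_trans (seminorm_le (lincomb c (y - x)) _ hq))//.
have H2 := lincomb_le (y - x) hq cM.
have := normr_ge0 (y - x); rewrite /K in yxK; nra.
Qed.

Lemma cont_at_cst S (b : E) x : cont_at S (fun=> b) x.
Proof.
by move=> q hq e e0; apply: near_all => y _; rewrite subrr seminorm0// ltW.
Qed.

Lemma diff_at_cst S (b : E) x : diff_at S (fun=> b) (fun=> 0) x.
Proof.
move=> q hq e e0; apply: near_all => y _.
rewrite subrr /lincomb big1 ?subr0 ?seminorm0// ?mulr_ge0// ?ltW// => i _.
by rewrite scaler0.
Qed.

Lemma diff_at_lincomb S c x : diff_at S (lincomb c) c x.
Proof.
move=> q hq e e0; apply: near_all => y _.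
by rewrite lincombB subrr seminorm0// mulr_ge0// ltW.
Qed.

Lemma cont_at_P S (a : R) g h x : cont_at S g x -> cont_at S h x ->
  cont_at S (fun z => a *: g z + h z) x.
Proof.
move=> cg ch q hq e e0.
have e1 : 0 < e / 2 / (`|a| + 1) by rewrite !divr_gt0// ltr_wpDl.
have e2 : 0 < e / 2 by rewrite divr_gt0.
apply: filterS2 (cg q hq _ e1) (ch q hq _ e2) => y H1 H2 Sy.
have {}H1 := H1 Sy; have {}H2 := H2 Sy.
rewrite opprD addrACA -scalerBr (le_trans (seminormD _ _ hq))// seminormZ//.
rewrite ler_pdivlMr ?ltr_wpDl// in H1.
have := seminorm_ge0 (g y - g x) hq; nra.
Qed.

Lemma diff_at_P S (a : R) g h c d x : diff_at S g c x -> diff_at S h d x ->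
  diff_at S (fun z => a *: g z + h z) (fun i => a *: c i + d i) x.
Proof.
move=> cg ch q hq e e0.
have e1 : 0 < e / 2 / (`|a| + 1) by rewrite !divr_gt0// ltr_wpDl.
have e2 : 0 < e / 2 by rewrite divr_gt0.
apply: filterS2 (cg q hq _ e1) (ch q hq _ e2) => y H1 H2 Sy.
have {}H1 := H1 Sy; have {}H2 := H2 Sy.
rewrite lincomb_cP opprD addrACA -scalerBr opprD addrACA -scalerBr.
rewrite (le_trans (seminormD _ _ hq))// seminormZ//.
rewrite mulrAC ler_pdivlMr ?ltr_wpDl// in H1.
have := seminorm_ge0 (g y - g x - lincomb c (y - x)) hq; nra.
Qed.

Lemma diff_at_eqc S g c d x : c =1 d -> diff_at S g c x -> diff_at S g d x.
Proof.
by move=> cd dg; have <- : c = d by apply/funext.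
Qed.

Lemma cont_at_eq S g h x : g =1 h -> cont_at S g x -> cont_at S h x.
Proof. by move=> gh; have -> : g = h by apply/funext. Qed.

Lemma diff_at_eq S g h c x : g =1 h -> diff_at S g c x -> diff_at S h c x.
Proof. by move=> gh; have -> : g = h by apply/funext. Qed.

Lemma cont_at_sum S (I : eqType) (r : seq I) (g : I -> 'rV[R]_n -> E) x :
  (forall i, i \in r -> cont_at S (g i) x) ->
  cont_at S (fun z => \sum_(i <- r) g i z) x.
Proof.
elim: r => [|i r IH] cg.
  by apply: cont_at_eq (cont_at_cst _ 0 _) => z; rewrite big_nil.
have ci := cg i (mem_head _ _).
have {}IH : cont_at S (fun z => \sum_(i <- r) g i z) x.
  by apply: IH => j jr; apply: cg; rewrite in_cons jr orbT.
by apply: cont_at_eq (cont_at_P 1 ci IH) => z; rewrite big_cons scale1r.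
Qed.

Lemma diff_at_sum S (I : eqType) (r : seq I) (g : I -> 'rV[R]_n -> E)
    (c : I -> 'I_n -> E) x :
  (forall i, i \in r -> diff_at S (g i) (c i) x) ->
  diff_at S (fun z => \sum_(i <- r) g i z) (fun j => \sum_(i <- r) c i j) x.
Proof.
elim: r => [|i r IH] cg.
  by apply: diff_at_eq (diff_at_eqc _ (diff_at_cst _ 0 _)) => z; rewrite big_nil.
have ci := cg i (mem_head _ _).
have {}IH : diff_at S (fun z => \sum_(i <- r) g i z)
    (fun j => \sum_(i <- r) c i j) x.
  by apply: IH => j jr; apply: cg; rewrite in_cons jr orbT.
by apply: diff_at_eq (diff_at_eqc _ (diff_at_P 1 ci IH)) => z;
  rewrite big_cons scale1r.
Qed.

Lemma diff_at_translate S g c v x : diff_at S g c (x + v) ->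
  diff_at [set z | S (z + v)] (fun z => g (z + v)) c x.
Proof.
move=> dg q hq e e0; have /near_rowP[d d0 dP] := dg q hq e e0.
apply/near_rowP; exists d => // y yx Sy.
have xyE : y - x = y + v - (x + v) by rewrite opprD addrACA subrr addr0.
by rewrite xyE; apply: dP => //; rewrite -xyE.
Qed.

Definition segment x y := [set x + t *: (y - x) | t in [set t : R | 0 <= t <= 1]].

Lemma mean_value S q g (g' : 'rV[R]_n -> 'I_n -> E) x y (M : R) :
  continuous_seminorm q -> segment x y `<=` S ->
  (forall z, segment x y z -> diff_at S g (g' z) z) ->
  (forall z, segment x y z -> q (lincomb (g' z) (y - x)) <= M) ->
  q (g y - g x) <= M.
Proof.
move=> hq sS dg gM; pose v := y - x; pose p t := x + t *: v.
have sp t : 0 <= t <= 1 -> segment x y (p t) by move=> t01; exists t.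
have -> : g y = g (p 1) by rewrite /p /v scale1r addrC subrK.
have -> : g x = g (p 0) by rewrite /p scale0r addr0.
apply: (mean_value_curve (h := g \o p) (h' := fun t => lincomb (g' (p t)) v)) => //.
- move=> t t01 e e0.
  have e1 : 0 < e / (`|v| + 1) by rewrite divr_gt0// ltr_wpDl.
  have /near_rowP[d d0 dP] := dg _ (sp t t01) q hq _ e1.
  apply/near_realP; exists (d / (`|v| + 1)); first by rewrite divr_gt0// ltr_wpDl.
  move=> s; rewrite ltr_pdivlMr ?ltr_wpDl// => st s01.
  have pst : p s - p t = (s - t) *: v.
    by rewrite /p opprD addrACA subrr add0r -scalerBl.
  have npst : `|p s - p t| <= `|s - t| * (`|v| + 1).
    by rewrite pst normrZ ler_wpM2l// lerDl.
  have := dP (p s) (le_lt_trans npst st) (sS _ (sp s s01)).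
  rewrite pst lincombZ => /le_trans; apply; rewrite -pst.
  rewrite (le_trans (ler_wpM2l (ltW e1) npst))//.
  by rewrite mulrCA mulrC divfK// gt_eqF// ltr_wpDl.
- by move=> t t01; apply: gM; exact: sp.
Qed.

Lemma is_dir_derivP g x v (b : E) : is_dir_deriv g x v b <->
  forall q, continuous_seminorm q -> forall e, 0 < e ->
    \forall t \near (0 : R), q (g (x + t *: v) - g x - t *: b) <= e * `|t|.
Proof.
have E1 q t : continuous_seminorm q -> t != 0 ->
    q (g (x + t *: v) - g x - t *: b) =
    `|t| * q (t^-1 *: (g (x + t *: v) - g x) - b).
  move=> hq t0; rewrite -seminormZ//; congr (q _).
  by rewrite scalerBr scalerA divff// scale1r.
split => [/cvg_seminormP H q hq e e0|H].
  have := H q hq e e0; rewrite /dnbhs near_withinE; apply: filterS => t tP.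
  have [->|t0] := eqVneq t 0.
    by rewrite !scale0r addr0 subrr subr0 seminorm0// mulr_ge0// ltW.
  by rewrite E1// mulrC ler_wpM2r// tP.
apply/cvg_seminormP => q hq e e0; rewrite /dnbhs near_withinE; apply: filterS (H q hq e e0) => t tP t0.
by move: tP; rewrite E1// mulrC ler_pM2r// normr_gt0.
Qed.

Lemma diff_at_dir_deriv S g c x v : nbhs x S -> diff_at S g c x ->
  is_dir_deriv g x v (lincomb c v).
Proof.
move=> xS dg; apply/is_dir_derivP => q hq e e0.
have e1 : 0 < e / (`|v| + 1) by rewrite divr_gt0// ltr_wpDl.
have [d d0 dP] := (near_rowP _ _).1 (filterI xS (dg q hq _ e1)).
apply/near_realP; exists (d / (`|v| + 1)); first by rewrite divr_gt0// ltr_wpDl.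
move=> t; rewrite subr0 ltr_pdivlMr ?ltr_wpDl// => td.
have xtE : x + t *: v - x = t *: v by rewrite addrAC subrr add0r.
have nxt : `|x + t *: v - x| <= `|t| * (`|v| + 1).
  by rewrite xtE normrZ ler_wpM2l// lerDl.
have [Sxt /(_ Sxt)] := dP _ (le_lt_trans nxt td).
rewrite xtE lincombZ => /le_trans; apply; rewrite -xtE.
rewrite (le_trans (ler_wpM2l (ltW e1) nxt))//.
by rewrite mulrCA mulrC divfK// gt_eqF// ltr_wpDl.
Qed.

Lemma diff_at_unique S g c d x : hausdorff_space E -> nbhs x S ->
  diff_at S g c x -> diff_at S g d x -> c =1 d.
Proof.
move=> hE xS dc dd i.
have := diff_at_dir_deriv (v := delta_mx 0 i) xS dc.
have := diff_at_dir_deriv (v := delta_mx 0 i) xS dd.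
by rewrite !lincomb_delta => /(dir_derivE hE) <- /(dir_derivE hE) <-.
Qed.

End Differentiability.

(** * Partial derivatives *)

Section PartialDerivatives.
Context {R : realType} {n : nat} {E : tvsType R}.
Implicit Types (W : set 'rV[R]_n) (x y z v : 'rV[R]_n).

(** Continuous partial derivatives give a total derivative: join x to y by a
    path parallel to the axes and use the mean value inequality on each edge. *)
Lemma partials_diff_at W (g : 'rV[R]_n -> E) (g' : 'I_n -> 'rV[R]_n -> E) x :
  nbhs x W ->
  (forall z i, W z -> is_dir_deriv g z (delta_mx 0 i) (g' i z)) ->
  (forall i, cont_at W (g' i) x) -> diff_at W g (g'^~ x) x.
Proof.
move=> xW dg cg q hq e e0.
have e1 : 0 < e / (n%:R + 1) by rewrite divr_gt0// ltr_wpDl.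
have /near_rowP[d d0 dP] : \forall y \near x,
    W y /\ forall i, q (g' i y - g' i x) <= e / (n%:R + 1).
  apply: filterI => //.
  have : \forall y \near x, forall i, W y -> q (g' i y - g' i x) <= e / (n%:R + 1).
    exact: (@filter_forall _ _ (fun i y => W y -> q (g' i y - g' i x) <= _) (nbhs x) _
      (fun i => cg i q hq _ e1)).
  by apply: filterS2 xW => y Wy H i; exact: H.
apply/near_rowP; exists (d / (n%:R + 1)); first by rewrite divr_gt0// ltr_wpDl.
move=> y; rewrite ltr_pdivlMr ?ltr_wpDl// => yx _.
(* [x + p r] is the point reached after moving along the coordinates in [r] *)
pose v := y - x; pose p (r : seq 'I_n) := \sum_(i <- r) v 0 i *: delta_mx 0 i : 'rV[R]_n.
have pn r : `|p r| <= (size r)%:R * `|v|.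
  elim: r => [|i r IH]; first by rewrite /p big_nil normr0 mul0r.
  rewrite /p big_cons -/(p r) (le_trans (ler_normD _ _))//= -natr1 mulrDl mul1r addrC.
  rewrite lerD// normrZ -[leRHS]mulr1.
  by apply: ler_pM => //; [exact: coord_le_norm|exact: norm_delta_le].
have key r : (size r <= n)%N ->
    q (g (x + p r) - g x - \sum_(i <- r) v 0 i *: g' i x) <=
    (size r)%:R * (e / (n%:R + 1) * `|v|).
  elim: r => [|i r IH] rn.
    by rewrite /p !big_nil addr0 subrr subr0 seminorm0// mul0r.
  rewrite big_cons /p big_cons -/(p r).
  set z := x + p r; set a := \sum_(_ <- _) _.
  have -> : x + (v 0 i *: delta_mx 0 i + p r) = z + v 0 i *: delta_mx 0 i.
    by rewrite /z addrCA addrC addrAC.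
  have zt t : 0 <= t <= 1 -> `|z + (t * v 0 i) *: delta_mx 0 i - x| < d.
    move=> /andP[t0 t1]; apply: le_lt_trans yx.
    have -> : z + (t * v 0 i) *: delta_mx 0 i - x = p r + (t * v 0 i) *: delta_mx 0 i.
      by rewrite /z; lmod R 'rV[R]_n.
    rewrite (le_trans (ler_normD _ _))//.
    rewrite mulrDr mulr1 -/v lerD//.
      rewrite (le_trans (pn r))// mulrC ler_wpM2l// ler_nat ltnW//.
    rewrite normrZ normrM (ger0_norm t0) -[leRHS]mulr1.
    apply: ler_pM => //; [exact: mulr_ge0| |exact: norm_delta_le].
    by rewrite -[leRHS]mul1r; apply: ler_pM => //; exact: coord_le_norm.
  have step : q (g (z + v 0 i *: delta_mx 0 i) - g z - v 0 i *: g' i x) <=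
      e / (n%:R + 1) * `|v|.
    pose h t := g (z + (t * v 0 i) *: delta_mx 0 i) - (t * v 0 i) *: g' i x.
    have -> : g (z + v 0 i *: delta_mx 0 i) - g z - v 0 i *: g' i x = h 1 - h 0.
      by rewrite /h !mul1r !mul0r !scale0r subr0 addr0 addrAC.
    apply: (mean_value_curve (h' := fun t => v 0 i *:
      (g' i (z + (t * v 0 i) *: delta_mx 0 i) - g' i x))) => //.
    - move=> t t01 e' e'0.
      have [Wz _] := dP _ (zt t t01).
      have e2 : 0 < e' / (`|v 0 i| + 1) by rewrite divr_gt0// ltr_wpDl.
      have /near_realP[d' d'0 d'P] := (is_dir_derivP _ _ _ _).1 (dg _ i Wz) q hq _ e2.
      apply/near_realP; exists (d' / (`|v 0 i| + 1)); first by rewrite divr_gt0// ltr_wpDl.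
      move=> s; rewrite ltr_pdivlMr ?ltr_wpDl// => st _.
      have nst : `|(s - t) * v 0 i| <= `|s - t| * (`|v 0 i| + 1).
        by rewrite normrM ler_wpM2l// lerDl.
      have := d'P ((s - t) * v 0 i); rewrite subr0 => /(_ (le_lt_trans nst st)).
      have -> : z + (t * v 0 i) *: delta_mx 0 i + ((s - t) * v 0 i) *: delta_mx 0 i
          = z + (s * v 0 i) *: delta_mx 0 i.
        by lmod R 'rV[R]_n.
      set b := g' i _; rewrite /h -/b.
      set gs := g _; set gt := g _ => H.
      have -> : gs - (s * v 0 i) *: g' i x - (gt - (t * v 0 i) *: g' i x) -
          (s - t) *: (v 0 i *: (b - g' i x)) = gs - gt - ((s - t) * v 0 i) *: b.
        by lmod R E.
      apply: (le_trans H); apply: (le_trans (ler_wpM2l (ltW e2) nst)).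
      by rewrite mulrCA mulrC divfK// gt_eqF// ltr_wpDl.
    - move=> t t01; have [_ H] := dP _ (zt t t01).
      rewrite seminormZ// mulrC; apply: ler_pM => //; first exact: seminorm_ge0.
      exact: coord_le_norm.
  have -> : g (z + v 0 i *: delta_mx 0 i) - g x - (v 0 i *: g' i x + a) =
      (g (z + v 0 i *: delta_mx 0 i) - g z - v 0 i *: g' i x) + (g z - g x - a).
    by rewrite addrACA opprD; congr (_ + _); rewrite [RHS]addrA subrK.
  rewrite (le_trans (seminormD _ _ hq))//= -natr1 mulrDl mul1r addrC lerD//.
  by apply: IH; exact: ltnW.
have := key (index_enum 'I_n).
have -> : x + p (index_enum 'I_n) = y.
  by rewrite /p -row_sum_delta /v addrC subrK.
rewrite -/(lincomb (g'^~ x) v) => /(_ _)/le_trans; apply.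
  by rewrite -[X in (_ <= X)%N]card_ord cardE enumT.
rewrite (_ : size _ = n); last by rewrite -[RHS]card_ord cardE enumT.
rewrite mulrA; apply: ler_wpM2r => //.
by rewrite mulrCA -[leRHS]mulr1 ler_pM2l// ler_pdivrMr ?ltr_wpDl// mul1r lerDl.
Qed.

(** Schwarz: both mixed derivatives approximate the second difference
    [g (x + t e_i + t e_j) - g (x + t e_i) - g (x + t e_j) + g x] divided by
    [t ^+ 2]. *)
Lemma schwarz W (g : 'rV[R]_n -> E) (g1 : 'I_n -> 'rV[R]_n -> E)
    (g2 : 'I_n -> 'I_n -> E) x i j :
  hausdorff_space E -> nbhs x W ->
  (forall z, W z -> diff_at W g (g1^~ z) z) ->
  (forall l, diff_at W (g1 l) (g2 l) x) -> g2 i j = g2 j i.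
Proof.
move=> hE xW dg dg1.
pose dl m : 'rV[R]_n := delta_mx 0 m.
pose D i j (t : R) := g (x + t *: dl i + t *: dl j)
  - g (x + t *: dl i) - g (x + t *: dl j) + g x.
have DC k l t : D k l t = D l k t.
  rewrite /D -!addrA [t *: _ + t *: _]addrC; congr (_ + _).
  by rewrite addrCA.
have key k l q e : continuous_seminorm q -> 0 < e ->
    \forall t \near (0 : R), 0 < t -> q (D k l t - t ^+ 2 *: g2 k l) <= 3 * e * t ^+ 2.
  move=> hq e0; have [d d0 dP] := (near_rowP _ _).1 (filterI xW (dg1 k q hq e e0)).
  apply/near_realP; exists (d / 3); first by rewrite divr_gt0.
  move=> t + t0; rewrite subr0 gtr0_norm// ltr_pdivlMr// => td.
  pose ek := dl k; pose el := dl l.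
  have nk : `|ek| <= 1 by exact: norm_delta_le.
  have nl : `|el| <= 1 by exact: norm_delta_le.
  pose c0 := fun m => if m == k then g2 k l else 0.
  pose S := W `&` [set z | W (z + t *: el)].
  pose K z := g (z + t *: el) - g z - t *: lincomb c0 z.
  pose G z m := g1 m (z + t *: el) - g1 m z - t *: c0 m.
  have E1 : lincomb c0 (t *: ek) = t *: g2 k l.
    by rewrite lincombZ lincomb_delta /c0 eqxx.
  have -> : D k l t - t ^+ 2 *: g2 k l = K (x + t *: ek) - K x.
    rewrite /K /D.
    have -> : lincomb c0 x = lincomb c0 (x + t *: ek) - t *: g2 k l.
      by rewrite -E1 -lincombB addrK.
    by rewrite /ek /el; lmod R E.
  have segd z : segment x (x + t *: ek) z -> `|z - x| <= t.
    move=> [s /andP[s0 s1] <-]; rewrite (addrC x (t *: ek)) addrK addrAC subrr add0r.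
    rewrite !normrZ (ger0_norm s0) (gtr0_norm t0).
    have h : t * `|ek| <= t by have := normr_ge0 ek; nra.
    have : 0 <= t * `|ek| by rewrite mulr_ge0// ltW.
    by nra.
  have segd2 z : segment x (x + t *: ek) z -> `|z + t *: el - x| <= 2 * t.
    move=> /segd zt; rewrite addrAC (le_trans (ler_normD _ _))// normrZ (gtr0_norm t0).
    have := normr_ge0 el; nra.
  have dPz z : `|z - x| <= 2 * t ->
      W z /\ q (g1 k z - g1 k x - lincomb (g2 k) (z - x)) <= e * `|z - x|.
    by move=> zt; have [|Wz H] := dP z _; [rewrite (le_lt_trans zt)//; lra|split; last exact: H].
  have dPs z : segment x (x + t *: ek) z -> `|z - x| <= 2 * t.
    by move=> sz; have := segd z sz; lra.
  (* the second difference is an increment of [K], whose derivative [G] along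
     [ek] is small near [x] *)
  apply: (mean_value (S := S) (g' := G)) => //.
  - by move=> z sz; split; [exact: (dPz _ (dPs _ sz)).1|exact: (dPz _ (segd2 _ sz)).1].
  - move=> z sz.
    have dz := dg z (dPz _ (dPs _ sz)).1.
    have dzl := diff_at_translate (dg _ (dPz _ (segd2 z sz)).1).
    have H := diff_at_P (- t) (diff_at_lincomb S c0 z)
      (diff_at_P (-1) (diff_atW (@subIsetl _ _ _) dz) (diff_atW (@subIsetr _ _ _) dzl)).
    by apply: (diff_at_eq _ (diff_at_eqc _ H)) => m; rewrite /K /G; lmod R E.
  - move=> z sz; rewrite (addrC x (t *: ek)) addrK lincombZ lincomb_delta seminormZ//.
    rewrite (gtr0_norm t0).
    have [_ A] := dPz _ (segd2 _ sz); have [_ B] := dPz _ (dPs _ sz).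
    have -> : G z k = (g1 k (z + t *: el) - g1 k x - lincomb (g2 k) (z + t *: el - x))
        - (g1 k z - g1 k x - lincomb (g2 k) (z - x)).
      have -> : lincomb (g2 k) (z - x) = lincomb (g2 k) (z + t *: el - x) - t *: g2 k l.
        rewrite -(lincomb_delta (g2 k) l) -lincombZ -lincombB; congr lincomb.
        by rewrite addrAC addrK.
      by rewrite /G /c0 eqxx; lmod R E.
    have := seminormB (g1 k (z + t *: el) - g1 k x - lincomb (g2 k) (z + t *: el - x))
      (g1 k z - g1 k x - lincomb (g2 k) (z - x)) hq.
    set Q := q (_ - _) in B *; set P := q (_ - _) in A *; set T := q (_ - _).
    have := segd2 _ sz; have := segd _ sz => h1 h2 h3.
    have : T <= 3 * e * t by nra.
    by nra.
apply/eqP; rewrite -subr_eq0; apply/eqP; apply: seminorm_eq0 hE _ => q hq e e0.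
have e6 : 0 < e / 6 by rewrite divr_gt0.
have [d d0 dP] := (near_realP _ _).1 (filterI (key i j q _ hq e6) (key j i q _ hq e6)).
pose t := d / 2; have t0 : 0 < t by rewrite divr_gt0.
have /dP[/(_ t0) h1 /(_ t0) h2] : `|t - 0| < d.
  by rewrite subr0 gtr0_norm// /t; lra.
have := seminorm_dist (D i j t) (t ^+ 2 *: g2 i j) (t ^+ 2 *: g2 j i) hq.
rewrite [q (t ^+ 2 *: _ - D _ _ _)]seminorm_distC// {2}(DC i j) -scalerBr seminormZ//.
rewrite ger0_norm ?sqr_ge0// => h3.
rewrite -(@ler_pM2l _ (t ^+ 2)) ?exprn_gt0//.
by rewrite (le_trans h3)//; lra.
Qed.

End PartialDerivatives.

(** * Jets and Taylor polynomials *)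

Section ScalarProducts.
Context {R : realType} {n : nat} {E : tvsType R}.
Implicit Types (S : set 'rV[R]_n) (x : 'rV[R]_n) (s : 'rV[R]_n -> R^o).

Lemma norm_seminorm : continuous_seminorm (Num.norm : R^o -> R).
Proof.
split; [exact: ler_normD|exact: normrM|exact: norm_continuous].
Qed.

Lemma cont_at_scale S s (g : 'rV[R]_n -> E) x :
  cont_at S s x -> cont_at S g x -> cont_at S (fun z => s z *: g z) x.
Proof.
move=> cs cg q hq e e0.
have a1 : 0 < `|s x| + 1 by rewrite ltr_wpDl.
have b1 : 0 < q (g x) + 1 by rewrite ltr_wpDl// seminorm_ge0.
have e1 : 0 < e / 2 / (`|s x| + 1) by rewrite !divr_gt0.
have e2 : 0 < Num.min 1 (e / 2 / (q (g x) + 1)).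
  by rewrite lt_min ltr01 !divr_gt0.
apply: filterS2 (cs _ norm_seminorm _ e2) (cg q hq _ e1) => y /= H1 H2 Sy.
have := H1 Sy; rewrite le_min => /andP[H1a]; rewrite ler_pdivlMr// => H1b.
have := H2 Sy; rewrite ler_pdivlMr// => {}H2.
have sy : `|s y| <= `|s x| + 1.
  by rewrite -(subrK (s x) (s y)) (le_trans (ler_normD _ _))// addrC lerD2l.
have -> : s y *: g y - s x *: g x = s y *: (g y - g x) + (s y - s x) *: g x.
  by lmod R E.
rewrite (le_trans (seminormD _ _ hq))// (seminormZ (s y) _ hq).
rewrite (seminormZ (s y - s x) _ hq).
have := seminorm_ge0 (g y - g x) hq; have := seminorm_ge0 (g x) hq.
have := normr_ge0 (s y - s x); nra.
Qed.

Lemma diff_at_scale S s (s' : 'I_n -> R^o) (g : 'rV[R]_n -> E) (c : 'I_n -> E) x :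
  diff_at S s s' x -> diff_at S g c x ->
  diff_at S (fun z => s z *: g z) (fun i => s' i *: g x + s x *: c i) x.
Proof.
move=> ds dg q hq e e0.
pose M := \sum_i q (c i).
have M0 : 0 <= M by rewrite sumr_ge0// => i _; rewrite seminorm_ge0.
have cM i : q (c i) <= M.
  by rewrite /M (bigD1 i)//= lerDl sumr_ge0// => j _; rewrite seminorm_ge0.
have a1 : 0 < `|s x| + 1 by rewrite ltr_wpDl.
have b1 : 0 < q (g x) + 1 by rewrite ltr_wpDl// seminorm_ge0.
have m1 : 0 < n%:R * M + 1 by rewrite ltr_wpDl// mulr_ge0.
have e1 : 0 < e / 3 / (`|s x| + 1) by rewrite !divr_gt0.
have e2 : 0 < e / 3 / (q (g x) + 1) by rewrite !divr_gt0.
have e3 : 0 < Num.min 1 (e / 3 / (n%:R * M + 1)).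
  by rewrite lt_min ltr01 !divr_gt0.
apply: filterS3 (ds _ norm_seminorm _ e2) (dg q hq _ e1)
  (diff_cont_at ds norm_seminorm e3) => y /= H1 H2 H3 Sy.
have {}H1 := H1 Sy; have {}H2 := H2 Sy.
have := H3 Sy; rewrite le_min => /andP[H3a]; rewrite ler_pdivlMr// => H3b.
rewrite mulrAC ler_pdivlMr// in H1; rewrite mulrAC ler_pdivlMr// in H2.
have sy : `|s y| <= `|s x| + 1.
  by rewrite -(subrK (s x) (s y)) (le_trans (ler_normD _ _))// addrC lerD2l.
have lc : lincomb (fun i => s' i *: g x + s x *: c i) (y - x) =
    lincomb s' (y - x) *: g x + s x *: lincomb c (y - x).
  rewrite /lincomb scaler_suml scaler_sumr -big_split; apply: eq_bigr => i _ /=.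
  by rewrite scalerDr !scalerA [s x * _]mulrC.
have -> : s y *: g y - s x *: g x -
    lincomb (fun i => s' i *: g x + s x *: c i) (y - x) =
    (s y *: (g y - g x - lincomb c (y - x)) +
     (s y - s x - lincomb s' (y - x)) *: g x) +
    (s y - s x) *: lincomb c (y - x).
  by rewrite lc; lmod R E.
rewrite (le_trans (seminormD _ _ hq))// (seminormZ (s y - s x) _ hq).
have L := lincomb_le (y - x) hq cM.
have := seminormD (s y *: (g y - g x - lincomb c (y - x)))
  ((s y - s x - lincomb s' (y - x)) *: g x) hq.
rewrite (seminormZ (s y) _ hq) (seminormZ (_ - lincomb s' _) _ hq).
set A := q (_ + _); set B := q (_ - _) in H2 *; set C := `|_ - lincomb s' _| in H1 *.
set D := q (lincomb c _) in L *; set F := `|s y - s x| in H3a H3b *.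
have := normr_ge0 (y - x); have := seminorm_ge0 (g x) hq.
have C0 : 0 <= C by exact: normr_ge0.
have F0 : 0 <= F by exact: normr_ge0.
have B0 : 0 <= B by exact: seminorm_ge0.
set v := `|y - x| in H1 H2 L *.
move=> G0 v0 HA.
have h1 : `|s y| * B <= e / 3 * v by nra.
have h2 : C * q (g x) <= e / 3 * v by nra.
have h3 : F * D <= e / 3 * v.
  have : F * D <= F * (n%:R * v * M) by exact: ler_wpM2l.
  have : F * (n%:R * M + 1) * v <= e / 3 * v by exact: ler_wpM2r.
  by have := mulr_ge0 F0 v0; nra.
lra.
Qed.

Lemma diff_at_coord S i x :
  diff_at S (fun z => z 0 i : R^o) (fun j => (j == i)%:R) x.
Proof.
apply: diff_at_eq (diff_at_lincomb S _ x) => z.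
rewrite /lincomb (bigD1 i)//= eqxx big1 => [|j ji].
  by rewrite addr0 /GRing.scale/= mulr1.
by rewrite (negbTE ji) scaler0.
Qed.

End ScalarProducts.

Section Jets.
Context {R : realType} {n : nat} {E : tvsType R}.
Implicit Types (S : set 'rV[R]_n) (J K : seq 'I_n -> 'rV[R]_n -> E)
  (w : seq 'I_n) (x y : 'rV[R]_n) (k : nat).

(** [J w] plays the role of the iterated partial derivative of [J [::]] along
    the letters of [w], the head of [w] being the last direction. *)
Definition isjet k S J : Prop := forall w x, S x ->
  ((size w <= k)%N -> cont_at S (J w) x) /\
  ((size w < k)%N -> diff_at S (J w) (fun i => J (i :: w) x) x).

Lemma isjetW k S S' J : S `<=` S' -> isjet k S' J -> isjet k S J.
Proof.
move=> SS' jJ w x Sx; have [c d] := jJ w x (SS' _ Sx).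
by split => wk; [apply: cont_atW (c wk)|apply: diff_atW (d wk)].
Qed.

Lemma isjet_P k S (a : R) J K : isjet k S J -> isjet k S K ->
  isjet k S (fun w z => a *: J w z + K w z).
Proof.
move=> jJ jK w x Sx; have [cJ dJ] := jJ w x Sx; have [cK dK] := jK w x Sx.
by split => wk; [apply: cont_at_P (cJ wk) (cK wk)|apply: diff_at_P (dJ wk) (dK wk)].
Qed.

Lemma isjet_local k S J :
  (forall x, S x -> exists S' K, [/\ isjet k S' K, S' x &
    \forall y \near x, S y -> S' y /\ forall w, (size w <= k)%N -> J w y = K w y]) ->
  isjet k S J.
Proof.
move=> H w x Sx; have [S' [K [jK S'x JK]]] := H x Sx.
have [cK dK] := jK w x S'x.
have JKx v : (size v <= k)%N -> J v x = K v x.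
  by move=> vk; exact: (nbhs_singleton JK Sx).2.
have JKw : (size w <= k)%N -> \forall y \near x, S y -> S' y /\ J w y = K w y.
  by move=> wk; apply: filterS JK => y H' /H'[S'y /(_ _ wk)].
split => wk.
  by apply: cont_at_local (JKw wk) (JKx w wk) (cK wk).
apply: diff_at_local (JKw (ltnW wk)) (JKx w (ltnW wk)) _.
by apply: diff_at_eqc (dK wk) => i; rewrite JKx.
Qed.

Lemma isjet_sum k S (I : eqType) (r : seq I) (J : I -> seq 'I_n -> 'rV[R]_n -> E) :
  (forall i, i \in r -> isjet k S (J i)) ->
  isjet k S (fun w x => \sum_(i <- r) J i w x).
Proof.
move=> jJ w x Sx; split => wk.
  by apply: cont_at_sum => i ir; exact: (jJ i ir w x Sx).1.
by apply: diff_at_sum => i ir; exact: (jJ i ir w x Sx).2.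
Qed.

Lemma segment_right x y : segment x y y.
Proof. by exists 1; rewrite /= ?lexx ?ler01// scale1r addrC subrK. Qed.

Lemma segment_sub x y z : segment x y z -> segment x z `<=` segment x y.
Proof.
move=> [s /andP[s0 s1] <-] _ [t /andP[t0 t1] <-]; exists (t * s).
  by rewrite /= mulr_ge0//= mulr_ile1.
by lmod R 'rV[R]_n.
Qed.

Lemma segment_norm x y z : segment x y z -> `|z - x| <= `|y - x|.
Proof.
move=> [s /andP[s0 s1] <-]; rewrite addrAC subrr add0r normrZ ger0_norm//.
by rewrite ler_piMl.
Qed.

(** Bounds on the top order derivatives along a segment and on all derivatives
    at one end propagate to the other end: descend from order [k] with the mean
    value inequality.  The Taylor estimates below apply this to Taylor
    polynomials and to differences of jets with small top order components. *)
Lemma jet_growth k S J (q : E -> R) x y (e r : R) :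
  continuous_seminorm q -> isjet k S J -> segment y x `<=` S ->
  0 <= e -> `|x - y| <= r ->
  (forall w z, size w = k -> segment y x z -> q (J w z) <= e) ->
  (forall w, (size w <= k)%N -> q (J w y) <= e * r ^+ (k - size w)) ->
  forall w, (size w <= k)%N ->
    q (J w x) <= n.+1%:R ^+ (k - size w) * (e * r ^+ (k - size w)).
Proof.
move=> hq jJ sS e0 xyr top base w wk.
have r0 : 0 <= r by exact: le_trans xyr.
suff H m : forall w z, (size w <= k)%N -> segment y x z -> (k - size w)%N = m ->
    q (J w z) <= n.+1%:R ^+ m * (e * r ^+ m).
  by apply: H => //; exact: segment_right.
elim: m => [|m IH] {wk}{}w z wk sz km.
  rewrite !expr0 mul1r mulr1; apply: top => //.
  by apply/eqP; rewrite eqn_leq wk /= -subn_eq0 km.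
have wk' : (size w < k)%N by rewrite -subn_gt0 km.
have km' i : (k - size (i :: w))%N = m by rewrite /= subnS km.
rewrite (le_trans (seminorm_le (J w y) _ hq))//.
have h1 : q (J w z - J w y) <= n%:R * r * (n.+1%:R ^+ m * (e * r ^+ m)).
  apply: (@mean_value _ _ _ S q (J w) (fun z i => J (i :: w) z)) => //.
  - by apply: subset_trans sS; exact: segment_sub.
  - move=> z' sz'; apply: (jJ w z' _).2 => //; apply: sS.
    exact: segment_sub sz'.
  - move=> z' sz'.
    have b : forall i, q (J (i :: w) z') <= n.+1%:R ^+ m * (e * r ^+ m).
      by move=> i; apply: IH => //; exact: segment_sub sz'.
    rewrite (le_trans (lincomb_le _ hq b))// ler_wpM2r//.
      by rewrite !mulr_ge0// exprn_ge0.
    by rewrite ler_wpM2l// (le_trans (segment_norm sz)).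
have h2 : q (J w y) <= e * r ^+ m.+1 by rewrite -km; exact: base.
have h3 : n%:R * r * (n.+1%:R ^+ m * (e * r ^+ m)) = n%:R * n.+1%:R ^+ m * (e * r ^+ m.+1).
  by rewrite exprS; ring.
have h4 : 1 <= n.+1%:R ^+ m :> R by rewrite exprn_ege1// ler1n.
have h5 : 0 <= e * r ^+ m.+1 by rewrite mulr_ge0// exprn_ge0.
rewrite h3 in h1.
have -> : n.+1%:R ^+ m.+1 * (e * r ^+ m.+1) =
    n%:R * n.+1%:R ^+ m * (e * r ^+ m.+1) + n.+1%:R ^+ m * (e * r ^+ m.+1).
  set N := n.+1%:R ^+ m; rewrite [n.+1%:R ^+ m.+1]exprS -/N -natr1; ring.
by apply: lerD h1 _; apply: (le_trans h2); rewrite ler_peMl.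
Qed.

End Jets.

Section TaylorPolynomials.
Context {R : realType} {n : nat} {E : tvsType R}.
Implicit Types (S : set 'rV[R]_n) (J K : seq 'I_n -> 'rV[R]_n -> E)
  (w u v : seq 'I_n) (x y a : 'rV[R]_n) (k l : nat) (c : seq 'I_n -> E).

(** The sum over the words [u] of length [l] of the monomials
    [c u * x_u1 * ... * x_ul]; indexing by words rather than by multi-indices
    replaces the multinomial coefficients by the single factor [l!]. *)
Fixpoint word_form l c x : E :=
  if l is l'.+1 then \sum_i x 0 i *: word_form l' (fun u => c (i :: u)) x
  else c [::].

Definition symmetric_words c : Prop := forall u v, perm_eq u v -> c u = c v.

Lemma word_formP l (b : R) c d x :
  word_form l (fun u => b *: c u + d u) x = b *: word_form l c x + word_form l d x.
Proof.
elim: l c d => //= l IH c d; rewrite scaler_sumr -big_split.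
by apply: eq_bigr => i _; rewrite /= IH; lmod R E.
Qed.

Lemma word_form0 l c : word_form l.+1 c 0 = 0.
Proof. by rewrite /= big1// => i _; rewrite mxE scale0r. Qed.

(** By symmetry of [c], the [l] letters contribute equally to the derivative. *)
Lemma diff_at_word_form S l c x : symmetric_words c ->
  diff_at S (word_form l c)
    (fun i => l%:R *: word_form l.-1 (fun u => c (i :: u)) x) x.
Proof.
elim: l c => [|l IH] c sc.
  by apply: diff_at_eqc (diff_at_cst S _ x) => i; rewrite scale0r.
have sci i : symmetric_words (fun u => c (i :: u)).
  by move=> u v uv; apply: sc; rewrite perm_cons.
have H i := diff_at_scale (diff_at_coord S i x) (IH _ (sci i)).
apply: diff_at_eqc (diff_at_sum (r := index_enum 'I_n) (fun i _ => H i)) => j.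
rewrite big_split /= (bigD1 j)//= eqxx scale1r big1 => [|i]; last first.
  by rewrite eq_sym => /negbTE ->; rewrite scale0r.
rewrite addr0 -[in RHS]nat1r scalerDl scale1r; congr (_ + _).
case: l {IH H} => [|l] /=.
  by rewrite scale0r big1// => i _; rewrite scale0r scaler0.
rewrite scaler_sumr; apply: eq_bigr => i _.
rewrite !scalerA mulrC; congr (_ *: word_form l _ x).
by apply/funext => u; apply: sc; rewrite (perm_catCA [:: i] [:: j] u).
Qed.

Definition taylor k J a w x : E :=
  \sum_(l < (k - size w).+1)
    (l`!%:R)^-1 *: word_form l (fun u => J (u ++ w) a) (x - a).

Lemma taylorP k (b : R) J K a w x :
  taylor k (fun u y => b *: J u y + K u y) a w x =
  b *: taylor k J a w x + taylor k K a w x.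
Proof.
rewrite /taylor scaler_sumr -big_split; apply: eq_bigr => l _ /=.
by rewrite word_formP; lmod R E.
Qed.

Lemma taylor_center k J a w : taylor k J a w a = J w a.
Proof.
rewrite /taylor big_ord_recl subrr big1 => [|l _].
  by rewrite addr0 /= fact0 invr1 scale1r.
by rewrite lift0 word_form0 scaler0.
Qed.

Lemma taylor_top k J a w x : size w = k -> taylor k J a w x = J w a.
Proof.
by move=> <-; rewrite /taylor subnn big_ord1 fact0 invr1 scale1r.
Qed.

(** Differentiating the form of degree [l] appends a letter and yields a factor
    [l], which turns [l!] into [(l - 1)!]. *)
Lemma isjet_taylor k S J a : (forall x, symmetric_words (J^~ x)) ->
  isjet k S (taylor k J a).
Proof.
move=> sJ w x Sx.
have D : (size w < k)%N ->
    diff_at S (taylor k J a w) (fun i => taylor k J a (i :: w) x) x.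
  move=> wk; have [m km] : exists m, (k - size w)%N = m.+1.
    by exists (k - size w).-1; rewrite prednK// subn_gt0.
  have kmi i : (k - size (i :: w))%N = m by rewrite /= subnS km.
  have sc : symmetric_words (fun u => J (u ++ w) a).
    by move=> u v uv; apply: sJ; rewrite perm_cat2r.
  have T l : diff_at S (fun z => word_form l (fun u => J (u ++ w) a) (z - a))
      (fun i => l%:R *: word_form l.-1 (fun u => J (i :: u ++ w) a) (x - a)) x.
    by apply: diff_atW (diff_at_translate (@diff_at_word_form setT l _ (x - a) sc)).
  have T' l := diff_at_P (l`!%:R)^-1 (T l) (diff_at_cst S 0 x).
  apply: diff_at_eq (diff_at_eqc _ (diff_at_sum (r := index_enum 'I_m.+2)
    (fun (l : 'I_m.+2) _ => T' l))) => [z|i].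
    by rewrite /taylor km; apply: eq_bigr => l _; rewrite addr0.
  rewrite /taylor kmi big_ord_recl /= scale0r scaler0 addr0 add0r.
  apply: eq_bigr => l _; rewrite addr0 /bump/= add1n scalerA factS natrM invfM.
  rewrite mulrAC mulVf ?mul1r ?pnatr_eq0//; congr (_ *: word_form l _ _).
  apply/funext => u; apply: sJ.
  by rewrite -cat_cons -cat_rcons perm_cat2r perm_sym perm_rcons.
split => wk; last exact: D.
move: wk; rewrite leq_eqVlt => /predU1P[wk|wk]; last exact: diff_cont_at (D wk).
by apply: cont_at_eq (cont_at_cst S (J w a) x) => z; rewrite taylor_top.
Qed.

Lemma taylor_bound k J a (q : E -> R) x (M r : R) :
  continuous_seminorm q -> (forall y, symmetric_words (J^~ y)) ->
  1 <= r -> `|x - a| <= r ->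
  (forall w, (size w <= k)%N -> q (J w a) <= M) ->
  forall w, (size w <= k)%N ->
    q (taylor k J a w x) <= n.+1%:R ^+ (k - size w) * (M * r ^+ (k - size w)).
Proof.
move=> hq sJ r1 xar JM.
have M0 : 0 <= M by apply: le_trans (JM [::] _); rewrite ?seminorm_ge0.
apply: (jet_growth hq (isjet_taylor k (S := setT) a sJ) (@subsetT _ (segment a x))) => //.
  by move=> w z wk _; rewrite taylor_top// JM// wk.
move=> w wk; rewrite taylor_center (le_trans (JM w wk))// ler_peMr//.
exact: exprn_ege1.
Qed.

(** Taylor's inequality, with the oscillation [e] of the top order derivatives
    along the segment. *)
Lemma taylor_remainder k S J (q : E -> R) x y (e : R) :
  continuous_seminorm q -> (forall y, symmetric_words (J^~ y)) ->
  isjet k S J -> segment y x `<=` S -> 0 <= e ->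
  (forall w z, size w = k -> segment y x z -> q (J w z - J w y) <= e) ->
  forall w, (size w <= k)%N -> q (J w x - taylor k J y w x) <=
    n.+1%:R ^+ (k - size w) * (e * `|x - y| ^+ (k - size w)).
Proof.
move=> hq sJ jJ sS e0 osc w wk.
have jK : isjet k S (fun w z => (-1) *: taylor k J y w z + J w z).
  by apply: isjet_P => //; exact: isjet_taylor.
rewrite addrC -scaleN1r.
apply: (jet_growth hq jK sS e0 (lexx _)) => //.
  by move=> v z vk sz; rewrite taylor_top// scaleN1r addrC osc.
move=> v vk; rewrite taylor_center scaleN1r addNr seminorm0// mulr_ge0//.
Qed.

(** If Taylor's inequality holds between [a] and [y] then the Taylor
    polynomials centred at [a] and [y] are close near [a]. *)
Lemma taylor_compare k J (q : E -> R) a y x (e r : R) :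
  continuous_seminorm q -> (forall y, symmetric_words (J^~ y)) ->
  0 <= e -> `|x - a| <= r ->
  (forall w, (size w <= k)%N ->
     q (J w a - taylor k J y w a) <= e * r ^+ (k - size w)) ->
  forall w, (size w <= k)%N -> q (taylor k J a w x - taylor k J y w x) <=
    n.+1%:R ^+ (k - size w) * (e * r ^+ (k - size w)).
Proof.
move=> hq sJ e0 xar base w wk.
have jK : isjet k setT
    (fun w z => (-1) *: taylor k J y w z + taylor k J a w z).
  by apply: isjet_P => //; exact: isjet_taylor.
rewrite addrC -scaleN1r.
apply: (jet_growth hq jK (@subsetT _ (segment a x)) e0 xar) => //.
  move=> v z vk _; rewrite !taylor_top// scaleN1r addrC.
  by have := base v; rewrite vk leqnn subnn expr0 mulr1 taylor_top//; apply.
move=> v vk; rewrite taylor_center scaleN1r addrC; exact: base.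
Qed.

End TaylorPolynomials.

(** * Products and locally finite sums of jets *)

Section LeibnizRule.
Context {R : realType} {n : nat} {E : tvsType R}.
Implicit Types (S : set 'rV[R]_n) (s : seq 'I_n -> 'rV[R]_n -> R^o)
  (K : seq 'I_n -> 'rV[R]_n -> E) (w : seq 'I_n) (x : 'rV[R]_n).

(** The complementary pairs of subwords of [w], with multiplicity: they index
    the terms of the Leibniz rule. *)
Fixpoint splits w : seq (seq 'I_n * seq 'I_n) :=
  if w is i :: w' then
    [seq (i :: p.1, p.2) | p <- splits w'] ++ [seq (p.1, i :: p.2) | p <- splits w']
  else [:: ([::], [::])].

Lemma size_splits w : size (splits w) = (2 ^ size w)%N.
Proof.
by elim: w => //= i w IH; rewrite size_cat !size_map IH expnS mul2n addnn.
Qed.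

Lemma splits_size w p : p \in splits w -> (size p.1 + size p.2)%N = size w.
Proof.
elim: w p => [|i w IH] p /=; first by rewrite inE => /eqP ->.
by rewrite mem_cat => /orP[] /mapP[p' /IH <- ->]; rewrite ?addnS.
Qed.

Definition leibniz s K w x : E := \sum_(p <- splits w) s p.1 x *: K p.2 x.

Lemma isjet_leibniz k S s K : isjet k S s -> isjet k S K -> isjet k S (leibniz s K).
Proof.
move=> js jK w x Sx.
have sz p : p \in splits w -> (size p.1 <= size w)%N /\ (size p.2 <= size w)%N.
  by move=> /splits_size <-; rewrite leq_addr leq_addl.
split => wk.
  apply: cont_at_sum => p /sz[p1 p2]; apply: cont_at_scale.
    by apply: (js p.1 x Sx).1; exact: leq_trans wk.
  by apply: (jK p.2 x Sx).1; exact: leq_trans wk.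
have H p : p \in splits w -> diff_at S (fun z => s p.1 z *: K p.2 z)
    (fun i => s (i :: p.1) x *: K p.2 x + s p.1 x *: K (i :: p.2) x) x.
  move=> /sz[p1 p2]; apply: diff_at_scale.
    by apply: (js p.1 x Sx).2; exact: leq_ltn_trans wk.
  by apply: (jK p.2 x Sx).2; exact: leq_ltn_trans wk.
apply: diff_at_eqc (diff_at_sum H) => i.
by rewrite big_split /leibniz /= big_cat !big_map.
Qed.

Lemma leibniz_nil s K x : leibniz s K [::] x = s [::] x *: K [::] x.
Proof. by rewrite /leibniz big_seq1. Qed.

Lemma leibniz_unit s K w x :
  s [::] x = 1 -> (forall u, u != [::] -> (size u <= size w)%N -> s u x = 0) ->
  leibniz s K w x = K w x.
Proof.
move=> s1; have [m sm] := ubnP (size w); elim: w K sm => [|i w IH] K sm s0.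
  by rewrite leibniz_nil s1 scale1r.
rewrite /leibniz /= big_cat !big_map /= big_seq big1 => [|p /splits_size pw].
  rewrite add0r; apply: (IH (fun u => K (i :: u))); first exact: ltnW.
  by move=> u u0 uw; apply: s0 => //; exact: leqW.
by rewrite s0 ?scale0r// /= ltnS -pw leq_addr.
Qed.

Lemma leibnizBr s K K' w x :
  leibniz s (fun u y => K u y - K' u y) w x = leibniz s K w x - leibniz s K' w x.
Proof.
by rewrite /leibniz -sumrB; apply: eq_bigr => p _; rewrite scalerBr.
Qed.

Lemma leibnizPr s (a : R) K K' w x :
  leibniz s (fun u y => a *: K u y + K' u y) w x =
  a *: leibniz s K w x + leibniz s K' w x.
Proof.
rewrite /leibniz scaler_sumr -big_split; apply: eq_bigr => p _ /=; lmod R E.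
Qed.

Lemma leibniz_suml (I : Type) (r : seq I) (s : I -> seq 'I_n -> 'rV[R]_n -> R^o)
    K w x :
  leibniz (fun u y => \sum_(i <- r) s i u y) K w x =
  \sum_(i <- r) leibniz (s i) K w x.
Proof.
rewrite /leibniz exchange_big; apply: eq_bigr => p _ /=.
by rewrite scaler_suml.
Qed.

Lemma leibniz0 s K w x :
  (forall u v, (size u + size v)%N = size w -> s u x *: K v x = 0) ->
  leibniz s K w x = 0.
Proof.
by move=> H; rewrite /leibniz big_seq big1// => p /splits_size; exact: H.
Qed.

Lemma leibniz_le (q : E -> R) s K w x (M : R) : continuous_seminorm q ->
  (forall u v, (size u + size v)%N = size w -> `|s u x| * q (K v x) <= M) ->
  q (leibniz s K w x) <= 2 ^+ size w * M.
Proof.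
move=> hq H; rewrite (le_trans (seminorm_sum _ _ _ hq))// big_seq.
rewrite (@le_trans _ _ (\sum_(p <- splits w | p \in splits w) M))//.
  by apply: ler_sum => p /splits_size pw; rewrite seminormZ// H.
by rewrite -big_seq big_const_seq count_predT iter_addr addr0 size_splits
  -[leLHS]mulr_natl natrX.
Qed.

End LeibnizRule.

Section LocallyFiniteSums.
Context {R : realType} {n : nat} {E : tvsType R}.
Implicit Types (k : nat) (S : set 'rV[R]_n) (x : 'rV[R]_n).

Lemma sum_support (V : nmodType) (I : eqType) (r r' : seq I) (F : I -> V) :
  uniq r -> uniq r' -> (forall i, i \notin r -> F i = 0) ->
  (forall i, i \notin r' -> F i = 0) ->
  \sum_(i <- r) F i = \sum_(i <- r') F i.
Proof.
move=> ur ur' Fr Fr'.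
rewrite (bigID (mem r'))/= [X in _ + X]big1 ?addr0 => [|i ir']; last exact: Fr'.
rewrite [RHS](bigID (mem r))/= [X in _ = _ + X]big1 ?addr0 => [|i ir]; last exact: Fr.
rewrite -big_filter -[RHS]big_filter; apply: perm_big.
apply: uniq_perm; rewrite ?filter_uniq// => i.
by rewrite !mem_filter andbC.
Qed.

(** The supports come with explicit lists, so that the sum of the family near [x]
    is the finite sum over [r x]. *)
Definition locally_finite_jets k S (I : eqType)
    (J : I -> seq 'I_n -> 'rV[R]_n -> E) (r : 'rV[R]_n -> seq I) : Prop :=
  forall x, S x -> uniq (r x) /\
    \forall y \near x, forall i w, i \notin r x -> (size w <= k)%N -> J i w y = 0.

Lemma locally_finite_near k S I J r x : @locally_finite_jets k S I J r -> S x ->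
  \forall y \near x, S y -> forall w, (size w <= k)%N ->
    \sum_(i <- r y) J i w y = \sum_(i <- r x) J i w y.
Proof.
move=> lf Sx; have [ux zx] := lf x Sx; apply: filterS zx => y zx Sy w wk.
have [uy zy] := lf y Sy; apply: sum_support => // i ir; last exact: zx.
exact: (nbhs_singleton zy).
Qed.

Lemma isjet_locally_finite k S I J r : @locally_finite_jets k S I J r ->
  (forall i, isjet k S (J i)) ->
  isjet k S (fun w x => \sum_(i <- r x) J i w x).
Proof.
move=> lf jJ; apply: isjet_local => x Sx.
exists S, (fun w y => \sum_(i <- r x) J i w y); split => //.
  by apply: isjet_sum => i _; exact: jJ.
by apply: filterS (locally_finite_near lf Sx) => y H Sy; split => //; exact: H.
Qed.

Lemma isjet_unique k S J K : hausdorff_space E -> open S ->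
  isjet k S J -> isjet k S K -> (forall x, S x -> J [::] x = K [::] x :> E) ->
  forall w x, (size w <= k)%N -> S x -> J w x = K w x.
Proof.
move=> hE oS jJ jK JK; elim=> [|i w IH] x wk Sx; first exact: JK.
have xS : nbhs x S by exact: open_nbhs_nbhs.
apply: (@diff_at_unique _ _ _ S (J w) (fun i => J (i :: w) x)
  (fun i => K (i :: w) x) x hE xS ((jJ w x Sx).2 wk)).
apply: diff_at_local ((jK w x Sx).2 wk); last exact: (IH x (ltnW wk) Sx).
by apply: near_all => y Sy; split => //; apply: IH => //; exact: ltnW.
Qed.

End LocallyFiniteSums.

(** * A bump function *)

Section SmoothStep.
Context {R : realType}.
Implicit Types (f g : R -> R) (m : nat).

(** m times continuously differentiable *)
Fixpoint smooth m g : Prop :=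
  if m is m'.+1 then
    exists g', (forall t : R, is_derive t 1 g (g' t)) /\ smooth m' g'
  else continuous g.

Lemma is_derive_continuous g (g' : R -> R) :
  (forall t : R, is_derive t 1 g (g' t)) -> continuous g.
Proof.
move=> dg t; apply/differentiable_continuous/derivable1_diffP.
by case: (dg t).
Qed.

Lemma smooth_continuous m g : smooth m g -> continuous g.
Proof. by case: m => [//|m [g' [dg _]]]; exact: is_derive_continuous dg. Qed.

Lemma smoothW m g : smooth m.+1 g -> smooth m g.
Proof.
elim: m g => [|m IH] g; first exact: smooth_continuous.
by move=> [g' [dg sg']]; exists g'; split => //; exact: IH.
Qed.

Lemma smooth_cst m (c : R) : smooth m (fun=> c).
Proof.
elim: m c => [|m IH] c; first by move=> t; exact: cvg_cst.
by exists (fun=> 0); split => // t; exact: is_derive_cst.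
Qed.

Lemma smoothB m f g : smooth m f -> smooth m g -> smooth m (fun t => f t - g t).
Proof.
elim: m f g => [|m IH] f g.
  by move=> cf cg t; apply: cvgB; [exact: cf|exact: cg].
move=> [f' [df sf]] [g' [dg sg]]; exists (fun t => f' t - g' t).
by split; [move=> t; exact: is_deriveB|exact: IH].
Qed.

Lemma smoothM m f g : smooth m f -> smooth m g -> smooth m (fun t => f t * g t).
Proof.
elim: m f g => [|m IH] f g.
  by move=> cf cg t; apply: cvgM; [exact: cf|exact: cg].
move=> sf0 sg0; move: (sf0) (sg0) => [f' [df sf]] [g' [dg sg]].
exists (fun t => f t * g' t - (0 - g t) * f' t); split.
  move=> t; have := is_deriveM (df t) (dg t).
  by rewrite sub0r mulNr opprK.
apply: smoothB; first by apply: IH => //; exact: smoothW.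
by apply: IH => //; apply: smoothB; [exact: smooth_cst|exact: smoothW].
Qed.

Lemma smooth_comp m f g : smooth m f -> smooth m g -> smooth m (f \o g).
Proof.
elim: m f g => [|m IH] f g.
  by move=> cf cg t; apply: continuous_comp; [exact: cg|exact: cf].
move=> [f' [df sf]] sg0; move: (sg0) => [g' [dg sg]].
exists (fun t => f' (g t) * g' t); split.
  by move=> t; apply: is_derive1_comp.
by apply: smoothM => //; apply: (IH f' g) => //; exact: smoothW.
Qed.

Lemma is_derive_pospow m (t : R) :
  is_derive t 1 (fun u : R => Num.max u 0 ^+ m.+2)
    (m.+2%:R * Num.max t 0 ^+ m.+1).
Proof.
have cp : continuous (fun u : R => Num.max u 0).
  by move=> u; apply: continuous_max; [exact: cvg_id|exact: cvg_cst].
have [t0|t0|->] := ltgtP t 0.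
- have h : is_derive t 1 (fun _ : R => 0 : R) 0 by exact: is_derive_cst.
  rewrite expr0n mulr0; apply: (near_eq_is_derive _ h).
  apply/near_realP; exists (- t); first by rewrite oppr_gt0.
  move=> u; rewrite ltr_norml => /andP[_ ut]; rewrite max_r ?expr0n//.
  by rewrite ltW//; lra.
- have h : is_derive t 1 (fun u : R => u ^+ m.+2) (m.+2%:R * t ^+ m.+1).
    have -> : (fun u : R => u ^+ m.+2) = (@id R^o) ^+ m.+2.
      by apply/funext => u; rewrite exprfctE.
    have := is_deriveX m.+2 (@is_derive_id R R^o t 1).
    by rewrite /GRing.scale/= mulr1.
  apply: (near_eq_is_derive _ h).
  apply/near_realP; exists t => //.
  move=> u; rewrite ltr_norml => /andP[ut _]; rewrite max_l//.
  by rewrite ltW//; lra.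
- apply/is_derive1_caratheodory; exists (fun u => Num.max u 0 ^+ m.+1); split.
  + move=> u; rewrite maxxx expr0n !subr0 exprSr.
    have [u0|u0] := leP u 0; last by [].
    by rewrite expr0n !mul0r.
  + exact: (@continuous_comp _ _ _ (fun u : R => Num.max u 0) (fun u => u ^+ m.+1) 0
      (cp 0) (@exprn_continuous _ _ _)).
  + by rewrite maxxx expr0n mulr0.
Qed.

Lemma smooth_pospow m : smooth m (fun t : R => Num.max t 0 ^+ m.+1).
Proof.
elim: m => [|m IH].
  by move=> u /=; apply: continuous_max; [exact: cvg_id|exact: cvg_cst].
exists (fun t : R => m.+2%:R * Num.max t 0 ^+ m.+1); split.
  exact: is_derive_pospow.
by apply: smoothM => //; exact: smooth_cst.
Qed.

Lemma smooth_derivatives m g : smooth m g -> exists s : nat -> R -> R,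
  [/\ s 0%N = g,
      forall l, (l < m)%N -> forall t : R, is_derive t 1 (s l) (s l.+1 t) &
      forall l, (l <= m)%N -> continuous (s l)].
Proof.
elim: m g => [|m IH] g.
  by move=> cg; exists (fun=> g); split => // l; rewrite leqn0 => /eqP ->.
move=> sg; move: (sg) => [g' [dg /IH[s [s0 ds cs]]]].
exists (fun l => if l is l'.+1 then s l' else g); split => //.
  by case=> [|l]; [rewrite s0|exact: ds].
by case=> [|l]; [move=> _; exact: smooth_continuous sg|exact: cs].
Qed.

(** A compactly supported bump whose integer translates sum to 1, together with
    its derivatives [b l].  With [p t = max t 0 ^+ k.+1], the function
    [s t = 1 - p (1 - p t)] is 0 on the left of 0 and 1 on the right of 1, and the
    translates of [s (t + 1) - s t] telescope. *)
Lemma bump_exists k : exists (b : nat -> R -> R) (M : R),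
  [/\ forall l, (l < k)%N -> forall t : R, is_derive t 1 (b l) (b l.+1 t),
      forall l, (l <= k)%N -> continuous (b l),
      forall l t, (l <= k)%N -> `|t| <= 1 -> `|b l t| <= M,
      forall t, 1 <= `|t| -> b 0%N t = 0 &
      forall u, -1 <= u -> u <= 2 -> \sum_(j < 4) b 0%N (u + 1 - j%:R) = 1].
Proof.
pose p (t : R) := Num.max t 0 ^+ k.+1.
pose s (t : R) := 1 - p (1 - p t).
have p0 t : t <= 0 -> p t = 0 by move=> t0; rewrite /p max_r// expr0n.
have s0 t : t <= 0 -> s t = 0.
  by move=> t0; rewrite /s (p0 t t0) subr0 /p max_l// expr1n subrr.
have s1 t : 1 <= t -> s t = 1.
  move=> t1; rewrite /s [p (1 - _)]p0 ?subr0// subr_le0 /p max_l ?(le_trans ler01)//.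
  exact: exprn_ege1.
have sp : smooth k p := smooth_pospow k.
have ss : smooth k s.
  apply: smoothB; first exact: smooth_cst.
  apply: (smooth_comp (f := p)) => //.
  by apply: smoothB => //; exact: smooth_cst.
have idsmooth m : smooth m (fun t : R => t).
  case: m => [|m]; first by move=> t; exact: cvg_id.
  by exists (fun=> 1); split; [move=> t; exact: is_derive_id|exact: smooth_cst].
have sb : smooth k (fun t => s (t + 1) - s t).
  apply: smoothB => //; apply: (smooth_comp (f := s)) => //.
  have -> : (fun t : R => t + 1) = (fun t => t - (- 1)).
    by apply/funext => t; rewrite opprK.
  by apply: smoothB => //; exact: smooth_cst.
have [b [b0 db cb]] := smooth_derivatives sb.
have bM l : (l <= k)%N -> exists M : R, forall t, `|t| <= 1 -> `|b l t| <= M.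
  move=> lk; have c : {within `[(-1)%R, 1%R], continuous (fun t => `|b l t|)}.
    apply: continuous_subspaceT => t.
    by apply: continuous_comp; [exact: cb|exact: norm_continuous].
  have [|t _ tM] := EVT_max _ c; first by lra.
  exists `|b l t| => u; rewrite ler_norml => u1; apply: tM.
  by rewrite in_itv/= u1.
have [M HM] : exists M : 'I_k.+1 -> R, forall l t, `|t| <= 1 -> `|b (val l) t| <= M l.
  have : forall l : 'I_k.+1, exists M : R, forall t, `|t| <= 1 -> `|b (val l) t| <= M.
    by move=> l; apply: bM; have := ltn_ord l; rewrite ltnS.
  by move=> /choice[M HM]; exists M.
exists b, (\sum_l `|M l|); split => //.
- move=> l t lk t1; rewrite -ltnS in lk.
  rewrite (le_trans (HM (Ordinal lk) t t1))// (bigD1 (Ordinal lk))//=.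
  by rewrite (le_trans (ler_norm _))// lerDl sumr_ge0.
- move=> t t1; rewrite b0; have [t0|t0] := leP 0 t.
    by rewrite !s1 ?subrr//; rewrite ger0_norm// in t1; lra.
  by rewrite !s0 ?subrr//; rewrite ltr0_norm// in t1; lra.
- move=> u u1 u2; rewrite !big_ord_recr big_ord0 /= b0 add0r.
  have -> : u + 1 - 0%:R + 1 = u + 2 by rewrite subr0; lra.
  have -> : u + 1 - 1%:R + 1 = u + 1 by lra.
  have -> : u + 1 - 2%:R + 1 = u by lra.
  have -> : u + 1 - 3%:R + 1 = u - 1 by lra.
  have -> : u + 1 - 0%:R = u + 1 by lra.
  have -> : u + 1 - 1%:R = u by lra.
  have -> : u + 1 - 2%:R = u - 1 by lra.
  have -> : u + 1 - 3%:R = u - 2 by lra.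
  rewrite (s1 (u + 2)) ?(s0 (u - 2)); lra.
Qed.

End SmoothStep.

(** * Distance to a set and bumps on a grid *)

Section DistanceToSet.
Context {R : realType} {n : nat}.
Variable A : set 'rV[R]_n.
Hypothesis A0 : A !=set0.
Implicit Types x y a : 'rV[R]_n.

Definition dist_set x : R := inf [set `|x - a| | a in A].

Let has_inf_dist x : has_inf [set `|x - a| | a in A].
Proof.
case: A0 => a Aa; split; first by exists `|x - a|; exists a.
by exists 0 => _ [b _ <-].
Qed.

Lemma dist_set_ge0 x : 0 <= dist_set x.
Proof.
apply: lb_le_inf; first exact: (has_inf_dist x).1.
by move=> _ [b _ <-].
Qed.

Lemma dist_set_le x a : A a -> dist_set x <= `|x - a|.
Proof. by move=> Aa; apply: ge_inf; [exact: (has_inf_dist x).2|exists a]. Qed.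

Lemma dist_set_close x (e : R) : 0 < e -> exists2 a, A a & `|x - a| < dist_set x + e.
Proof.
by move=> e0; have [_ [a Aa <-] ae] := inf_adherent e0 (has_inf_dist x); exists a.
Qed.

Lemma dist_set_lipschitz x y : dist_set x <= dist_set y + `|x - y|.
Proof.
apply/ler_addgt0Pr => e e0; have [a Aa ae] := dist_set_close y e0.
rewrite (le_trans (dist_set_le x Aa))//.
have -> : x - a = (x - y) + (y - a) by lmod R 'rV[R]_n.
rewrite (le_trans (ler_normD _ _))//; lra.
Qed.

Lemma dist_set_gt0 x : ~ closure A x -> 0 < dist_set x.
Proof.
move=> nA; rewrite lt_neqAle dist_set_ge0 andbT; apply/eqP => d0; apply: nA.
move=> B /near_rowP[e e0 eB]; have [a Aa ae] := dist_set_close x e0.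
by exists a; split => //; apply: eB; rewrite distrC -[e]add0r d0.
Qed.

Lemma open_dist_set_lt (l c : R) : 0 <= l -> open [set x | dist_set x * l < c].
Proof.
move=> l0; rewrite openE => x /= xc; apply/near_rowP.
have l1 : 0 < l + 1 by rewrite ltr_wpDl.
have e0 : 0 < (c - dist_set x * l) / (l + 1) by rewrite divr_gt0 ?subr_gt0.
exists ((c - dist_set x * l) / (l + 1)) => // y.
rewrite ltr_pdivlMr// => yx /=.
have := dist_set_lipschitz y x; have := normr_ge0 (y - x); nra.
Qed.

Lemma open_dist_set_gt (l c : R) : 0 <= l -> open [set x | c < dist_set x * l].
Proof.
move=> l0; rewrite openE => x /= xc; apply/near_rowP.
have l1 : 0 < l + 1 by rewrite ltr_wpDl.
have e0 : 0 < (dist_set x * l - c) / (l + 1) by rewrite divr_gt0 ?subr_gt0.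
exists ((dist_set x * l - c) / (l + 1)) => // y.
rewrite ltr_pdivlMr// => yx /=.
have := dist_set_lipschitz x y; rewrite distrC.
have := normr_ge0 (y - x); nra.
Qed.

End DistanceToSet.

Section GridBumps.
Context {R : realType} {n : nat}.
Implicit Types (S : set 'rV[R]_n) (x y : 'rV[R]_n) (w u v : seq 'I_n).
Variables (k : nat) (b : nat -> R -> R) (M : R).
Hypothesis db : forall l, (l < k)%N -> forall t : R, is_derive t 1 (b l) (b l.+1 t).
Hypothesis cb : forall l, (l <= k)%N -> continuous (b l).
Hypothesis bM : forall l t, (l <= k)%N -> `|t| <= 1 -> `|b l t| <= M.
Hypothesis b_supp : forall t, 1 <= `|t| -> b 0%N t = 0.
Hypothesis b_sum : forall u : R, -1 <= u -> u <= 2 -> \sum_(j < 4) b 0%N (u + 1 - j%:R) = 1.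

Let hR : hausdorff_space R^o := @norm_hausdorff R R^o.

Lemma isjet_cst0 S (F : tvsType R) : isjet k S (fun _ _ => 0 : F).
Proof. by move=> w x _; split=> _; [exact: cont_at_cst|exact: diff_at_cst]. Qed.

Lemma continuous_cont_at (F : tvsType R) S (g : 'rV[R]_n -> F) x :
  {for x, continuous g} -> cont_at S g x.
Proof.
move=> /cvg_seminormP cg q hq e e0.
by apply: filterS (cg q hq e e0) => y H _.
Qed.

Lemma diff_at_of_coord S (f : R -> R) (d : R) c x :
  is_derive (x 0 c) 1 f d ->
  diff_at S (fun z => f (z 0 c) : R^o) (fun j => if j == c then d else 0) x.
Proof.
move=> /is_derive1_caratheodory[g [gE cg gd]] q hq e e0.
have q1 : 0 < q (1 : R^o) + 1 by rewrite ltr_wpDl// seminorm_ge0.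
have e1 : 0 < e / (q (1 : R^o) + 1) by rewrite divr_gt0.
have /near_realP[r r0 rP] : \forall t \near x 0 c, `|g t - g (x 0 c)| <= e / (q (1 : R^o) + 1).
  by move/cvgrPdist_le : cg => /(_ _ e1); apply: filterS => t; rewrite distrC.
apply/near_rowP; exists r => // y yx _.
have yxc : `|y 0 c - x 0 c| <= `|y - x| by have := coord_le_norm (y - x) c; rewrite !mxE.
have -> : lincomb (fun j => if j == c then d : R^o else 0) (y - x) = (y 0 c - x 0 c) * d.
  rewrite /lincomb (bigD1 c)//= eqxx big1 ?addr0 => [|j /negbTE ->]; last by rewrite scaler0.
  by rewrite !mxE.
have -> : f (y 0 c) - f (x 0 c) - (y 0 c - x 0 c) * d =
    ((g (y 0 c) - g (x 0 c)) * (y 0 c - x 0 c)) *: (1 : R^o).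
  by rewrite gE gd /GRing.scale/= mulr1; ring.
rewrite seminormZ// normrM.
have := rP (y 0 c) (le_lt_trans yxc yx); rewrite ler_pdivlMr// => H.
have := seminorm_ge0 (1 : R^o) hq.
have := normr_ge0 (g (y 0 c) - g (x 0 c)); have := normr_ge0 (y 0 c - x 0 c).
set G := `|g _ - _| in H *; set Y := `|y 0 c - _| in yxc *; set Q := q 1 in H *.
move=> Y0 G0 Q0; apply: (@le_trans _ _ (G * Q * `|y - x|)).
  by rewrite mulrAC ler_wpM2l// mulr_ge0.
by apply: ler_wpM2r => //; nra.
Qed.

Definition unit_jet w x : R^o := (w == [::])%:R.

Lemma isjet_unit S : isjet k S unit_jet.
Proof.
move=> w x _; split=> _; first exact: cont_at_cst.
exact: diff_at_eqc (diff_at_cst S _ x).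
Qed.

(** The jet of [b 0 (lam * x 0 c - m)]: its derivatives along the other
    coordinates vanish. *)
Definition coord_bump (lam : R) (m : int) (c : 'I_n) w x : R^o :=
  if all (pred1 c) w then lam ^+ size w * b (size w) (lam * x 0 c - m%:~R) else 0.

Lemma is_derive_affine (lam : R) (m : int) (t : R) :
  is_derive t 1 (fun t : R => lam * t - m%:~R) lam.
Proof.
have h1 : is_derive t 1 (fun t : R => lam *: t : R^o) (lam *: 1 : R^o).
  exact: is_deriveZ.
have h2 : is_derive t 1 (fun _ : R => m%:~R : R^o) 0 by exact: is_derive_cst.
by have := is_deriveB h1 h2; rewrite subr0 /GRing.scale/= mulr1.
Qed.

Lemma continuous_of_coord (f : R -> R) c : continuous f ->
  continuous (fun z : 'rV[R]_n => f (z 0 c)).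
Proof.
move=> cf z; apply: (continuous_comp (f := fun z : 'rV[R]_n => z 0 c)).
  exact: coord_continuous.
exact: cf.
Qed.

Lemma isjet_coord_bump S lam m c : isjet k S (coord_bump lam m c).
Proof.
move=> w x _; rewrite /coord_bump /=; split => wk; last first.
  have [wc|wc] := boolP (all (pred1 c) w); last first.
    by apply: diff_at_eqc (diff_at_cst S _ x) => i /=; rewrite andbF.
  pose f (t : R) : R := lam ^+ size w * b (size w) (lam * t - m%:~R).
  have df : is_derive (x 0 c) 1 f (lam ^+ (size w).+1 * b (size w).+1 (lam * x 0 c - m%:~R)).
    have dl := is_derive_affine lam m (x 0 c).
    have dbl := db wk (lam * x 0 c - m%:~R).
    have h := @is_derive1_comp R (b (size w)) (fun t : R => lam * t - m%:~R) _ _ _ dbl dl.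
    have := is_deriveZ (lam ^+ size w : R) h.
    by rewrite /GRing.scale/= exprSr mulrAC mulrA.
  by apply: diff_at_eqc (diff_at_of_coord S df) => i; rewrite andbT.
have [wc|wc] := boolP (all (pred1 c) w); last exact: cont_at_cst.
apply: continuous_cont_at.
apply: (continuous_of_coord (f := fun t => lam ^+ size w * b (size w) (lam * t - m%:~R))).
apply: (@smoothM R 0 (fun=> lam ^+ size w)); first exact: smooth_cst.
apply: (@smooth_comp R 0 (b (size w))); first exact: cb.
exact: is_derive_continuous (is_derive_affine lam m).
Qed.

Definition grid_bump_on (r : seq 'I_n) (lam : R) (m : 'I_n -> int) : seq 'I_n -> 'rV[R]_n -> R^o :=
  foldr (fun c K => leibniz (coord_bump lam (m c) c) K) unit_jet r.

Definition grid_bump := grid_bump_on (enum 'I_n).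

Lemma isjet_grid_bump S lam m : isjet k S (grid_bump lam m).
Proof.
rewrite /grid_bump; elim: (enum _) => [|c r IH]; first exact: isjet_unit.
by rewrite /=; apply: isjet_leibniz => //; exact: isjet_coord_bump.
Qed.

Lemma grid_bump_nil lam m x :
  grid_bump lam m [::] x = \prod_c b 0%N (lam * x 0 c - (m c)%:~R).
Proof.
rewrite /grid_bump -big_enum /=; elim: (enum _) => [|c r IH]; first by rewrite big_nil.
by rewrite /= leibniz_nil IH big_cons /coord_bump /= expr0 mul1r.
Qed.

Lemma grid_bump_eq0 lam m w x c : (size w <= k)%N ->
  1 < `|lam * x 0 c - (m c)%:~R| -> grid_bump lam m w x = 0.
Proof.
move=> wk xc; pose O := [set y : 'rV[R]_n | 1 < `|lam * y 0 c - (m c)%:~R|].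
have oO : open O.
  have cf : continuous (fun y : 'rV[R]_n => `|lam * y 0 c - (m c)%:~R|).
    apply: (continuous_of_coord (f := fun t : R => `|lam * t - (m c)%:~R|)).
    apply: (@smooth_comp R 0 Num.norm); first exact: norm_continuous.
    exact: is_derive_continuous (is_derive_affine lam (m c)).
  have -> : O = (fun y : 'rV[R]_n => `|lam * y 0 c - (m c)%:~R|) @^-1` [set t | 1 < t] by [].
  by apply: open_comp => [y _|]; [exact: cf|exact: open_gt].
apply: (@isjet_unique R n R^o k O (grid_bump lam m) (fun _ _ => 0) hR oO) => //;
  [exact: isjet_grid_bump|exact: isjet_cst0|move=> y yO].
by rewrite grid_bump_nil (bigD1 c)//= b_supp ?mul0r// ltW.
Qed.

Lemma grid_bump_supp lam m w x : (size w <= k)%N -> grid_bump lam m w x != 0 ->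
  forall c, `|lam * x 0 c - (m c)%:~R| <= 1.
Proof.
move=> wk H c; rewrite leNgt; apply/negP => xc.
by rewrite (grid_bump_eq0 wk xc) eqxx in H.
Qed.

Lemma grid_bump_le : exists2 C : R, 0 <= C & forall lam m w x, 0 <= lam ->
  (size w <= k)%N -> `|grid_bump lam m w x| <= C * lam ^+ size w.
Proof.
have M0 : 0 <= M by rewrite (le_trans _ (@bM 0%N 0 _ _))// normr0.
pose C := (2 ^+ k * M) ^+ size (enum 'I_n).
have C0 : 0 <= C by rewrite exprn_ge0// mulr_ge0.
exists C => // lam m w x lam0 wk.
have [xm|] := pselect (forall c, `|lam * x 0 c - (m c)%:~R| <= 1); last first.
  move=> /existsNP[c /negP]; rewrite -ltNge => xc.
  by rewrite (grid_bump_eq0 wk xc) normr0 mulr_ge0// exprn_ge0.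
rewrite /C /grid_bump; elim: (enum _) w wk => [|c r IH] w wk /=.
  rewrite expr0 mul1r /unit_jet; case: eqP => [->|_]; first by rewrite normr1.
  by rewrite normr0 exprn_ge0.
have C'0 : 0 <= (2 ^+ k * M) ^+ size r by rewrite exprn_ge0// mulr_ge0.
have H u v : (size u + size v)%N = size w ->
    `|coord_bump lam (m c) c u x| * `|grid_bump_on r lam m v x| <=
    M * (2 ^+ k * M) ^+ size r * lam ^+ size w.
  move=> uvw; rewrite -uvw exprD.
  have uk : (size u <= k)%N by rewrite (leq_trans _ wk)// -uvw leq_addr.
  have vk : (size v <= k)%N by rewrite (leq_trans _ wk)// -uvw leq_addl.
  have h1 : `|coord_bump lam (m c) c u x| <= M * lam ^+ size u.
    rewrite /coord_bump; case: ifP => _; last by rewrite normr0 mulr_ge0// exprn_ge0.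
    by rewrite normrM normrX (ger0_norm lam0) mulrC ler_wpM2r ?exprn_ge0// bM.
  have := ler_pM (normr_ge0 _) (normr_ge0 _) h1 (IH v vk).
  by rewrite mulrACA.
have := leibniz_le norm_seminorm H.
move=> /le_trans; apply; rewrite !mulrA ler_wpM2r ?exprn_ge0//.
by rewrite exprS ler_wpM2r// ler_wpM2r// ler_weXn2l// ler1n.
Qed.

Lemma int_window (a f : int) : f - 2 < a -> a < f + 3 -> 0 <= a - f + 1 < 4.
Proof. lia. Qed.

Lemma int_window_abs (a f : int) : 0 <= a - f + 1 < 4 ->
  a = f + `|(a - f + 1)%R|%N - 1.
Proof. lia. Qed.

(** The grid points whose bumps may be nonzero near [x]: four candidates for each
    coordinate. *)
Definition grid_points (lam : R) x : seq {ffun 'I_n -> int} :=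
  [seq [ffun c => Num.floor (lam * x 0 c) + (f c : nat)%:Z - 1]
     | f : {ffun 'I_n -> 'I_4}].

Lemma grid_points_uniq lam x : uniq (grid_points lam x).
Proof.
rewrite map_inj_uniq ?enum_uniq// => f g /ffunP fg; apply/ffunP => c.
have := fg c; rewrite !ffunE => /addIr /addrI [] fgc; exact: val_inj.
Qed.

Lemma size_grid_points lam x : size (grid_points lam x) = (4 ^ n)%N.
Proof. by rewrite size_map -cardE card_ffun !card_ord. Qed.

Lemma grid_points_mem lam x y m w : (size w <= k)%N ->
  (forall c, `|lam * y 0 c - lam * x 0 c| < 1) ->
  m \notin grid_points lam x -> grid_bump lam m w y = 0.
Proof.
move=> wk xy mx; apply: contraNeq mx => /(grid_bump_supp wk) ym.
pose e c := m c - Num.floor (lam * x 0 c) + 1.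
have eP c : (0 <= e c < 4)%R.
  have := ym c; have := xy c; have /andP[] := floor_itv (lam * x 0 c).
  rewrite /e ler_norml ltr_norml rmorphD/=.
  set f := Num.floor _ => f1 f2 /andP[a1 a2] /andP[b1 b2].
  have h1 : f%:~R - 2 < (m c)%:~R :> R by lra.
  have h2 : (m c)%:~R < f%:~R + 3 :> R by lra.
  apply: int_window; rewrite -(ltr_int R); first by rewrite rmorphB.
  by rewrite rmorphD.
have e4 c : (`|e c| < 4)%N by have := eP c; lia.
apply/mapP; exists [ffun c => Ordinal (e4 c)]; first by rewrite mem_enum.
apply/ffunP => c; rewrite !ffunE /=.
exact: int_window_abs (eP c).
Qed.

(** The sum factors as the product over the coordinates of the sums of [b_sum]. *)
Lemma grid_bump_sum lam x y :
  (forall c, `|lam * y 0 c - lam * x 0 c| < 1) ->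
  \sum_(m <- grid_points lam x) grid_bump lam m [::] y = 1.
Proof.
move=> xy; rewrite big_map big_enum /=.
have E (f : {ffun 'I_n -> 'I_4}) : grid_bump lam [ffun c => Num.floor (lam * x 0 c) + (f c : nat)%:Z - 1] [::] y
    = \prod_c b 0%N ((lam * y 0 c - (Num.floor (lam * x 0 c))%:~R) + 1 - (f c)%:R).
  rewrite grid_bump_nil; apply: eq_bigr => c _; congr (b 0%N _).
  by rewrite ffunE rmorphB rmorphD/= ; ring.
rewrite (eq_bigr _ (fun f _ => E f)).
rewrite -(bigA_distr_bigA (fun c (j : 'I_4) =>
  b 0%N ((lam * y 0 c - (Num.floor (lam * x 0 c))%:~R) + 1 - j%:R))).
rewrite big1// => c _; apply: b_sum.
  have := xy c; have /andP[] := floor_itv (lam * x 0 c).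
  by rewrite ltr_norml rmorphD/= => ? ? /andP[? ?]; lra.
have := xy c; have /andP[] := floor_itv (lam * x 0 c).
by rewrite ltr_norml rmorphD/= => ? ? /andP[? ?]; lra.
Qed.

Lemma near_grid lam x : 0 <= lam ->
  \forall y \near x, forall c, `|lam * (y : 'rV[R]_n) 0 c - lam * x 0 c| < 1.
Proof.
move=> lam0; apply/near_rowP; exists (lam + 1)^-1; first by rewrite invr_gt0 ltr_wpDl.
move=> y; rewrite -[ltRHS]mul1r ltr_pdivlMr ?ltr_wpDl// => yx c.
rewrite -mulrBr normrM (ger0_norm lam0).
have := coord_le_norm (y - x) c; rewrite !mxE; have := normr_ge0 (y - x).
have := normr_ge0 (y 0 c - x 0 c); nra.
Qed.

(** The sum of the bumps at all the grid points selected by [P]: those outside of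
    [grid_points lam x] vanish near [x]. *)
Definition grid_sum (P : {ffun 'I_n -> int} -> bool) (lam : R) w x : R^o :=
  \sum_(m <- grid_points lam x) (P m)%:R *: grid_bump lam m w x.

Lemma isjet_grid_sum S P lam : 0 <= lam -> isjet k S (grid_sum P lam).
Proof.
move=> lam0; apply: isjetW (_ : isjet k setT _) => //.
apply: (isjet_locally_finite (J := fun m w x => (P m)%:R *: grid_bump lam m w x)).
  move=> x _; split; first exact: grid_points_uniq.
  apply: filterS (near_grid x lam0) => y xy m w mx wk.
  by rewrite (grid_points_mem wk xy mx) scaler0.
move=> m w x Sx; have [c d] := @isjet_grid_bump setT lam m w x Sx.
split => wk.
  by apply: cont_at_eq (cont_at_P (P m)%:R (c wk) (cont_at_cst _ 0 _)) => y; rewrite addr0.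
apply: diff_at_eq (diff_at_eqc _ (diff_at_P (P m)%:R (d wk) (diff_at_cst _ 0 _))) => y;
  by rewrite addr0.
Qed.

Lemma grid_sum_le : exists2 C : R, 0 <= C & forall P lam w x, 0 <= lam ->
  (size w <= k)%N -> `|grid_sum P lam w x| <= C * lam ^+ size w.
Proof.
have [C C0 HC] := grid_bump_le; exists ((4 ^ n)%N%:R * C); first exact: mulr_ge0.
move=> P lam w x lam0 wk; rewrite (le_trans (ler_norm_sum _ _ _))//.
rewrite (@le_trans _ _ (\sum_(m <- grid_points lam x) C * lam ^+ size w))//.
  apply: ler_sum => m _; rewrite normrM -[leRHS]mul1r.
  apply: ler_pM => //; last exact: HC.
  by case: (P m); rewrite ?normr1 ?normr0.
rewrite big_const_seq count_predT iter_addr addr0 size_grid_points.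
by rewrite -mulrA mulr_natl.
Qed.

Lemma grid_sum_eq0 (P : {ffun 'I_n -> int} -> bool) lam x :
  (forall m : {ffun 'I_n -> int},
     (forall c, `|lam * x 0 c - (m c)%:~R| <= 1) -> ~~ P m) ->
  grid_sum P lam [::] x = 0.
Proof.
move=> H; rewrite /grid_sum big1// => m _.
have [->|/(grid_bump_supp (w := [::]) (leq0n k)) /H /negbTE ->] :=
  eqVneq (grid_bump lam m [::] x) 0; first by rewrite scaler0.
by rewrite scale0r.
Qed.

Lemma grid_sum_eq1 (P : {ffun 'I_n -> int} -> bool) lam x :
  (forall m : {ffun 'I_n -> int},
     (forall c, `|lam * x 0 c - (m c)%:~R| <= 1) -> P m) ->
  grid_sum P lam [::] x = 1.
Proof.
move=> H; rewrite -(@grid_bump_sum lam x x) => [|c]; last first.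
  by rewrite subrr normr0.
apply: eq_bigr => m _.
have [->|/(grid_bump_supp (w := [::]) (leq0n k)) /H ->] :=
  eqVneq (grid_bump lam m [::] x) 0; first by rewrite scaler0.
by rewrite scale1r.
Qed.

End GridBumps.

(** * Whitney partition of unity *)

Section WhitneyPartition.
Context {R : realType} {n : nat}.
Variables (k : nat) (A : set 'rV[R]_n).
Hypothesis A0 : A !=set0.
Implicit Types (x y : 'rV[R]_n) (w u v : seq 'I_n).
Local Notation d := (dist_set A).

Let level_exists x : 0 < d x -> exists j, 2^-1 <= 2 ^+ j.+1 * d x.
Proof.
move=> dx; exists (Num.truncn (d x)^-1).
have : (d x)^-1 < (Num.truncn (d x)^-1).+1%:R by exact: truncnS_gt.
set N := Num.truncn _ => h.
have h2 : N.+1%:R <= 2 ^+ N.+1 :> R by rewrite -natrX ler_nat ltnW// ltn_expl.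
have h3 : 1 <= 2 ^+ N.+1 * d x.
  by rewrite -ler_pdivrMr// div1r (le_trans (ltW h)).
by rewrite (le_trans _ h3)// invf_le1// ler1n.
Qed.

(** A Whitney partition of unity off [A]: C^k functions [phi i]
    living at distance and scale comparable to the distance [d] to [A],
    each with an associated point [p i] of [A].  They sum to 1 where [d < 1].
    The functions are [(chi_(j+1) - chi_j) * psi_(j+1, m)], where [psi_(j, m)] is
    the grid bump of mesh [2 ^- j] at the grid point [m] and [chi_j] the sum of
    those [psi_(j, m)] whose grid point is at distance at least [2 * 2 ^- j] from
    A.  As the bumps of each mesh sum to 1 and the differences telescope over j,
    the bounds on the derivatives are those of products of bumps. *)
Theorem whitney_partition :
  exists (I : eqType) (phi : I -> seq 'I_n -> 'rV[R]_n -> R^o)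
    (p : I -> 'rV[R]_n) (r : 'rV[R]_n -> seq I) (C : R) (N : nat),
  [/\ forall i, isjet k setT (phi i) /\ A (p i),
      locally_finite_jets k [set x | 0 < d x] phi r,
      forall x, 0 < d x -> d x < 1 -> \sum_(i <- r x) phi i [::] x = 1,
      forall x, 0 < d x -> (size (r x) <= N)%N &
      0 <= C /\ forall i w x, 0 < d x -> (size w <= k)%N ->
        phi i w x = 0 \/
        `|x - p i| <= 4 * d x /\ `|phi i w x| <= C / d x ^+ size w].
Proof.
have [b [M [db cb bM bs bS]]] := @bump_exists R k.
have hR : hausdorff_space R^o := @norm_hausdorff R R^o.
pose lam j : R := 2 ^+ j.
have lam0 j : 0 < lam j by rewrite exprn_gt0.
have lam_ge0 j : 0 <= lam j by exact: ltW.
have lamS j : lam j.+1 = 2 * lam j by rewrite /lam exprS.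
have lamle i j : (i <= j)%N -> lam i <= lam j.
  by move=> ij; rewrite ler_weXn2l// ler1n.
pose psi j (m : {ffun 'I_n -> int}) := @grid_bump R n b (lam j) m.
pose z j (m : {ffun 'I_n -> int}) : 'rV[R]_n := \row_c ((m c)%:~R / lam j).
pose P j (m : {ffun 'I_n -> int}) := 2 <= d (z j m) * lam j.
pose chi j := grid_sum b (P j) (lam j).
pose theta j w x : R^o := -1 *: chi j w x + chi j.+1 w x.
pose phi (i : nat * {ffun 'I_n -> int}) : seq 'I_n -> 'rV[R]_n -> R^o :=
  leibniz (theta i.1) (psi i.1.+1 i.2).
have jpsi S j m : isjet k S (psi j m) by exact: isjet_grid_bump.
have jchi S j : isjet k S (chi j) by apply: (isjet_grid_sum db cb bs).
have jtheta S j : isjet k S (theta j) by exact: isjet_P.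
have jphi S i : isjet k S (phi i) by exact: isjet_leibniz.
have zx j (m : {ffun 'I_n -> int}) x : (forall c, `|lam j * x 0 c - (m c)%:~R| <= 1) ->
    `|x - z j m| * lam j <= 1.
  move=> xm; rewrite -ler_pdivlMr//; apply: row_norm_le.
    by rewrite divr_ge0.
  move=> c; rewrite !mxE ler_pdivlMr// -{2}(ger0_norm (lam_ge0 j)) -normrM mulrBl.
  by rewrite divfK ?gt_eqF// mulrC.
have dz x j (m : {ffun 'I_n -> int}) : (forall c, `|lam j * x 0 c - (m c)%:~R| <= 1) ->
    d (z j m) * lam j <= d x * lam j + 1 /\ d x * lam j <= d (z j m) * lam j + 1.
  move=> /zx h; have h1 := dist_set_lipschitz A0 x (z j m).
  have h2 := dist_set_lipschitz A0 (z j m) x; rewrite distrC in h2.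
  by have := lam0 j; split; nra.
(* a bump lives within one mesh of its grid point, so that [chi j] vanishes
   where [d] is less than one mesh and is 1 where [d] is at least three *)
have chi0 j x : d x * lam j < 1 -> chi j [::] x = 0.
  move=> dx; apply: (grid_sum_eq0 db cb bs) => m /dz[h _].
  by rewrite /P -ltNge; lra.
have chi1 j x : 3 <= d x * lam j -> chi j [::] x = 1.
  move=> dx; apply: (grid_sum_eq1 db cb bs bS) => m /dz[_ h].
  by rewrite /P; lra.
have theta_low j x : d x * lam j.+1 < 1 -> theta j [::] x = 0.
  move=> dx; rewrite /theta !chi0//; first by rewrite scaler0 addr0.
  by move: dx; rewrite lamS; have := dist_set_ge0 A0 x; have := lam0 j; nra.
have theta_high j x : 6 < d x * lam j.+1 -> theta j [::] x = 0.
  move=> dx; rewrite /theta !chi1//; first by rewrite scaleN1r addNr.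
    by lra.
  by move: dx; rewrite lamS; lra.
(* by uniqueness of jets, all derivatives vanish with the function *)
have theta_eq0 O j w x : open O -> O x -> (forall y, O y -> theta j [::] y = 0) ->
    (size w <= k)%N -> theta j w x = 0.
  move=> oO Ox H wk; apply: (@isjet_unique R n R^o k O (theta j) (fun _ _ => 0) hR oO) => //.
  exact: isjet_cst0.
have phi_eq0l j m w x : (forall u, (size u <= k)%N -> theta j u x = 0) ->
    (size w <= k)%N -> phi (j, m) w x = 0.
  move=> H wk; apply: leibniz0 => u v uv; rewrite H ?scale0r//.
  by rewrite (leq_trans _ wk)// -uv leq_addr.
have phi_eq0r j m w x : (forall u, (size u <= k)%N -> psi j.+1 m u x = 0) ->
    (size w <= k)%N -> phi (j, m) w x = 0.
  move=> H wk; apply: leibniz0 => u v uv; rewrite (H v) ?scaler0//.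
  by rewrite (leq_trans _ wk)// -uv leq_addl.
have p_exists (i : nat * {ffun 'I_n -> int}) : exists a,
    A a /\ `|z i.1.+1 i.2 - a| < d (z i.1.+1 i.2) + (lam i.1.+1)^-1.
  have [|a Aa h] := dist_set_close A0 (z i.1.+1 i.2) (e := (lam i.1.+1)^-1).
    by rewrite invr_gt0.
  by exists a.
have [p pP] := choice p_exists.
(* near [x] the function [theta j] vanishes unless [1/2 <= 2 ^ j.+1 * d x < 12],
   so that five levels suffice, from the least one with [1/2 <= 2 ^ j.+1 * d x] *)
pose lev x := if pselect (exists j, 2^-1 <= 2 ^+ j.+1 * d x) is left h
  then ex_minn h else 0%N.
have levP x : 0 < d x -> 2^-1 <= lam (lev x).+1 * d x /\
    forall j, (j < lev x)%N -> lam j.+1 * d x < 2^-1.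
  move=> dx; rewrite /lev; case: pselect => [h|/(_ (level_exists dx))//].
  case: ex_minnP => j hj jmin; split => // i ij; rewrite ltNge; apply/negP => hi.
  by have := jmin i hi; rewrite leqNgt ij.
pose r x := [seq (j, m) | j <- iota (lev x) 5, m <- grid_points (lam j.+1) x].
have [C1 C10 HC1] := grid_bump_le (n := n) db cb bM bs.
have [C2 C20 HC2] := grid_sum_le (n := n) db cb bM bs.
pose C3 := 2 ^+ k * (2 * C2 * C1) * 6 ^+ k.
exists (nat * {ffun 'I_n -> int})%type, phi, p, r, C3, (5 * 4 ^ n)%N; split.
- by move=> i; split; [exact: jphi|exact: (pP i).1].
- move=> x /= dx; split.
    apply: allpairs_uniq_dep; rewrite ?iota_uniq//.
      by move=> j _; exact: grid_points_uniq.
    by move=> [j m] [j' m'] _ _ /= [-> ->].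
  have [lx1 lx2] := levP x dx.
  pose L := lam (lev x + 6)%N.
  apply/near_rowP; exists (Num.min (d x / 2) L^-1).
    by rewrite lt_min divr_gt0//= invr_gt0 lam0.
  pose O := [set y | `|y - x| < d x / 2].
  have oO : open O.
    rewrite openE => y /= yx; apply/near_rowP; exists (d x / 2 - `|y - x|).
      by rewrite subr_gt0.
    move=> y' y'y; rewrite /O /=.
    have -> : y' - x = (y' - y) + (y - x) by lmod R 'rV[R]_n.
    by rewrite (le_lt_trans (ler_normD _ _))//; lra.
  have Od y : O y -> d x / 2 < d y /\ d y < 2 * d x.
    rewrite /O /= => yx; have h1 := dist_set_lipschitz A0 x y; have h2 := dist_set_lipschitz A0 y x.
    by rewrite distrC in h1; split; lra.
  move=> y; rewrite lt_min => /andP[yO yL] [j m] w jm wk.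
  have [jl|jl] := boolP (j \in iota (lev x) 5); last first.
    apply: phi_eq0l => // u uk; apply: (theta_eq0 O) => // y' /Od[y1 y2].
    move: jl; rewrite mem_iota negb_and -ltnNge -leqNgt => /orP[jl|jl].
      by apply: theta_low; have := lx2 j jl; have := lam0 j.+1; nra.
    have := lamle (lev x + 5)%N j jl; rewrite addnS !addnS addn0 !lamS => h.
    rewrite lamS in lx1.
    apply: theta_high; rewrite lamS; have := lam0 j; have := lam0 (lev x); nra.
  apply: phi_eq0r => // u uk.
  apply: (grid_points_mem db cb bs (lam := lam j.+1) (x := x)) => //.
    move=> c; rewrite -mulrBr normrM ger0_norm//.
    have h1 : `|y 0 c - x 0 c| <= `|y - x|.
      by have := coord_le_norm (y - x) c; rewrite !mxE.
    have h2 : lam j.+1 <= L.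
      by apply: lamle; move: jl; rewrite mem_iota; lia.
    have h3 : `|y - x| * L < 1 by rewrite -ltr_pdivlMr ?div1r ?lam0.
    by have := normr_ge0 (y 0 c - x 0 c); have := lam0 j.+1; nra.
  apply: contra jm => mj; apply/allpairsPdep; exists j, m; split => //.
- move=> x dx dx1; have [lx1 lx2] := levP x dx.
  rewrite big_allpairs_dep /=.
  have E j : \sum_(m <- grid_points (lam j.+1) x) phi (j, m) [::] x = theta j [::] x.
    rewrite (eq_bigr (fun m => theta j [::] x *: psi j.+1 m [::] x)) => [|m _].
      rewrite -scaler_sumr (grid_bump_sum bS); first by rewrite /GRing.scale/= mulr1.
      by move=> c; rewrite subrr normr0.
    by rewrite /phi leibniz_nil.
  rewrite (eq_bigr _ (fun j _ => E j)) /= !big_cons big_nil /theta !scaleN1r.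
  have -> : chi (lev x) [::] x = 0.
    apply: chi0; case lx : (lev x) => [|l]; first by rewrite /lam expr0 mulr1.
    have := lx2 l; rewrite lx ltnSn => /(_ isT); lra.
  have -> : chi (lev x).+1.+4 [::] x = 1.
    by apply: chi1; rewrite !lamS; rewrite lamS in lx1; have := lam0 (lev x); nra.
  by lmod R R^o.
- move=> x dx; rewrite size_allpairs_dep /= !size_grid_points; lia.
- split; first by rewrite !mulr_ge0// exprn_ge0.
  move=> [j m] w x dx wk; have l0 := lam0 j.+1.
  have [low|low] := ltP (d x * lam j.+1) 1.
    left; apply: phi_eq0l => // u uk.
    apply: (theta_eq0 [set y | d y * lam j.+1 < 1]) => //.
      exact: open_dist_set_lt.
    by move=> y; exact: theta_low.
  have [high|high] := ltP 6 (d x * lam j.+1).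
    left; apply: phi_eq0l => // u uk.
    apply: (theta_eq0 [set y | 6 < d y * lam j.+1]) => //.
      exact: open_dist_set_gt.
    by move=> y; exact: theta_high.
  have [xm|] := pselect (forall c, `|lam j.+1 * x 0 c - (m c)%:~R| <= 1); last first.
    move=> /existsNP[c /negP]; rewrite -ltNge => xc.
    left; apply: phi_eq0r => // u uk; exact: (grid_bump_eq0 db cb bs uk xc).
  right; split.
    have [_ /=] := pP (j, m); set a := p _ => za.
    have h1 := zx j.+1 m x xm; have [h2 _] := dz x j.+1 m xm.
    have h3 : `|z j.+1 m - a| * lam j.+1 < d (z j.+1 m) * lam j.+1 + 1.
      by rewrite -[X in _ < _ + X](mulVf (lt0r_neq0 l0)) -mulrDl ltr_pM2r.
    rewrite -(ler_pM2r l0).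
    have -> : x - a = (x - z j.+1 m) + (z j.+1 m - a) by lmod R 'rV[R]_n.
    have := ler_normD (x - z j.+1 m) (z j.+1 m - a); nra.
  have H u v : (size u + size v)%N = size w ->
      `|theta j u x| * `|psi j.+1 m v x| <= 2 * C2 * C1 * lam j.+1 ^+ size w.
    move=> uvw; rewrite -uvw exprD.
    have uk : (size u <= k)%N by rewrite (leq_trans _ wk)// -uvw leq_addr.
    have vk : (size v <= k)%N by rewrite (leq_trans _ wk)// -uvw leq_addl.
    have h1 : `|theta j u x| <= 2 * C2 * lam j.+1 ^+ size u.
      rewrite /theta scaleN1r (le_trans (ler_normD _ _))// normrN.
      have a1 := HC2 (P j) (lam j) u x (lam_ge0 j) uk.
      have a2 := HC2 (P j.+1) (lam j.+1) u x (lam_ge0 j.+1) uk.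
      have a3 : lam j ^+ size u <= lam j.+1 ^+ size u.
        by apply: lerXn2r; rewrite ?nnegrE//; exact: lamle.
      have := ler_wpM2l C20 a3; rewrite /chi; lra.
    have h2 := HC1 (lam j.+1) m v x (lam_ge0 j.+1) vk.
    have := ler_pM (normr_ge0 _) (normr_ge0 _) h1 h2.
    by rewrite mulrACA.
  rewrite (le_trans (leibniz_le norm_seminorm H))//.
  have dxl : lam j.+1 <= 6 / d x by rewrite ler_pdivlMr// mulrC.
  have dxl2 : lam j.+1 ^+ size w <= 6 ^+ k / d x ^+ size w.
    rewrite (@le_trans _ _ ((6 / d x) ^+ size w))//.
      by apply: lerXn2r; rewrite ?nnegrE// divr_ge0// ltW.
    rewrite expr_div_n ler_wpM2r ?invr_ge0 ?exprn_ge0 ?(ltW dx)//.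
    by rewrite ler_weXn2l// ler1n.
  have K0 : 0 <= 2 * C2 * C1 by rewrite !mulr_ge0.
  have -> : C3 / d x ^+ size w = 2 ^+ k * (2 * C2 * C1 * (6 ^+ k / d x ^+ size w)).
    by rewrite /C3 !mulrA.
  apply: ler_pM; [exact: exprn_ge0| | |exact: ler_wpM2l].
    by apply: mulr_ge0 => //; exact: exprn_ge0.
  by rewrite ler_weXn2l// ler1n.
Qed.

End WhitneyPartition.

(** * Extension of jets *)

Lemma subn_split (a b c k : nat) : (a + b)%N = c -> (c <= k)%N ->
  (k - b)%N = (a + (k - c))%N.
Proof. lia. Qed.

Section JetExtension.
Context {R : realType} {n : nat} {E : tvsType R}.
Variables (k : nat) (A : set 'rV[R]_n).
Hypothesis A0 : A !=set0.
Variables (I : eqType) (phi : I -> seq 'I_n -> 'rV[R]_n -> R^o)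
  (p : I -> 'rV[R]_n) (r : 'rV[R]_n -> seq I) (C : R) (N : nat).
Local Notation d := (dist_set A).
Hypothesis phiP : forall i, isjet k setT (phi i) /\ A (p i).
Hypothesis phi_lf : locally_finite_jets k [set x | 0 < d x] phi r.
Hypothesis phi_sum :
  forall x, 0 < d x -> d x < 1 -> \sum_(i <- r x) phi i [::] x = 1.
Hypothesis phi_card : forall x, 0 < d x -> (size (r x) <= N)%N.
Hypothesis C0 : 0 <= C.
Hypothesis phi_bound : forall i w x, 0 < d x -> (size w <= k)%N ->
  phi i w x = 0 \/ `|x - p i| <= 4 * d x /\ `|phi i w x| <= C / d x ^+ size w.
Implicit Types (x y z a : 'rV[R]_n) (w u v : seq 'I_n)
  (J K : seq 'I_n -> 'rV[R]_n -> E) (q : E -> R) (U : set 'rV[R]_n).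

(** The jet of [\sum_i phi_i * T_i], where [T_i] is the Taylor polynomial of [J] at
    the point [p i]. *)
Definition glue J w x : E :=
  \sum_(i <- r x) leibniz (phi i) (taylor k J (p i)) w x.

Definition jet_ext J w x : E := if pselect (A x) then J w x else glue J w x.

Lemma jet_extE J w x : A x -> jet_ext J w x = J w x.
Proof. by rewrite /jet_ext; case: pselect. Qed.

Lemma jet_ext_off J w x : ~ A x -> jet_ext J w x = glue J w x.
Proof. by rewrite /jet_ext; case: pselect. Qed.

Lemma jet_ext_glue J w x : 0 < d x -> jet_ext J w x = glue J w x.
Proof.
rewrite /jet_ext; case: pselect => // Ax dx.
by have := dist_set_le A0 x Ax; rewrite subrr normr0 leNgt dx.
Qed.

Lemma jet_extP (b : R) J K w x :
  jet_ext (fun u y => b *: J u y + K u y) w x =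
  b *: jet_ext J w x + jet_ext K w x.
Proof.
have [Ax|nAx] := pselect (A x); first by rewrite !jet_extE.
rewrite !jet_ext_off// /glue scaler_sumr -big_split; apply: eq_bigr => i _ /=.
rewrite -leibnizPr; congr leibniz; apply/funext => u; apply/funext => y.
exact: taylorP.
Qed.

Lemma open_dist_gt0 : open [set x | 0 < d x].
Proof.
have -> : [set x | 0 < d x] = [set x | 0 < d x * 1].
  by apply/funext => x; rewrite /= mulr1.
exact: open_dist_set_gt.
Qed.

Lemma isjet_glue J : (forall x, symmetric_words (J^~ x)) ->
  isjet k [set x | 0 < d x] (glue J).
Proof.
move=> sJ; apply: (isjet_locally_finite
  (J := fun i => leibniz (phi i) (taylor k J (p i)))) => [x dx|i].
  have [ur zr] := phi_lf dx; split => //; apply: filterS zr => y H i w ir wk.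
  apply: leibniz0 => u v uv; rewrite H ?scale0r//.
  by rewrite (leq_trans _ wk)// -uv leq_addr.
apply: isjet_leibniz; last exact: isjet_taylor.
exact: isjetW (phiP i).1.
Qed.

(** The [phi i] sum to a locally constant function. *)
Lemma phi_sum_eq0 u x : 0 < d x -> d x < 1 -> u != [::] -> (size u <= k)%N ->
  \sum_(i <- r x) phi i u x = 0.
Proof.
move=> dx dx1 u0 uk.
have hR : hausdorff_space R^o := @norm_hausdorff R R^o.
pose O := [set x | 0 < d x] `&` [set x | d x * 1 < 1].
have oO : open O by apply: openI; [exact: open_dist_gt0|exact: open_dist_set_lt].
have jS : isjet k O (fun w x => \sum_(i <- r x) phi i w x).
  apply: isjetW (_ : isjet k [set x | 0 < d x] _); first exact: subIsetl.
  apply: isjet_locally_finite phi_lf _ => i.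
  exact: isjetW (phiP i).1.
have := @isjet_unique R n R^o k O _ (unit_jet (n := n)) hR oO jS (@isjet_unit R n k O) _ u x uk.
rewrite /unit_jet (negbTE u0); apply; last by split; rewrite /= ?mulr1.
by move=> y [/= y0]; rewrite mulr1 => y1; exact: phi_sum.
Qed.

(** The Taylor polynomial at [y] is also glued from copies of itself, by the
    Leibniz rule for its product with [1 = \sum_i phi i]. *)
Lemma glue_taylor J y w x : 0 < d x -> d x < 1 -> (size w <= k)%N ->
  glue J w x - taylor k J y w x = \sum_(i <- r x)
    leibniz (phi i) (fun v z => taylor k J (p i) v z - taylor k J y v z) w x.
Proof.
move=> dx dx1 wk.
have <- : leibniz (fun u z => \sum_(i <- r x) phi i u z) (taylor k J y) w x =
    taylor k J y w x.
  apply: leibniz_unit; first exact: phi_sum.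
  by move=> u u0 uw; apply: phi_sum_eq0 => //; exact: leq_trans wk.
rewrite leibniz_suml /glue -sumrB; apply: eq_bigr => i _.
by rewrite leibnizBr.
Qed.

Let K1 := N%:R * (2 ^+ k * (C * (6 * n.+1%:R) ^+ k)) : R.
Let K2 := K1 + (3 * n.+1%:R) ^+ k : R.

Let K1_ge0 : 0 <= K1.
Proof. by rewrite !mulr_ge0// exprn_ge0// mulr_ge0. Qed.

Let n1 : 1 <= n.+1%:R :> R. Proof. by rewrite ler1n. Qed.

(** Taylor's inequality, in the form of Whitney, for points of [A] near [a]. *)
Definition whitney_near J q a (rho e : R) : Prop :=
  forall x y, A x -> A y -> `|x - a| < rho -> `|y - a| < rho ->
  forall w, (size w <= k)%N ->
    q (J w x - taylor k J y w x) <= e * `|x - y| ^+ (k - size w).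

(** Where [phi i] is nonzero, the point [p i] is within [6 * d x] of [y].  Hence the
    Taylor polynomials differ by [e * d x ^+ (k - size v)] up to a factor, which
    absorbs the bound [C / d x ^+ size u] on the derivatives of [phi i]. *)
Lemma glue_estimate J q a (rho e : R) x y w : continuous_seminorm q ->
  (forall x, symmetric_words (J^~ x)) -> A a -> 0 <= e ->
  whitney_near J q a rho e ->
  0 < d x -> d x < 1 -> 6 * `|x - a| < rho -> A y -> `|x - y| <= 2 * d x ->
  (size w <= k)%N ->
  q (glue J w x - taylor k J y w x) <= K1 * (e * d x ^+ (k - size w)).
Proof.
move=> hq sJ Aa e0 wJ dx dx1 xa Ay xy wk.
have dxa := dist_set_le A0 x Aa.
have ya : `|y - a| < rho.
  have := ler_normD (y - x) (x - a); rewrite addrA subrK [`|y - x|]distrC; lra.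
rewrite glue_taylor// (le_trans (seminorm_sum _ _ _ hq))//.
rewrite (@le_trans _ _ (\sum_(i <- r x)
  2 ^+ k * (C * (6 * n.+1%:R) ^+ k) * (e * d x ^+ (k - size w))))//; last first.
  rewrite big_const_seq count_predT iter_addr addr0 -[leLHS]mulr_natl /K1 -mulrA.
  rewrite -!mulrA ler_wpM2r ?ler_nat ?phi_card//.
  by rewrite !mulr_ge0// ?exprn_ge0// ?mulr_ge0// ltW.
apply: ler_sum => i _.
have H u v : (size u + size v)%N = size w ->
    `|phi i u x| * q (taylor k J (p i) v x - taylor k J y v x) <=
    C * (6 * n.+1%:R) ^+ k * (e * d x ^+ (k - size w)).
  move=> uvw.
  have uk : (size u <= k)%N by rewrite (leq_trans _ wk)// -uvw leq_addr.
  have vk : (size v <= k)%N by rewrite (leq_trans _ wk)// -uvw leq_addl.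
  have [->|[xp phiu]] := phi_bound i dx uk.
    by rewrite normr0 mul0r !mulr_ge0// ?exprn_ge0// ?mulr_ge0// ltW.
  have pa : `|p i - a| < rho.
    have := ler_normD (p i - x) (x - a); rewrite addrA subrK [`|p i - x|]distrC; lra.
  have py : `|p i - y| <= 6 * d x.
    have := ler_normD (p i - x) (x - y); rewrite addrA subrK [`|p i - x|]distrC; lra.
  have h : q (taylor k J (p i) v x - taylor k J y v x) <=
      n.+1%:R ^+ (k - size v) * (e * (6 * d x) ^+ (k - size v)).
    apply: taylor_compare => //; first by lra.
    move=> w' wk'; rewrite (le_trans (wJ _ _ (phiP i).2 Ay pa ya w' wk'))//.
    by rewrite ler_wpM2l//; apply: lerXn2r; rewrite ?nnegrE// (le_trans _ py).
  have := ler_pM (normr_ge0 _) (seminorm_ge0 _ hq) phiu h.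
  move/le_trans; apply.
  have -> : n.+1%:R ^+ (k - size v) * (e * (6 * d x) ^+ (k - size v)) =
      (6 * n.+1%:R) ^+ (k - size v) * (e * d x ^+ (k - size v)).
    by rewrite !exprMn; ring.
  have -> : d x ^+ (k - size v) = d x ^+ size u * d x ^+ (k - size w).
    by rewrite -exprD -(subn_split uvw wk).
  have -> : C / d x ^+ size u * ((6 * n.+1%:R) ^+ (k - size v) *
      (e * (d x ^+ size u * d x ^+ (k - size w)))) =
      C * (6 * n.+1%:R) ^+ (k - size v) * (e * d x ^+ (k - size w)).
    by field; rewrite expf_neq0// gt_eqF.
  rewrite ler_wpM2r//; first by rewrite mulr_ge0// exprn_ge0// ltW.
  rewrite ler_wpM2l// ler_weXn2l ?leq_subr//; have := n1; lra.
rewrite (le_trans (leibniz_le hq H))// -!mulrA ler_wpM2r//.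
  by rewrite !mulr_ge0// ?exprn_ge0// ?mulr_ge0// ltW.
by rewrite ler_weXn2l// ler1n.
Qed.

(** The comparison passes through the Taylor polynomial at a point [y] of [A] that
    is almost closest to [x]. *)
Lemma jet_ext_estimate J q a (rho e : R) x w : continuous_seminorm q ->
  (forall x, symmetric_words (J^~ x)) -> A a -> 0 <= e ->
  whitney_near J q a rho e -> A x \/ 0 < d x -> 6 * `|x - a| < rho ->
  `|x - a| < 1 -> (size w <= k)%N ->
  q (jet_ext J w x - taylor k J a w x) <= K2 * (e * `|x - a| ^+ (k - size w)).
Proof.
move=> hq sJ Aa e0 wJ Axd xa xa1 wk.
have K31 : 1 <= (3 * n.+1%:R) ^+ k :> R.
  by rewrite exprn_ege1//; have := n1; lra.
have xn := normr_ge0 (x - a).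
have rho0 : 0 < rho by lra.
have [Ax|nAx] := pselect (A x).
  rewrite jet_extE// (le_trans (wJ x a Ax Aa _ _ w wk))//.
  - by lra.
  - by rewrite subrr normr0.
  rewrite -[leLHS]mul1r ler_wpM2r//; first by rewrite mulr_ge0// exprn_ge0.
  by rewrite /K2; have := K1_ge0; lra.
have {Axd} dx : 0 < d x by case: Axd.
have dxa := dist_set_le A0 x Aa.
have [y Ay xy] := dist_set_close A0 x dx.
have ya : `|y - a| <= 3 * `|x - a|.
  have := ler_normD (y - x) (x - a); rewrite addrA subrK [`|y - x|]distrC; lra.
rewrite jet_ext_glue// (le_trans (seminorm_dist (taylor k J y w x) _ _ hq))//.
rewrite /K2 mulrDl lerD//.
  rewrite (le_trans (glue_estimate hq sJ Aa e0 wJ dx _ xa Ay _ wk))//; [lra|lra|].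
  rewrite ler_wpM2l// ler_wpM2l//; apply: lerXn2r; rewrite ?nnegrE//; exact: ltW.
have h : q (taylor k J y w x - taylor k J a w x) <=
    n.+1%:R ^+ (k - size w) * (e * (3 * `|x - a|) ^+ (k - size w)).
  apply: taylor_compare => //; first by lra.
  move=> v vk; rewrite (le_trans (wJ _ _ Ay Aa _ _ v vk))//; first by lra.
    by rewrite subrr normr0.
  by rewrite ler_wpM2l//; apply: lerXn2r; rewrite ?nnegrE// mulr_ge0.
rewrite (le_trans h)//.
have -> : n.+1%:R ^+ (k - size w) * (e * (3 * `|x - a|) ^+ (k - size w)) =
    (3 * n.+1%:R) ^+ (k - size w) * (e * `|x - a| ^+ (k - size w)).
  by rewrite !exprMn; ring.
rewrite ler_wpM2r//; first by rewrite mulr_ge0// exprn_ge0.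
by rewrite ler_weXn2l ?leq_subr//; have := n1; lra.
Qed.

Definition segment_near a (rho : R) : Prop :=
  forall x y, A x -> A y -> `|x - a| < rho -> `|y - a| < rho ->
  forall z, segment x y z -> A z /\ `|z - a| < rho.

Lemma segment_nearP a : locally_convex_set A -> A a ->
  exists2 rho0 : R, 0 < rho0 & forall rho, rho <= rho0 -> segment_near a rho.
Proof.
move=> lcA Aa; have [D [cD DA]] := lcA a Aa.
move=> /near_rowP[rho0 rho00 HD]; exists rho0 => // rho rle x y Ax Ay xa ya _ [t /andP[t0 t1] <-].
split.
  have Dx : D x by apply: HD => //; exact: lt_le_trans rle.
  have Dy : D y by apply: HD => //; exact: lt_le_trans rle.
  apply: DA; have -> : x + t *: (y - x) = t *: y + (1 - t) *: x by lmod R 'rV[R]_n.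
  exact: convex_setP.
have -> : x + t *: (y - x) - a = t *: (y - a) + (1 - t) *: (x - a) by lmod R 'rV[R]_n.
rewrite (le_lt_trans (ler_normD _ _))// !normrZ (ger0_norm t0) ger0_norm ?subr_ge0//.
have [->|tn0] := eqVneq t 0; first by rewrite mul0r add0r subr0 mul1r.
have tp : 0 < t by rewrite lt_neqAle eq_sym tn0.
have : t * `|y - a| < t * rho by rewrite ltr_pM2l.
have : (1 - t) * `|x - a| <= (1 - t) * rho by rewrite ler_wpM2l ?subr_ge0// ltW.
lra.
Qed.

Lemma whitney_near_osc J q a (rho e : R) : continuous_seminorm q ->
  (forall x, symmetric_words (J^~ x)) -> isjet k A J -> 0 <= e ->
  segment_near a rho ->
  (forall w x y, size w = k -> A x -> A y -> `|x - a| < rho -> `|y - a| < rho ->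
    q (J w x - J w y) <= e) ->
  whitney_near J q a rho (n.+1%:R ^+ k * e).
Proof.
move=> hq sJ jJ e0 seg osc x y Ax Ay xa ya w wk.
have := taylor_remainder hq sJ jJ (x := x) (y := y) (e := e).
move=> /(_ _ e0 _ w wk)/le_trans; apply.
- by move=> z /(seg y x Ay Ax ya xa)[].
- by move=> v z vk /(seg y x Ay Ax ya xa)[Az za]; exact: osc.
- rewrite -mulrA ler_wpM2r ?mulr_ge0 ?exprn_ge0//.
  by rewrite ler_weXn2l ?leq_subr.
Qed.

(** By local convexity Taylor's inequality applies between all points of [A]
    near [a]. *)
Lemma near_whitney J q a (e : R) : continuous_seminorm q ->
  locally_convex_set A -> A a ->
  (forall x, symmetric_words (J^~ x)) -> isjet k A J -> 0 < e ->
  exists2 rho, 0 < rho & whitney_near J q a rho (n.+1%:R ^+ k * e).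
Proof.
move=> hq lcA Aa sJ jJ e0; have [rho0 rho00 seg] := segment_nearP lcA Aa.
have e2 : 0 < e / 2 by rewrite divr_gt0.
have H : \forall z \near a, forall t : k.-tuple 'I_n,
    A z -> q (J t z - J t a) <= e / 2.
  apply: (@filter_forall _ _ (fun (t : k.-tuple 'I_n) z =>
    A z -> q (J t z - J t a) <= e / 2) (nbhs a) _) => t.
  by apply: (jJ t a Aa).1 hq _ e2; rewrite size_tuple.
have /near_rowP[rho1 rho10 H1] := H.
exists (Num.min rho0 rho1); first by rewrite lt_min rho00.
apply: whitney_near_osc => //; first exact: ltW.
  by apply: seg; rewrite ge_min lexx.
move=> w x y wk Ax Ay; rewrite !lt_min => /andP[_ xa] /andP[_ ya].
have wk' : size w == k by apply/eqP.
have h1 := H1 x xa (Tuple wk') Ax; have h2 := H1 y ya (Tuple wk') Ay.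
rewrite /= in h1 h2.
rewrite (le_trans (seminorm_dist (J w a) _ _ hq))// [q (J w a - _)]seminorm_distC//.
by rewrite [e]splitr lerD.
Qed.

(** At a point [a] of [A] the extension differs from the Taylor polynomial of [J]
    by [o(|x - a|^(k - size w))], and hence has the same derivatives there. *)
Lemma isjet_jet_ext U J : locally_convex_set A ->
  (forall x, U x -> A x \/ 0 < d x) ->
  (forall x, symmetric_words (J^~ x)) -> isjet k A J -> isjet k U (jet_ext J).
Proof.
move=> lcA UA sJ jJ w a Ua.
have [Aa|nAa] := pselect (A a); last first.
  have da : 0 < d a by case: (UA a Ua).
  have [cg dg] := @isjet_glue J sJ w a da.
  have near_a v : \forall y \near a, U y -> 0 < d y /\ jet_ext J v y = glue J v y.
    have : \forall y \near a, 0 < d y by apply: open_dist_gt0.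
    by apply: filterS => y dy _; split => //; exact: jet_ext_glue.
  split => wk.
    by apply: cont_at_local (near_a w) _ (cg wk); exact: jet_ext_glue.
  apply: diff_at_local (near_a w) _ _; first exact: jet_ext_glue.
  by apply: diff_at_eqc (dg wk) => i; rewrite jet_ext_glue.
have K2p : 0 < K2.
  by rewrite /K2 ltr_wpDl// exprn_gt0// mulr_gt0.
have Np : 0 < n.+1%:R ^+ k :> R by rewrite exprn_gt0.
have key q e : continuous_seminorm q -> 0 < e -> (size w <= k)%N ->
    \forall x \near a, U x ->
      q (jet_ext J w x - taylor k J a w x) <= e * `|x - a| ^+ (k - size w) /\
      `|x - a| < 1.
  move=> hq e0 wk.
  have e1 : 0 < e / K2 / n.+1%:R ^+ k by rewrite !divr_gt0.
  have [rho rho0 wJ] := near_whitney hq lcA Aa sJ jJ e1.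
  apply/near_rowP; exists (Num.min 1 (rho / 6)); first by rewrite lt_min ltr01 divr_gt0.
  move=> x; rewrite lt_min => /andP[xa1 xa] Ux; split => //.
  rewrite (le_trans (jet_ext_estimate hq sJ Aa _ wJ (UA x Ux) _ xa1 wk))//.
  - by rewrite mulr_ge0 ?ltW.
  - by rewrite mulrC -ltr_pdivlMr.
  - rewrite mulrA ler_wpM2r ?exprn_ge0//.
    by rewrite [n.+1%:R ^+ k * _]mulrC divfK ?gt_eqF// mulrC divfK// gt_eqF.
have jT := @isjet_taylor R n E k U J a sJ w a Ua.
split => wk q hq e e0.
  have e2 : 0 < e / 2 by rewrite divr_gt0.
  apply: filterS2 (key q _ hq e2 wk) (jT.1 wk q hq _ e2) => x H1 H2 Ux.
  have [{}H1 xa] := H1 Ux; have {}H2 := H2 Ux.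
  rewrite taylor_center in H2; rewrite (jet_extE _ _ Aa).
  rewrite (le_trans (seminorm_dist (taylor k J a w x) _ _ hq))// [leRHS]splitr lerD//.
  rewrite (le_trans H1)// ler_piMr ?(ltW e2)//.
  by rewrite exprn_ile1// ltW.
have e2 : 0 < e / 2 by rewrite divr_gt0.
apply: filterS2 (key q _ hq e2 (ltnW wk)) (jT.2 wk q hq _ e2) => x H1 H2 Ux.
have [{}H1 xa] := H1 Ux; have {}H2 := H2 Ux.
rewrite taylor_center in H2; rewrite (jet_extE _ _ Aa).
have E1 : lincomb (fun i => jet_ext J (i :: w) a) (x - a) =
    lincomb (fun i => taylor k J a (i :: w) a) (x - a).
  by apply: eq_bigr => i _; rewrite jet_extE// taylor_center.
rewrite E1 -addrA -[_ - J w a - _]addrA in H2 *.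
rewrite (le_trans (seminorm_le (taylor k J a w x + (- J w a - lincomb
  (fun i => taylor k J a (i :: w) a) (x - a))) _ hq))// [e]splitr mulrDl lerD//.
have -> : jet_ext J w x + (- J w a - lincomb
    (fun i => taylor k J a (i :: w) a) (x - a)) - (taylor k J a w x + (- J w a - lincomb
    (fun i => taylor k J a (i :: w) a) (x - a))) = jet_ext J w x - taylor k J a w x.
  by lmod R E.
rewrite (le_trans H1)// ler_wpM2l ?(ltW e2)//.
have [m km] : exists m, (k - size w)%N = m.+1.
  by exists (k - size w).-1; rewrite prednK// subn_gt0.
by rewrite km exprS ler_piMr// exprn_ile1// ltW.
Qed.

(** This bound and the next one serve for the continuity of the extension: the
    constants depend neither on the jet nor on the seminorm. *)
Lemma jet_ext_bound_near a (rho : R) : locally_convex_set A -> A a -> 0 < rho ->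
  exists2 rho' : R, 0 < rho' & exists C' : R, forall q J M,
    continuous_seminorm q -> (forall x, symmetric_words (J^~ x)) -> isjet k A J ->
    (forall w z, (size w <= k)%N -> A z -> `|z - a| < rho -> q (J w z) <= M) ->
    forall x w, `|x - a| < rho' -> A x \/ 0 < d x -> (size w <= k)%N ->
      q (jet_ext J w x) <= C' * M.
Proof.
move=> lcA Aa rho0; have [rho1 rho10 seg] := segment_nearP lcA Aa.
pose rho2 := Num.min rho rho1.
have rho20 : 0 < rho2 by rewrite lt_min rho0.
exists (Num.min 1 (rho2 / 6)); first by rewrite lt_min ltr01 divr_gt0.
exists (K2 * (n.+1%:R ^+ k * 2) + n.+1%:R ^+ k) => q J M hq sJ jJ JM x w.
rewrite lt_min => /andP[xa1 xa] Axd wk.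
have Np : 0 < n.+1%:R ^+ k :> R by rewrite exprn_gt0.
have M0 : 0 <= M.
  by apply: le_trans (seminorm_ge0 _ hq) (JM [::] a _ Aa _); rewrite ?subrr ?normr0.
have M20 : 0 <= 2 * M by rewrite mulr_ge0.
have wJ : whitney_near J q a rho2 (n.+1%:R ^+ k * (2 * M)).
  apply: whitney_near_osc => //; first by apply: seg; rewrite ge_min lexx orbT.
  move=> v y z vk Ay Az; rewrite !lt_min => /andP[ya _] /andP[za _].
  rewrite (le_trans (seminormB _ _ hq))// mulrDl !mul1r lerD//; apply: JM => //;
  by rewrite vk.
have K20 : 0 <= K2 by rewrite /K2 addr_ge0// exprn_ge0// mulr_ge0.
rewrite (le_trans (seminorm_le (taylor k J a w x) _ hq))// mulrDl lerD//.
  rewrite (le_trans (jet_ext_estimate hq sJ Aa _ wJ Axd _ xa1 wk))//.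
  - by rewrite mulr_ge0// ltW.
  - by rewrite mulrC -ltr_pdivlMr.
  - rewrite -!mulrA ler_wpM2l// ler_wpM2l ?(ltW Np)// ler_wpM2l// ler_piMr//.
    by rewrite exprn_ile1// ltW.
have h := taylor_bound hq sJ (lexx 1) (ltW xa1) (M := M) _ wk.
rewrite (le_trans (h _))//.
  by move=> v vk; apply: JM => //; rewrite subrr normr0.
by rewrite expr1n mulr1 ler_wpM2r// ler_weXn2l ?leq_subr.
Qed.

Lemma jet_ext_bound_off x0 : 0 < d x0 ->
  exists2 rho' : R, 0 < rho' & exists C' : R, forall q J M,
    continuous_seminorm q -> (forall x, symmetric_words (J^~ x)) -> 0 <= M ->
    (forall w i, (size w <= k)%N -> i \in r x0 -> q (J w (p i)) <= M) ->
    forall x w, `|x - x0| < rho' -> (size w <= k)%N ->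
      q (jet_ext J w x) <= C' * M.
Proof.
move=> dx0.
have /near_rowP[rho1 rho10 H1] : \forall x \near x0, 0 < d x -> forall J w, (size w <= k)%N ->
    glue J w x = \sum_(i <- r x0) leibniz (phi i) (taylor k J (p i)) w x.
  have [ur zr] := phi_lf dx0; apply: filterS zr => y zr dy J w wk.
  have [uy zy] := phi_lf dy; apply: sum_support => // i ir; apply: leibniz0 => u v uv.
    by rewrite (nbhs_singleton zy) ?scale0r// (leq_trans _ wk)// -uv leq_addr.
  by rewrite zr ?scale0r// (leq_trans _ wk)// -uv leq_addr.
exists (Num.min rho1 (d x0 / 2)); first by rewrite lt_min rho10 divr_gt0.
pose b : R := 8 * d x0 + 1; pose c := 2 / d x0 + 1.
have c1 : 1 <= c by rewrite lerDr divr_ge0// ltW.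
have b1 : 1 <= b by rewrite lerDr mulr_ge0// ltW.
pose B := 2 ^+ k * (C * c ^+ k * (n.+1%:R ^+ k * b ^+ k)).
exists ((size (r x0))%:R * B) => q J M hq sJ M0 JM x w.
rewrite lt_min => /andP[xx0 xd] wk.
have h1 := dist_set_lipschitz A0 x0 x; have h2 := dist_set_lipschitz A0 x x0.
rewrite distrC in h1.
have dx : d x0 / 2 < d x by lra.
have dxp : 0 < d x by rewrite (lt_trans _ dx)// divr_gt0.
have cd : (d x)^-1 <= c.
  rewrite (@le_trans _ _ (d x0 / 2)^-1)//.
    by rewrite lef_pV2 ?posrE ?divr_gt0// ltW.
  by rewrite invf_div lerDl.
rewrite jet_ext_glue// H1//.
rewrite (le_trans (seminorm_sum _ _ _ hq))// big_seq.
rewrite (@le_trans _ _ (\sum_(i <- r x0 | i \in r x0) B * M))//; last first.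
  by rewrite -big_seq big_const_seq count_predT iter_addr addr0 -[leLHS]mulr_natl mulrA.
apply: ler_sum => i ir.
have H u v : (size u + size v)%N = size w ->
    `|phi i u x| * q (taylor k J (p i) v x) <=
    C * c ^+ k * (n.+1%:R ^+ k * b ^+ k) * M.
  move=> uvw.
  have uk : (size u <= k)%N by rewrite (leq_trans _ wk)// -uvw leq_addr.
  have vk : (size v <= k)%N by rewrite (leq_trans _ wk)// -uvw leq_addl.
  have c0 : 0 <= c by lra.
  have b0 : 0 <= b by lra.
  have [->|[xp phiu]] := phi_bound i dxp uk.
    by rewrite normr0 mul0r !mulr_ge0// exprn_ge0.
  have h : q (taylor k J (p i) v x) <= n.+1%:R ^+ (k - size v) * (M * b ^+ (k - size v)).
    by apply: taylor_bound => //; [rewrite /b; lra|move=> w' wk'; exact: JM].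
  rewrite -mulrA; apply: ler_pM => //; first exact: seminorm_ge0.
    rewrite (le_trans phiu)// ler_wpM2l// -exprVn.
    rewrite (@le_trans _ _ (c ^+ size u))//.
      by apply: lerXn2r; rewrite ?nnegrE// invr_ge0 ltW.
    by rewrite ler_weXn2l.
  rewrite (le_trans h)// -mulrA; apply: ler_pM => //.
  - by rewrite mulr_ge0// exprn_ge0.
  - by rewrite ler_weXn2l ?leq_subr.
  - by rewrite mulrC ler_wpM2r// ler_weXn2l ?leq_subr.
rewrite (le_trans (leibniz_le hq H))// /B -[leRHS]mulrA ler_wpM2r//.
  by rewrite !mulr_ge0// exprn_ge0//; lra.
by rewrite ler_weXn2l// ler1n.
Qed.

End JetExtension.

(** * Jets of C^k functions *)

Section JetsOfCkFunctions.
Context {R : realType} {n : nat} {E : tvsType R} (hE : hausdorff_space E).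
Implicit Types (A U W : set 'rV[R]_n) (a : 'I_n -> nat) (x y z : 'rV[R]_n) (w u v : seq 'I_n)
  (J K : seq 'I_n -> 'rV[R]_n -> E) (q : E -> R) (k l : nat).

Lemma valL0_off A (h : A -> E) x : ~ A x -> 'valL_ 0 h x = 0.
Proof.
move=> Ax; rewrite /= oinv_set_val insubN//; apply/negP => xA; apply: Ax.
exact: set_mem xA.
Qed.

Lemma valL0_in A (h : A -> E) x (Ax : A x) : 'valL_ 0 h x = h (SigSub (mem_set Ax)).
Proof. exact: (valL0E h (SigSub (mem_set Ax))). Qed.

Lemma set_valP A (x : A) : A (set_val x).
Proof. exact: set_mem (valP x). Qed.

Lemma sub_nearP A (x : A) (P : A -> Prop) (Q : 'rV[R]_n -> Prop) :
  (forall y : A, P y <-> Q (set_val y)) ->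
  (\forall y \near x, P y) <-> (\forall z \near set_val x, A z -> Q z).
Proof.
move=> PQ; split.
  move=> [_ [[V oV <-] /= Vx VP]]; have : nbhs (set_val x) V by exact: open_nbhs_nbhs.
  apply: filterS => z Vz Az; have := VP (SigSub (mem_set Az)) Vz.
  by move/PQ.
move=> H; have : nbhs (set_val x) [set z | A z -> Q z] := H.
rewrite nbhsE => -[V [oV Vx] VQ]; exists (set_val @^-1` V); split => //=.
  by exists V.
by move=> y Vy; apply/PQ; apply: VQ => //; exact: set_valP.
Qed.

Lemma sub_continuousP A (h : A -> E) :
  continuous h <-> forall x, A x -> cont_at A ('valL_ 0 h) x.
Proof.
split => [ch x Ax q hq e e0|ch x].
  pose x' : A := SigSub (mem_set Ax).
  have /cvg_seminormP/(_ q hq e e0) H := ch x'.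
  have PQ (y : A) : q (h y - h x') <= e <->
      q ('valL_ 0 h (set_val y) - 'valL_ 0 h x) <= e.
    by rewrite (valL0E h y) (valL0_in _ Ax).
  exact: (sub_nearP x' PQ).1 H.
apply: (@cvg_seminormP _ _ _ (nbhs x) _ h (h x)).2 => q hq e e0.
have PQ (y : A) : q (h y - h x) <= e <->
    q ('valL_ 0 h (set_val y) - 'valL_ 0 h (set_val x)) <= e.
  by rewrite (valL0E h y) (valL0E h x).
exact: (sub_nearP x PQ).2 (ch _ (set_valP x) q hq e e0).
Qed.

Lemma restrict_continuousP A (g : 'rV[R]_n -> E) :
  (forall x, A x -> cont_at A g x) -> continuous (fun x : A => g (set_val x)).
Proof.
move=> cg; apply/sub_continuousP => x Ax.
apply: cont_at_local (cg x Ax); last by rewrite (valL0_in _ Ax).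
by apply: near_all => y Ay; split => //; rewrite (valL0_in _ Ay).
Qed.

Lemma dense_interior_unique A (h1 h2 : A -> E) : has_dense_interior A ->
  continuous h1 -> continuous h2 ->
  (forall x : A, A° (set_val x) -> h1 x = h2 x) -> h1 = h2.
Proof.
move=> diA c1 c2 h12; apply/funext => x; apply/eqP; rewrite -subr_eq0; apply/eqP.
apply: seminorm_eq0 hE _ => q hq e e0; have e2 : 0 < e / 2 by rewrite divr_gt0.
have H1 := (sub_continuousP h1).1 c1 _ (set_valP x) q hq _ e2.
have H2 := (sub_continuousP h2).1 c2 _ (set_valP x) q hq _ e2.
have [y [Ay [y1 y2]]] := diA _ (set_valP x) _ (filterI H1 H2).
have Ay' : A y by exact: interior_subset Ay.
have {}y1 := y1 Ay'; have {}y2 := y2 Ay'.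
rewrite (valL0E h1 x) (valL0_in _ Ay') in y1; rewrite (valL0E h2 x) (valL0_in _ Ay') in y2.
rewrite -h12// in y2; rewrite (le_trans (seminorm_dist (h1 (SigSub (mem_set Ay'))) _ _ hq))//.
by rewrite [e]splitr seminorm_distC// lerD.
Qed.

(** Adjacent letters commute by Schwarz; moving one letter at a time to the front
    gives all permutations. *)
Lemma isjet_symmetric k W J : open W -> isjet k W J ->
  forall w w', perm_eq w w' -> (size w <= k)%N -> forall x, W x -> J w x = J w' x.
Proof.
move=> oW jJ.
have cong w w' i : (size w < k)%N -> (size w' < k)%N -> (forall x, W x -> J w x = J w' x) ->
    forall x, W x -> J (i :: w) x = J (i :: w') x.
  move=> wk wk' ww x Wx; have xW : nbhs x W by exact: open_nbhs_nbhs.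
  apply: (@diff_at_unique _ _ _ W (J w) (fun i => J (i :: w) x)
    (fun i => J (i :: w') x) x hE xW ((jJ w x Wx).2 wk)).
  apply: diff_at_local ((jJ w' x Wx).2 wk'); last exact: ww.
  by apply: near_all => y Wy; split => //; exact: ww.
have swap i j w x : (size w + 2 <= k)%N -> W x -> J (i :: j :: w) x = J (j :: i :: w) x.
  move=> wk Wx; have xW : nbhs x W by exact: open_nbhs_nbhs.
  apply: (@schwarz _ _ _ W (J w) (fun i => J (i :: w))
    (fun m p => J (p :: m :: w) x) x j i hE xW).
    by move=> z Wz; apply: (jJ w z Wz).2; rewrite (leq_trans _ wk)// addn2 ltnS leqW.
  by move=> m; apply: (jJ (m :: w) x Wx).2; rewrite (leq_trans _ wk)// addn2.
have bring i u v : (size u + size v < k)%N -> forall x, W x ->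
    J (u ++ i :: v) x = J (i :: u ++ v) x.
  elim: u => [//|j u IH] /= uk x Wx.
  rewrite -swap//; last by rewrite size_cat addn2.
  apply: cong => //.
  - by rewrite size_cat /= addnS.
  - by rewrite /= size_cat.
  - by apply: IH; rewrite (leq_trans _ uk)// ltnW// !addSn.
elim=> [|i w IH] w' ww wk x Wx.
  by move: ww; rewrite perm_sym => /perm_nilP ->.
have iw' : i \in w' by rewrite -(perm_mem ww) mem_head.
move: ww wk; case/splitPr: iw' => u v ww wk.
have ww' : perm_eq w (u ++ v).
  by rewrite -(perm_cons i); apply: (perm_trans ww); exact: (permEl (perm_catCA u [:: i] v)).
have sw := perm_size ww'; rewrite size_cat in sw.
rewrite bring//; last by rewrite -sw.
by apply: cong => //; [rewrite size_cat -sw|exact: IH ww' (ltnW wk)].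
Qed.

(** By local convexity and density of the interior, differentiability at a
    boundary point follows from the mean value inequality on segments pushed
    into the interior. *)
Lemma isjet_closure k A J : locally_convex_set A -> has_dense_interior A ->
  (forall w x, (size w <= k)%N -> A x -> cont_at A (J w) x) ->
  isjet k A° J -> isjet k A J.
Proof.
move=> lcA diA cJ jJ w x Ax; split => wk; first exact: cJ.
move=> q hq e e0.
have e1 : 0 < e / (n%:R + 1) by rewrite divr_gt0// ltr_wpDl.
have [D [cD DA nD']] := lcA x Ax.
have nD : \forall z \near x, A z -> D z by exact: nD'.
have nH : \forall z \near x, forall i, A z -> q (J (i :: w) z - J (i :: w) x) <= e / (n%:R + 1).
  exact: (@filter_forall _ _ (fun i z => A z -> q (J (i :: w) z - J (i :: w) x) <= _)
    (nbhs x) _ (fun i => cJ (i :: w) x wk Ax q hq _ e1)).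
have /near_rowP[r r0 rP] : \forall z \near x, A z ->
    D z /\ forall i, q (J (i :: w) z - J (i :: w) x) <= e / (n%:R + 1).
  by apply: filterS2 nD nH => z h1 h2 Az; split; [exact: h1|move=> i; exact: h2].
apply/near_rowP; exists r => // x' xx' Ax'.
pose c i := J (i :: w) x; pose K z := (-1) *: lincomb c z + J w z.
have -> : J w x' - J w x - lincomb c (x' - x) = K x' - K x.
  by rewrite lincombB /K; lmod R E.
have cK z : A z -> cont_at A K z.
  move=> Az; apply: cont_at_P; last exact: cJ (ltnW wk) Az.
  exact: diff_cont_at (diff_at_lincomb A c z).
have [c0 [Ac0 c0x]] : exists c0, A° c0 /\ `|c0 - x| < r.
  have : nbhs x [set z | `|z - x| < r] by apply/near_rowP; exists r.
  by move/(diA x Ax) => [c0 [? ?]]; exists c0.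
have [s s0 sP] : exists2 s : R, 0 < s & forall z, `|z - c0| < s -> A z /\ `|z - x| < r.
  have /near_rowP[s1 s10 sA] : nbhs c0 A := Ac0.
  exists (Num.min s1 (r - `|c0 - x|)); first by rewrite lt_min s10 subr_gt0.
  move=> z; rewrite lt_min => /andP[/sA Az zc]; split => //.
  have -> : z - x = (z - c0) + (c0 - x) by lmod R 'rV[R]_n.
  by rewrite (le_lt_trans (ler_normD _ _))//; lra.
pose pt (t : R) z := z + t *: (c0 - z).
have Dx : D x by apply: (rP x _ Ax).1; rewrite subrr normr0.
have Dx' : D x' by apply: (rP x' _ Ax').1.
have Dsc z : `|z - c0| < s -> D z.
  by move=> /sP[Az zx]; exact: (rP z zx Az).1.
have ball_conv (t : R) (u v : 'rV[R]_n) : 0 <= t <= 1 -> `|u - x| < r -> `|v - x| < r ->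
    `|t *: u + (1 - t) *: v - x| < r.
  move=> /andP[t0 t1] ur vr.
  have -> : t *: u + (1 - t) *: v - x = t *: (u - x) + (1 - t) *: (v - x) by lmod R 'rV[R]_n.
  rewrite (le_lt_trans (ler_normD _ _))// !normrZ (ger0_norm t0) ger0_norm ?subr_ge0//.
  by have [->|tn0] := eqVneq t 0; [rewrite mul0r add0r subr0 mul1r|nra].
have ptA (t : R) (u : 'rV[R]_n) : 0 < t -> t <= 1 -> D u -> `|u - x| < r ->
    A° (pt t u) /\ `|pt t u - x| < r.
  move=> t0 t1 Du ur; split.
    apply/near_rowP; exists (t * s); first by rewrite mulr_gt0.
    move=> v vp; apply: DA.
    have -> : v = t *: (c0 + t^-1 *: (v - pt t u)) + (1 - t) *: u.
      rewrite scalerDr scalerA divff ?gt_eqF// /pt; lmod R 'rV[R]_n.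
    apply: convex_setP => //; last by rewrite ltW.
    apply: Dsc; rewrite addrAC subrr add0r normrZ gtr0_norm ?invr_gt0//.
    by rewrite mulrC ltr_pdivrMr// mulrC.
  have -> : pt t u = t *: c0 + (1 - t) *: u by rewrite /pt; lmod R 'rV[R]_n.
  by apply: ball_conv => //; rewrite (ltW t0).
apply/ler_addgt0Pr => eta eta0; have eta2 : 0 < eta / 2 by rewrite divr_gt0.
have pt_small z : A z -> exists2 t1 : R, 0 < t1 & forall t, 0 < t -> t < t1 ->
    A (pt t z) -> q (K (pt t z) - K z) <= eta / 2.
  move=> Az; have /near_rowP[d d0 dP] := cK z Az q hq _ eta2.
  have nc : 0 < `|c0 - z| + 1 by rewrite ltr_wpDl.
  exists (d / (`|c0 - z| + 1)); first by rewrite divr_gt0.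
  move=> t t0; rewrite ltr_pdivlMr// => td Apt; apply: dP => //.
  rewrite /pt addrAC subrr add0r normrZ (gtr0_norm t0); nra.
have [t1 t10 t1P] := pt_small x Ax; have [t2 t20 t2P] := pt_small x' Ax'.
pose t := Num.min 1 (Num.min t1 t2) / 2.
have m0 : 0 < Num.min 1 (Num.min t1 t2) by rewrite !lt_min ltr01 t10.
have t0 : 0 < t by rewrite divr_gt0.
have [tl1 [tl2 tl3]] : t <= 1 /\ t < t1 /\ t < t2.
  have : t < Num.min 1 (Num.min t1 t2) by rewrite ltr_pdivrMr// ltr_pMr// ltr1n.
  by rewrite !lt_min => /andP[/ltW ? /andP[? ?]].
have xr : `|x - x| < r by rewrite subrr normr0.
have [Apx _] := ptA t x t0 tl1 Dx xr; have [Apx' _] := ptA t x' t0 tl1 Dx' xx'.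
have h1 := t1P t t0 tl2 (interior_subset Apx).
have h2 := t2P t t0 tl3 (interior_subset Apx').
have seg z : segment (pt t x) (pt t x') z -> A° z /\ `|z - x| < r.
  move=> [b /andP[b0 b1] <-].
  have -> : pt t x + b *: (pt t x' - pt t x) = pt t (b *: x' + (1 - b) *: x).
    by rewrite /pt; lmod R 'rV[R]_n.
  apply: ptA => //; first exact: convex_setP.
  by apply: ball_conv => //; rewrite b0.
have h3 : q (K (pt t x') - K (pt t x)) <= e * `|x' - x|.
  apply: (@mean_value _ _ _ A° q K (fun z i => (-1) *: c i + J (i :: w) z)) => //.
  - by move=> z /seg[].
  - move=> z /seg[Az _]; apply: diff_at_P; first exact: diff_at_lincomb.
    exact: (jJ w z Az).2.
  - move=> z /seg[Az zr].
    have b i : q ((-1) *: c i + J (i :: w) z) <= e / (n%:R + 1).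
      rewrite scaleN1r addrC; apply: (rP z zr _).2; exact: interior_subset.
    rewrite (le_trans (lincomb_le _ hq b))//.
    have -> : pt t x' - pt t x = (1 - t) *: (x' - x) by rewrite /pt; lmod R 'rV[R]_n.
    rewrite normrZ ger0_norm ?subr_ge0//.
    have en : n%:R * (e / (n%:R + 1)) <= e.
      by rewrite mulrCA ler_piMr ?(ltW e0)// ler_pdivrMr ?ltr_wpDl// mul1r lerDl.
    have := normr_ge0 (x' - x); set X := `|x' - x| => X0.
    have : (1 - t) * X <= X by rewrite ler_piMl//; lra.
    have : 0 <= n%:R * (e / (n%:R + 1)) by rewrite mulr_ge0// ltW.
    have : 0 <= (1 - t) * X by rewrite mulr_ge0// subr_ge0.
    rewrite mulrAC; nra.
have := seminorm_dist (K (pt t x')) (K x') (K x) hq.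
have := seminorm_dist (K (pt t x)) (K (pt t x')) (K x) hq.
rewrite [q (K x' - K (pt t x'))]seminorm_distC//; lra.
Qed.

Definition multi_word (a : 'I_n -> nat) : seq 'I_n :=
  flatten [seq nseq (a i) i | i <- enum 'I_n].

Definition directions w : seq 'rV[R]_n := [seq delta_mx 0 i | i <- w].

Lemma multi_directionsE a : multi_directions a = directions (multi_word a).
Proof.
rewrite /directions map_flatten -map_comp; congr flatten.
by apply: eq_map => i /=; rewrite map_nseq.
Qed.

Lemma size_multi_word a : size (multi_word a) = (\sum_i a i)%N.
Proof.
rewrite size_flatten /shape -map_comp sumnE big_map big_enum /=.
by apply: eq_bigr => i _; rewrite size_nseq.
Qed.

Lemma count_multi_word a i : count_mem i (multi_word a) = a i.
Proof.
rewrite count_flatten -map_comp sumnE big_map big_enum /=.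
rewrite (bigD1 i)//= count_nseq /= eqxx mul1n big1 ?addn0// => j ji.
by rewrite count_nseq /= (negbTE ji).
Qed.

Lemma perm_multi_word w : perm_eq (multi_word (fun i => count_mem i w)) w.
Proof. by apply/allP => i _ /=; rewrite count_multi_word. Qed.

Lemma sum_count w : (\sum_i count_mem i w)%N = size w.
Proof. by rewrite -(perm_size (perm_multi_word w)) size_multi_word. Qed.

Lemma rows_of_seq (ys : seq 'rV[R]_n) :
  [seq row i (\matrix_(i < size ys) nth 0 ys i) | i <- enum 'I_(size ys)] = ys.
Proof.
rewrite -[RHS](mkseq_nth 0) /mkseq -val_enum_ord -map_comp.
by apply: eq_map => i /=; rewrite rowK.
Qed.

Lemma iter_derivable_last W (g : 'rV[R]_n -> E) ys y :
  iter_derivable W g (rcons ys y) ->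
  forall x, W x -> exists d, is_dir_deriv (iter_deriv g ys) x y d.
Proof. by elim: ys g => [|y' ys IH] g /= [dg Ig] //; exact: IH Ig. Qed.

Lemma Ck_iter_derivable k A (f : A -> E) ys : is_Ck k f -> (size ys <= k)%N ->
  iter_derivable A° ('valL_ 0 f) ys.
Proof.
move=> [_ Cf]; case: ys => [//|y ys] yk.
have [+ _ _] := Cf (size (y :: ys)) yk.
by move=> /(_ (\matrix_(i < size (y :: ys)) nth 0 (y :: ys) i)); rewrite rows_of_seq.
Qed.

Lemma Ck_deriv_ext k A (f : A -> E) ys : is_Ck k f -> (size ys <= k)%N ->
  exists h : A -> E, continuous h /\
    forall x : A, A° (set_val x) -> h x = iter_deriv ('valL_ 0 f) ys (set_val x).
Proof.
move=> [cf Cf]; case: ys => [|y ys] yk.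
  by exists f; split => // x _; exact: esym (valL0E f x).
have [_ _ [F [cF FE]]] := Cf (size (y :: ys)) yk.
set l := size (y :: ys) in F cF FE.
pose Y : 'M[R]_(l, n) := \matrix_(i < l) nth 0 (y :: ys) i.
exists (fun x : A => F (x, Y)); split.
  move=> x; apply: (@continuous_comp _ _ _ (fun x : A => (x, Y)) F); last exact: cF.
  apply: (@cvg_pair _ _ _ (nbhs x) (nbhs x) (nbhs Y) _ _ _ id (fun=> Y)).
    exact: cvg_id.
  exact: cvg_cst.
by move=> x Ax; rewrite FE// /dk rows_of_seq.
Qed.

(** The iterated partial derivatives of a C^k function form a jet on the
    interior, since continuous partials give differentiability. *)
Lemma Ck_isjet_interior k A (f : A -> E) : is_Ck k f ->
  isjet k A° (fun w => iter_deriv ('valL_ 0 f) (directions (rev w))).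
Proof.
move=> Cf.
have C w x : A° x -> (size w <= k)%N ->
    cont_at A° (iter_deriv ('valL_ 0 f) (directions (rev w))) x.
  move=> Ax wk; have yk : (size (directions (rev w)) <= k)%N.
    by rewrite size_map size_rev.
  have [h [ch hE']] := Ck_deriv_ext Cf yk.
  have hE2 z : A° z -> iter_deriv ('valL_ 0 f) (directions (rev w)) z = 'valL_ 0 h z.
    by move=> Az; rewrite (valL0_in h (interior_subset Az)) hE'.
  apply: cont_at_local ((sub_continuousP h).1 ch x (interior_subset Ax)); last exact: hE2.
  by apply: near_all => y Ay; split; [exact: interior_subset|exact: hE2].
move=> w x Ax; split => wk; first exact: C.
apply: (@partials_diff_at _ _ _ A° _ (fun i => iter_deriv ('valL_ 0 f) (directions (rev (i :: w))))).
- by apply: open_nbhs_nbhs; split => //; exact: open_interior.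
- move=> z i Az; have dk : (size (directions (rev (i :: w))) <= k)%N.
    by rewrite size_map size_rev.
  have := Ck_iter_derivable Cf dk.
  rewrite /directions rev_cons map_rcons => /iter_derivable_last/(_ z Az)[d hd].
  by rewrite /iter_deriv foldl_rcons (dir_derivE hE hd).
- by move=> i; exact: C.
Qed.

Lemma partialP k A (f : A -> E) a : is_Ck k f -> (\sum_i a i <= k)%N ->
  continuous (partial f a) /\ forall x : A, A° (set_val x) ->
    partial f a x = iter_deriv ('valL_ 0 f) (multi_directions a) (set_val x).
Proof.
move=> Cf ak; have mk : (size (multi_directions a : seq 'rV[R]_n) <= k)%N.
  by rewrite multi_directionsE size_map size_multi_word.
have [h hP] := Ck_deriv_ext Cf mk.
by rewrite /partial; case: xgetP => [h' _ //|/(_ h)].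
Qed.

Lemma partial_unique k A (f h : A -> E) a : has_dense_interior A ->
  is_Ck k f -> (\sum_i a i <= k)%N -> continuous h ->
  (forall x : A, A° (set_val x) ->
    h x = iter_deriv ('valL_ 0 f) (multi_directions a) (set_val x)) ->
  partial f a = h.
Proof.
move=> diA Cf ak ch hP; have [c cP] := partialP Cf ak.
by apply: dense_interior_unique => // x Ax; rewrite cP// hP.
Qed.

Lemma partial0 k A (f : A -> E) a : has_dense_interior A -> is_Ck k f ->
  (forall i, a i = 0%N) -> partial f a = f.
Proof.
move=> diA Cf a0; have s0 : (\sum_i a i)%N = 0%N by rewrite big1.
apply: (partial_unique diA Cf); [by rewrite s0|exact: Cf.1|move=> x _].
have -> : multi_directions a = [::] :> seq 'rV[R]_n.
  by apply/eqP; rewrite -size_eq0 multi_directionsE size_map size_multi_word s0.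
by exact: esym (valL0E f x).
Qed.

Lemma partial_lincomb k A (b : R) (f g : A -> E) a : has_dense_interior A ->
  is_Ck k f -> is_Ck k g -> (\sum_i a i <= k)%N ->
  partial (b *: f + g) a = b *: partial f a + partial g a.
Proof.
move=> diA Cf Cg ak; have Cfg := is_Ck_lincomb hE b Cf Cg.
have [cf fP] := partialP Cf ak; have [cg gP] := partialP Cg ak.
apply: (partial_unique diA Cfg ak); first exact: continuous_lincomb.
have mk : (size (multi_directions a : seq 'rV[R]_n) <= k)%N.
  by rewrite multi_directionsE size_map size_multi_word.
move=> x Ax; have vE z : A° z ->
    'valL_ 0 (b *: f + g) z = b *: 'valL_ 0 f z + 'valL_ 0 g z.
  by move=> /interior_subset Az; rewrite !(valL0_in _ Az).
have [_ ->//] := iter_deriv_lincomb hE (@open_interior _ A) (@subset_refl _ _)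
  vE (Ck_iter_derivable Cf mk) (Ck_iter_derivable Cg mk).
by rewrite -fP// -gP.
Qed.

(** A word only enters through the multiplicities of its letters, as in [partial].
    Values off [A] and beyond order [k] are 0. *)
Definition Ck_jet k A (f : A -> E) : seq 'I_n -> 'rV[R]_n -> E := fun w =>
  if (size w <= k)%N then 'valL_ 0 (partial f (fun i => count_mem i w)) else fun=> 0.

Lemma Ck_jet_symmetric k A (f : A -> E) x : symmetric_words ((Ck_jet k f)^~ x).
Proof.
move=> u v uv; rewrite /Ck_jet (perm_size uv).
have -> // : (fun i => count_mem i u) = (fun i => count_mem i v).
by apply/funext => i; exact: (permP uv).
Qed.

Lemma Ck_jet_nil k A (f : A -> E) : has_dense_interior A -> is_Ck k f ->
  Ck_jet k f [::] = 'valL_ 0 f.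
Proof. by move=> diA Cf; rewrite /Ck_jet (partial0 diA Cf). Qed.

Lemma Ck_jet_lincomb k A (b : R) (f g : A -> E) w x : has_dense_interior A ->
  is_Ck k f -> is_Ck k g ->
  Ck_jet k (b *: f + g) w x = b *: Ck_jet k f w x + Ck_jet k g w x.
Proof.
move=> diA Cf Cg; rewrite /Ck_jet; case: ifP => wk; last by rewrite scaler0 addr0.
rewrite (partial_lincomb _ diA Cf Cg) ?sum_count//.
have [Ax|Ax] := pselect (A x); first by rewrite !(valL0_in _ Ax).
by rewrite !(valL0_off _ Ax) scaler0 addr0.
Qed.

(** On the interior, [partial f] is an iterated derivative in the order fixed by
    [multi_word], and symmetry gives all other orders; [isjet_closure] reaches the
    boundary. *)
Lemma isjet_Ck_jet k A (f : A -> E) : locally_convex_set A ->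
  has_dense_interior A -> is_Ck k f -> isjet k A (Ck_jet k f).
Proof.
move=> lcA diA Cf; apply: isjet_closure => //.
  move=> w x wk Ax; rewrite /Ck_jet wk; apply: (sub_continuousP _).1 => //.
  by have [] := @partialP k A f (fun i => count_mem i w) Cf; rewrite ?sum_count.
pose H w := iter_deriv ('valL_ 0 f) (directions (rev w)).
have jH : isjet k A° H := Ck_isjet_interior Cf.
apply: isjet_local => x Ax; exists A°, H; split => //.
apply: near_all => y Ay; split => // w wk.
have ck : (\sum_i count_mem i w <= k)%N by rewrite sum_count.
have [_ E'] := partialP Cf ck.
rewrite /Ck_jet wk (valL0_in _ (interior_subset Ay)) E'//=.
rewrite multi_directionsE -[multi_word _]revK.
have pw : perm_eq (rev (multi_word (fun i => count_mem i w))) w.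
  by rewrite perm_rev; exact: perm_multi_word.
apply: (isjet_symmetric (@open_interior _ A) jH pw _ Ay).
by rewrite (perm_size pw).
Qed.

End JetsOfCkFunctions.

(** * C^k functions of jets *)

Section CkFunctionsOfJets.
Context {R : realType} {n : nat} {E : tvsType R} (hE : hausdorff_space E).
Implicit Types (U W : set 'rV[R]_n) (x y z : 'rV[R]_n) (w u v : seq 'I_n)
  (J K : seq 'I_n -> 'rV[R]_n -> E) (c : seq 'I_n -> E) (q : E -> R) (k l : nat).

(** [dir_word ys c w] is the derivative along the directions [ys] of the
    component [w] of a jet with components [c] at a point. *)
Definition dir_word (ys : seq 'rV[R]_n) c : seq 'I_n -> E :=
  foldl (fun c y w => lincomb (fun i => c (rcons w i)) y) c ys.

Lemma dir_word_directions v c w : dir_word (directions v) c w = c (w ++ rev v).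
Proof.
elim: v c w => [|i v IH] c w; first by rewrite cats0.
rewrite [LHS]IH lincomb_delta rev_cons; congr c.
by rewrite -!cats1 catA.
Qed.

(** The direction [y] comes before those of [w], whence the place of [i] at the end
    of the word. *)
Lemma isjet_dir k W J y : isjet k.+1 W J ->
  isjet k W (fun w z => lincomb (fun i => J (rcons w i) z) y).
Proof.
move=> jJ; apply: (@isjet_sum _ _ _ k W _ (index_enum 'I_n)
  (fun i w z => y 0 i *: J (rcons w i) z)) => i _.
have j0 : isjet k W (fun w z => 0 : E) by exact: isjet_cst0.
have j1 : isjet k W (fun w => J (rcons w i)).
  move=> w x Wx; have [c d] := jJ (rcons w i) x Wx.
  rewrite size_rcons in c d; split => wk; [exact: c|exact: d].
have := isjet_P (y 0 i) j1 j0.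
by congr isjet; apply/funext => w; apply/funext => z; rewrite addr0.
Qed.

Lemma jet_iter_deriv k W J ys (g : 'rV[R]_n -> E) : open W -> isjet k W J ->
  (size ys <= k)%N -> (forall z, W z -> g z = J [::] z) ->
  iter_derivable W g ys /\
  forall z, W z -> iter_deriv g ys z = dir_word ys (J^~ z) [::].
Proof.
move=> oW; elim: ys k J g => [|y ys IH] k J g jJ yk gE; first by split.
case: k jJ yk => [//|k] jJ yk.
have D z : W z -> is_dir_deriv g z y (lincomb (fun i => J [:: i] z) y).
  move=> Wz; have Wn : nbhs z W by exact: open_nbhs_nbhs.
  apply: (diff_at_dir_deriv Wn).
  apply: diff_at_local ((jJ [::] z Wz).2 isT); last exact: gE.
  by apply: near_all => x Wx; split => //; exact: gE.
have gE' z : W z -> dir_deriv g y z = lincomb (fun i => J (rcons [::] i) z) y.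
  by move=> Wz; rewrite (dir_derivE hE (D z Wz)).
have [I1 I2] := IH k _ _ (isjet_dir y jJ) yk gE'.
split; last exact: I2.
by split => // z Wz; exists (lincomb (fun i => J [:: i] z) y); exact: D.
Qed.

Lemma cvg_sum_scale (T : Type) (F : set_system T) {FF : Filter F} (I : Type)
    (r : seq I) (s : I -> T -> R) (s0 : I -> R) (u : I -> T -> E) (u0 : I -> E) :
  (forall i, s i @ F --> s0 i) -> (forall i, u i @ F --> u0 i) ->
  (fun t => \sum_(i <- r) s i t *: u i t) @ F --> \sum_(i <- r) s0 i *: u0 i.
Proof.
move=> hs hu; elim: r => [|i r IH].
  rewrite big_nil; under eq_fun do rewrite big_nil; exact: cvg_cst.
rewrite big_cons; under eq_fun do rewrite big_cons.
apply: (@continuous2_cvg _ _ _ _ _ FF _ _ (fun x y : E => x + y)) => //.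
  exact: (@add_continuous E (_, _)).
apply: (@continuous2_cvg _ _ _ _ _ FF (s i) (u i) (fun (x : R^o) (y : E) => x *: y)).
- exact: (@scale_continuous R E (s0 i, u0 i)).
- exact: hs.
- exact: hu.
Qed.

Lemma cvg_dir_word (T : Type) (F : set_system T) {FF : Filter F} k l (r : seq 'I_l)
    (Y : T -> 'M[R]_(l, n)) (Y0 : 'M[R]_(l, n)) (c : T -> seq 'I_n -> E) c0 w :
  (forall i j, (fun t => Y t i j) @ F --> Y0 i j) ->
  (forall w, (size w <= k)%N -> (fun t => c t w) @ F --> c0 w) ->
  (size r + size w <= k)%N ->
  (fun t => dir_word [seq row i (Y t) | i <- r] (c t) w) @ F -->
  dir_word [seq row i Y0 | i <- r] c0 w.
Proof.
move=> hY; elim: r k c c0 w => [|i r IH] k c c0 w hc /= wk; first exact: hc.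
case: k hc wk => [//|k] hc wk.
apply: (IH k (fun t w => lincomb (fun i => c t (rcons w i)) (row i (Y t)))
  (fun w => lincomb (fun i => c0 (rcons w i)) (row i Y0))) => // {w wk} w wk.
apply: (cvg_sum_scale (s := fun j t => row i (Y t) 0 j)) => j.
  by rewrite mxE; under eq_fun do rewrite mxE; exact: hY.
by apply: hc; rewrite size_rcons.
Qed.

Section OneJet.
Variables (k : nat) (U : set 'rV[R]_n) (J : seq 'I_n -> 'rV[R]_n -> E).
Hypotheses (diU : has_dense_interior U) (jJ : isjet k U J).

Let f : U -> E := fun x : U => J [::] (set_val x).

Lemma jet_fun_continuous w : (size w <= k)%N ->
  continuous (fun x : U => J w (set_val x)).
Proof. by move=> wk; apply: restrict_continuousP => x Ux; exact: (jJ w Ux).1. Qed.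

Lemma jet_fun_iter_deriv ys : (size ys <= k)%N ->
  iter_derivable U° ('valL_ 0 f) ys /\
  forall z, U° z -> iter_deriv ('valL_ 0 f) ys z = dir_word ys (J^~ z) [::].
Proof.
move=> yk; apply: (jet_iter_deriv (@open_interior _ U) (isjetW (@interior_subset _ U) jJ) yk).
by move=> z Uz; rewrite (valL0_in _ (interior_subset Uz)).
Qed.

(** The components of a jet are the iterated partial derivatives of its first
    component, which is therefore a C^k function. *)
Lemma jet_is_Ck : is_Ck k f.
Proof.
split; first exact: (jet_fun_continuous (w := [::])).
move=> l /andP[_ lk].
have rk (Y : 'M[R]_(l, n)) : (size [seq row i Y | i <- enum 'I_l] <= k)%N.
  by rewrite size_map size_enum_ord.
have sk : (size (enum 'I_l) + size ([::] : seq 'I_n) <= k)%N.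
  by rewrite size_enum_ord addn0.
have dkE z (Y : 'M[R]_(l, n)) : U° z ->
    dk f z Y = dir_word [seq row i Y | i <- enum 'I_l] (J^~ z) [::].
  exact: (jet_fun_iter_deriv (rk Y)).2.
have entry_cvg (Y0 : 'M[R]_(l, n)) i j : (fun Y : 'M[R]_(l, n) => Y i j) @ Y0 --> Y0 i j.
  exact: coord_continuous.
split.
- by move=> Y; exact: (jet_fun_iter_deriv (rk Y)).1.
- apply: (@subspace_eq_continuous _ _ _
    (fun z : 'rV[R]_n * 'M[R]_(l, n) => dir_word [seq row i z.2 | i <- enum 'I_l] (J^~ z.1) [::])).
    by move=> [z Y] /set_mem[/= Uz _]; exact: esym (dkE z Y Uz).
  apply/subspace_continuousP => -[z0 Y0] [/= Uz0 _].
  apply: (@cvg_dir_word _ _ _ k l (enum 'I_l) snd Y0 (fun t => J^~ t.1) (J^~ z0)) => //.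
    move=> i j; apply: cvg_within_filter.
    apply: (@cvg_comp _ _ _ snd (fun Y : 'M[R]_(l, n) => Y i j) _ (nbhs Y0)); last exact: entry_cvg.
    exact: cvg_snd.
  move=> w wk; apply/cvg_seminormP => q hq e e0.
  have H := (jJ w (interior_subset Uz0)).1 wk q hq e e0.
  have H2 : \forall t \near (z0, Y0), U t.1 -> q (J w t.1 - J w z0) <= e.
    by exact: (@cvg_fst _ _ (nbhs z0) (nbhs Y0) _ _ H).
  by rewrite /prop_near1 /within; apply: filterS H2 => t H2 [/interior_subset/H2].
- exists (fun t => dir_word [seq row i t.2 | i <- enum 'I_l] (J^~ (set_val t.1)) [::]).
  split; last by move=> x Y Ux; rewrite dkE.
  move=> [x0 Y0].
  apply: (@cvg_dir_word _ _ _ k l (enum 'I_l) snd Y0 (fun t => J^~ (set_val t.1)) (J^~ (set_val x0))) => //.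
    move=> i j.
    apply: (@cvg_comp _ _ _ snd (fun Y : 'M[R]_(l, n) => Y i j) _ (nbhs Y0)); last exact: entry_cvg.
    exact: cvg_snd.
  move=> w wk; apply: (@cvg_comp _ _ _ fst (fun x : U => J w (set_val x)) _ (nbhs x0)).
    exact: cvg_fst.
  exact: jet_fun_continuous.
Qed.

Lemma partial_jet (a : 'I_n -> nat) : (\sum_i a i <= k)%N ->
  partial f a = fun x : U => J (rev (multi_word a)) (set_val x).
Proof.
move=> ak; have mk : (size (multi_word a) <= k)%N by rewrite size_multi_word.
apply: (partial_unique hE diU jet_is_Ck ak).
  by apply: jet_fun_continuous; rewrite size_rev.
move=> x Ux; rewrite multi_directionsE.
have dk' : (size (directions (multi_word a) : seq 'rV[R]_n) <= k)%N by rewrite size_map.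
by rewrite (jet_fun_iter_deriv dk').2// dir_word_directions.
Qed.

End OneJet.

End CkFunctionsOfJets.

(** * The compact-open C^k-topology *)

Section CkSeminorms.
Context {R : realType} {n : nat} {E : tvsType R} (hE : hausdorff_space E).
Implicit Types (U : set 'rV[R]_n) (q : E -> R) (k l : nat).

Lemma Ck_norm_ge0 U l q (K : set U) (f : U -> E) : 0 <= Ck_norm l q K f.
Proof. exact: bigmax_ge_id. Qed.

Lemma Ck_norm_le U l q (K : set U) (f : U -> E) (M : R) : 0 <= M ->
  (forall a : 'I_n -> nat, (\sum_i a i <= l)%N -> forall x, K x -> q (partial f a x) <= M) ->
  Ck_norm l q K f <= M.
Proof.
move=> M0 fM; apply: bigmax_le => // a al.
have [->|/set0P K0] := eqVneq K set0; first by rewrite image_set0 sup0.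
apply: ge_sup; first by case: K0 => x Kx; exists (q (partial f (fun i => a i) x)), x.
by move=> _ [x Kx <-]; apply: fM.
Qed.

Lemma le_Ck_norm U k l q (K : set U) (f : U -> E) (a : 'I_n -> nat) x : is_Ck k f -> (l <= k)%N ->
  continuous_seminorm q -> compact K -> (\sum_i a i <= l)%N -> K x ->
  q (partial f a x) <= Ck_norm l q K f.
Proof.
move=> Cf lk hq cK al Kx.
have ai i : (a i < l.+1)%N by rewrite ltnS (leq_trans _ al)// (bigD1 i)//= leq_addr.
pose b : {ffun 'I_n -> 'I_l.+1} := [ffun i => Ordinal (ai i)].
have -> : a = (fun i => b i : nat) by apply/funext => i; rewrite ffunE.
have bl : (\sum_i b i <= l)%N.
  by rewrite (eq_bigr a)// => i _; rewrite ffunE.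
apply: le_trans (le_bigmax_cond _ _ bl).
have [cb _] := partialP Cf (leq_trans bl lk).
have cq : continuous (fun x => q (partial f (fun i => b i) x) : R^o).
  move=> z; apply: (@continuous_comp _ _ _ _ q); first exact: cb.
  by case: hq => _ _; apply.
have cI : compact ((fun x => q (partial f (fun i => b i) x) : R^o) @` K).
  by apply: continuous_compact cK; exact: continuous_subspaceT.
apply: ub_le_sup; last by exists x.
have [N [_ HN]] := compact_bounded cI; exists (N + 1) => y Ky.
by rewrite (le_trans (ler_norm y))//; apply: HN => //; rewrite ltrDl.
Qed.

Lemma Ck_norm_lincomb U k l q (K : set U) (b : R) (f g : U -> E) :
  has_dense_interior U -> is_Ck k f -> is_Ck k g -> (l <= k)%N ->
  continuous_seminorm q -> compact K ->
  Ck_norm l q K (b *: f + g) <= `|b| * Ck_norm l q K f + Ck_norm l q K g.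
Proof.
move=> diU Cf Cg lk hq cK; apply: Ck_norm_le.
  by rewrite addr_ge0// ?mulr_ge0// Ck_norm_ge0.
move=> a al x Kx; rewrite (partial_lincomb hE _ diU Cf Cg) ?(leq_trans al)//.
rewrite (le_trans (seminormD _ _ hq))// seminormZ// lerD//; last exact: le_Ck_norm Cg _ _ _ _ _.
by rewrite ler_wpM2l//; exact: le_Ck_norm Cf _ _ _ _ _.
Qed.

Lemma Ck_continuousP (T : topologicalType) k U (F : T -> Ck hE k U) :
  (forall B t, Ck_subbase B -> B (F t) -> nbhs t (F @^-1` B)) -> continuous F.
Proof.
move=> H t V; rewrite nbhsE => -[W [[D' sD' <-] [D D'D Dt] DV]].
have [X sX XE] := sD' D D'D.
set P := (X in \bigcap_(B in X) _ = D) in XE.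
have : nbhs t (\bigcap_(B in P) F @^-1` B).
  apply: (@filter_bigI _ _ X (fun B => F @^-1` B) (nbhs t)) => B XB; apply: H; first exact: set_mem (sX B XB).
  by rewrite -XE in Dt; exact: Dt.
apply: filterS => s Xs; apply: DV; exists D => //.
have Ds : (\bigcap_(B in P) B : set (Ck hE k U)) (F s) by move=> B PB; exact: Xs.
by move: Ds; have -> : (\bigcap_(B in P) B : set (Ck hE k U)) = D := XE.
Qed.

Lemma Ck_ball_nbhs k U l q (K : set U) (f : Ck hE k U) (e : R) :
  has_dense_interior U -> (l <= k)%N -> continuous_seminorm q -> compact K -> 0 < e ->
  \forall g \near f, Ck_norm l q K (Ck_fun (g - f)) < e.
Proof.
move=> diU lk hq cK e0; apply: open_nbhs_nbhs; split.
  pose B : set (Ck hE k U) := [set g | Ck_norm l q K (Ck_fun (g - f)) < e].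
  exists [set B]; last by rewrite bigcup_set1.
  move=> _ ->; exists (finmap.fset1 B); last by rewrite set_fset1 bigcap_set1.
  move=> C; rewrite finmap.in_fset1 => /eqP ->; apply/mem_set.
  by exists l, q, K, f, e.
rewrite /= subrr; apply: le_lt_trans e0.
apply: Ck_norm_le => // a al x Kx.
have C0 : is_Ck k (fun=> 0 : E) := is_Ck_cst0 hE k U.
have : partial ((-1) *: (fun _ : U => 0 : E) + (fun=> 0)) a x = 0.
  by rewrite (partial_lincomb hE _ diU C0 C0) ?(leq_trans al)// scaleN1r addNr.
by rewrite scaler0 addr0 => E0; rewrite E0 seminorm0.
Qed.

End CkSeminorms.

(** * The extension operator *)

Section ExtensionOperator.
Context {R : realType} {n : nat} {E : tvsType R} (hE : hausdorff_space E).
Variables (k : nat) (U A : set 'rV[R]_n).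
Hypotheses (AU : A `<=` U) (A_closed : relatively_closed U A)
  (A_lcpt : locally_compact_set A) (A_lc : locally_convex_set A)
  (A_di : has_dense_interior A).
Implicit Types (x z : 'rV[R]_n) (w : seq 'I_n)
  (J K : seq 'I_n -> 'rV[R]_n -> E) (q : E -> R).

Lemma relatively_closedP x : U x -> ~ A x -> ~ closure A x.
Proof.
move=> Ux nAx cx; apply: nAx; pose x' : U := SigSub (mem_set Ux).
apply: (A_closed (t := x')) => B [_ [[V oV <-] /= Vx VB]].
have [y [Ay Vy]] := cx V (open_nbhs_nbhs (conj oV Vx)).
by exists (SigSub (mem_set (AU Ay))); split => //; exact: VB.
Qed.

Lemma locally_compactP z : A z -> exists2 rho : R, 0 < rho &
  exists2 K : set A, compact K &
    forall y : A, `|set_val y - z| < rho -> K y.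
Proof.
move=> Az; pose z' : A := SigSub (mem_set Az).
have [K zK [cK _]] := A_lcpt (x := z') I.
have PQ (y : A) : K y <-> [set set_val y | y in K] (set_val y).
  by split=> [Ky|[y' Ky' /val_inj <-]//]; exists y.
have {}zK : \forall y \near z', K y by apply: (@filterS _ (nbhs z')) zK => y; apply.
have /near_rowP[rho rho0 H] := (sub_nearP z' PQ).1 zK.
exists rho => //; exists K => // y yz; apply/PQ; apply: H => //; exact: set_valP.
Qed.

(** The compact set and the constant serve all jets and all seminorms.  Near [A]
    the compact set is a neighbourhood in [A], by local compactness; off [A] it is
    the finite set of points whose Taylor polynomials are glued near [x0]. *)
Lemma jet_extension : exists ext :
    (seq 'I_n -> 'rV[R]_n -> E) -> (seq 'I_n -> 'rV[R]_n -> E),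
  [/\ forall (b : R) J K w x,
        ext (fun w x => b *: J w x + K w x) w x = b *: ext J w x + ext K w x,
      forall J w x, A x -> ext J w x = J w x,
      forall J, (forall x, symmetric_words (J^~ x)) -> isjet k A J ->
        isjet k U (ext J) &
      forall x0, U x0 -> exists2 rho : R, 0 < rho &
        exists2 K : set A, compact K & exists2 C : R, 0 <= C &
        forall q J M, continuous_seminorm q ->
          (forall x, symmetric_words (J^~ x)) -> isjet k A J -> 0 <= M ->
          (forall w (z : A), (size w <= k)%N -> K z -> q (J w (set_val z)) <= M) ->
          forall x w, U x -> `|x - x0| < rho -> (size w <= k)%N ->
            q (ext J w x) <= C * M].
Proof.
have [A0|/set0P A0] := eqVneq A set0.
  exists (fun _ _ _ => 0); split.
  - by move=> b J K w x; rewrite scaler0 addr0.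
  - by move=> J w x; rewrite A0.
  - by move=> J _ _; exact: isjet_cst0.
  - move=> x0 _; exists 1 => //; exists set0; first exact: compact0.
    by exists 0 => // q J M hq *; rewrite seminorm0// mul0r.
have [I [phi [p [r [C [N [phiP phi_lf phi_sum phi_card [C0 phi_bound]]]]]]]] :=
  whitney_partition k A0.
have UA x : U x -> A x \/ 0 < dist_set A x.
  move=> Ux; have [|nAx] := pselect (A x); [by left|right].
  by apply: dist_set_gt0 => //; exact: relatively_closedP.
exists (jet_ext k A phi p r); split.
- by move=> b J K w x; exact: jet_extP.
- by move=> J w x; exact: jet_extE.
- by move=> J sJ jJ; exact: (isjet_jet_ext A0 phiP phi_lf phi_sum phi_card C0 phi_bound).
move=> x0 Ux0; have M0C (C' M : R) : 0 <= M -> C' * M <= Num.max 0 C' * M.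
  by move=> M0; rewrite ler_wpM2r// le_max lexx orbT.
have max0 (C' : R) : 0 <= Num.max 0 C' by rewrite le_max lexx.
case: (UA x0 Ux0) => [Ax0|dx0].
  have [rho1 rho10 [K cK KP]] := locally_compactP Ax0.
  have [rho rho0 [C' H]] := jet_ext_bound_near (E := E) A0 phiP phi_lf phi_sum phi_card C0
    phi_bound A_lc Ax0 rho10.
  exists rho => //; exists K => //; exists (Num.max 0 C') => // q J M hq sJ jJ M0 JM x w Ux xx wk.
  apply: le_trans (M0C C' M M0); apply: H => //; last exact: UA.
  move=> v z vk Az zx; pose z' : A := SigSub (mem_set Az).
  exact: (JM v z' vk (KP z' zx)).
have [rho rho0 [C' H]] := jet_ext_bound_off (E := E) A0 phi_lf C0 phi_bound dx0.
exists rho => //; pose P i : A := SigSub (mem_set (phiP i).2).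
exists [set y | y \in [seq P i | i <- r x0]].
  by apply: finite_compact; exact: finite_seq.
exists (Num.max 0 C') => // q J M hq sJ jJ M0 JM x w Ux xx wk.
apply: le_trans (M0C C' M M0); apply: H => // v i vk ir.
by apply: (JM v (P i) vk) => /=; exact: map_f.
Qed.

(** The local bounds are made uniform on the compact set [K] by the covering form
    of compactness, applied to the filter of the large pairs of a compact subset
    of [A] and a constant. *)
Lemma extension_operator : exists T : (A -> E) -> (U -> E),
  [/\ forall f, is_Ck k f -> is_Ck k (T f),
      forall (b : R) f g, is_Ck k f -> is_Ck k g -> T (b *: f + g) = b *: T f + T g,
      forall f, is_Ck k f -> T f \o subfun AU = f &
      has_dense_interior U -> forall K : set U, compact K ->
        exists2 K' : set A, compact K' & exists2 C : R, 0 <= C &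
        forall q (f : A -> E), continuous_seminorm q -> is_Ck k f ->
          forall a : 'I_n -> nat, (\sum_i a i <= k)%N -> forall x : U, K x ->
            q (partial (T f) a x) <= C * Ck_norm k q K' f].
Proof.
have [ext [extP extE extJ ext_bound]] := jet_extension.
have jA (f : A -> E) : is_Ck k f -> isjet k A (Ck_jet k f) by exact: isjet_Ck_jet.
have jU (f : A -> E) : is_Ck k f -> isjet k U (ext (Ck_jet k f)).
  by move=> Cf; apply: extJ (jA f Cf) => x; exact: Ck_jet_symmetric.
exists (fun f (x : U) => ext (Ck_jet k f) [::] (set_val x)); split.
- by move=> f /jU; exact: jet_is_Ck.
- move=> b f g Cf Cg; apply/funext => x.
  rewrite -[RHS]extP; congr (ext _ _ _); apply/funext => w; apply/funext => z.
  exact: Ck_jet_lincomb.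
- move=> f Cf; apply/funext => x.
  have Ax := set_valP x.
  rewrite /= extE// (Ck_jet_nil hE A_di Cf); exact: valL0E.
move=> diU K cK.
pose large (S : set (set A * R)) := exists2 K0 : set A, compact K0 &
  exists2 C0 : R, 0 <= C0 & forall (K' : set A) C, compact K' ->
    K0 `<=` K' -> C0 <= C -> S (K', C).
have large_filter : Filter large.
  split.
  - by exists set0; [exact: compact0|exists 0].
  - move=> S1 S2 [K1 cK1 [C1 C10 H1]] [K2 cK2 [C2 C20 H2]].
    exists (K1 `|` K2); first exact: compactU.
    exists (Num.max C1 C2); first by rewrite le_max C10.
    move=> K' C cK'; rewrite subUset ge_max => -[K1' K2'] /andP[CC1 CC2].
    by split; [exact: H1|exact: H2].
  - move=> S1 S2 S12 [K1 cK1 [C1 C10 H1]]; exists K1 => //; exists C1 => // *.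
    by apply: S12; exact: H1.
pose P (i : set A * R) (x : U) := forall q (f : A -> E) w, continuous_seminorm q -> is_Ck k f ->
  (size w <= k)%N -> q (ext (Ck_jet k f) w (set_val x)) <= i.2 * Ck_norm k q i.1 f.
have [K' cK' [C C0 H]] : large [set i | K `<=` P i].
  have NC := (compact_near_coveringP K).1 cK.
  apply: (NC (set A * R)%type large P large_filter) => x Kx.
  have [rho rho0 [K1 cK1 [C1 C10 H1]]] := ext_bound _ (set_valP x).
  exists ([set y : U | `|set_val y - set_val x| < rho],
    [set i | compact i.1 /\ K1 `<=` i.1 /\ C1 <= i.2]).
    split; last by exists K1 => //; exists C1.
    have PQ (y : U) : `|set_val y - set_val x| < rho <-> `|set_val y - set_val x| < rho by [].
    apply: (sub_nearP x (Q := fun z => `|z - set_val x| < rho) PQ).2.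
    by apply/near_rowP; exists rho.
  move=> [y [K' C']] [/= yx [cK' [K1K' C1C']]] q f w hq Cf wk /=.
  rewrite (@le_trans _ _ (C1 * Ck_norm k q K' f))//; last first.
    by rewrite ler_wpM2r// Ck_norm_ge0.
  apply: (H1 q (Ck_jet k f)) => //.
  - by move=> z; exact: Ck_jet_symmetric.
  - exact: jA.
  - exact: Ck_norm_ge0.
  - move=> v z vk K1z; rewrite /Ck_jet vk valL0E.
    have vk' : (\sum_i count_mem i v <= k)%N by rewrite sum_count.
    exact: (le_Ck_norm Cf (leqnn k) hq cK' vk' (K1K' z K1z)).
  - exact: set_valP.
exists K' => //; exists C => // q f hq Cf a ak x Kx.
rewrite (partial_jet hE diU (jU f Cf) ak).
by apply: (H K' C cK' (@subset_refl _ _) (lexx C)) => //; rewrite size_rev size_multi_word.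
Qed.

End ExtensionOperator.

Theorem mainTheorem2 (R : realType) (E : tvsType R) (hE : hausdorff_space E)
    (n k : nat) (n_gt0 : (0 < n)%N) (U A : set 'rV[R]_n)
    (U_lc : locally_convex_set U) (U_di : has_dense_interior U)
    (AU : A `<=` U) (A_closed : relatively_closed U A)
    (A_lcpt : locally_compact_set A)
    (A_lc : locally_convex_set A) (A_di : has_dense_interior A) :
  exists Phi : {linear Ck hE k A -> Ck hE k U},
    continuous (Phi : Ck hE k A -> Ck hE k U) /\
    cancel (Phi : Ck hE k A -> Ck hE k U) (Ck_restr AU).
Proof.
have [T [TCk Tlin TK Tbound]] :=
  extension_operator hE k AU A_closed A_lcpt A_lc A_di.
have CkP (V : set 'rV[R]_n) (f : Ck hE k V) : is_Ck k (Ck_fun f) by apply/asboolP; exact: Ck_funP.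
pose Phi (f : Ck hE k A) : Ck hE k U := MkCk hE (asboolT (TCk f (CkP A f))).
have Phi_lin : linear Phi.
  by move=> b f g; apply: val_inj; exact: (Tlin b f g (CkP A f) (CkP A g)).
suff Phi_cont : continuous Phi.
  pose Phi_isLinear := GRing.isLinear.Build _ _ _ _ Phi Phi_lin.
  exists (HB.pack Phi Phi_isLinear : {linear _ -> _}); split; first exact: Phi_cont.
  by move=> f; apply: val_inj; exact: TK.
apply: Ck_continuousP => _ f [l [q [K [f1 [e [lk hq cK e0 ->]]]]]].
pose s := Ck_norm l q K (Ck_fun (Phi f - f1)).
rewrite -[_ (Phi f)]/(is_true (s < e)) => fe.
have [K' cK' [C C0 HC]] := Tbound U_di K cK.
have C10 : 0 < C + 1 by rewrite ltr_wpDl.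
(* the radius is such that [Phi] maps the ball around [f] into the given one *)
have r0 : 0 < (e - s) / (C + 1) by rewrite divr_gt0 ?subr_gt0.
apply: filterS (Ck_ball_nbhs f A_di (leqnn k) hq cK' r0) => g /=.
set t := Ck_norm k q K' _ => tr.
have t0 : 0 <= t by exact: Ck_norm_ge0.
have gs : Ck_norm l q K (Ck_fun (Phi (g - f))) <= C * t.
  apply: Ck_norm_le => [|a al x Kx]; first by rewrite mulr_ge0.
  by apply: HC => //; rewrite (leq_trans al).
suff : Ck_norm l q K (Ck_fun (Phi g - f1)) < e by [].
have -> : Phi g - f1 = 1 *: Phi (g - f) + (Phi f - f1).
  have -> : g - f = (-1) *: f + g by rewrite scaleN1r addrC.
  by rewrite Phi_lin scaleN1r scale1r addrACA addrA addNr add0r addrC.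
have := Ck_norm_lincomb hE 1 U_di (CkP _ (Phi (g - f))) (CkP _ (Phi f - f1)) lk hq cK.
move=> /le_lt_trans; apply; rewrite normr1 mul1r -/s.
rewrite (le_lt_trans (lerD gs (lexx s)))//.
rewrite -ltrBrDr; move: tr; rewrite ltr_pdivlMr// => tr.
by rewrite (le_lt_trans _ tr)// mulrDr mulr1 mulrC lerDl.
Qed.
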